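(* For every $d>0$ there is $\varepsilon_d>0$ and a simple branching algorithm which, given any graph $G=(V,E)$ and any subset $X\subseteq V$ with $|X|\ge d\cdot|V|$, enumerates all minimal dominating sets of $G$ that are subsets of $X$ in $O^*\left((2-\varepsilon_d)^{|X|}\right)$ time.
   Context: A dominating set of $G$ is a set $D\subseteq V$ such that every vertex of $V$ is in $D$ or adjacent to a vertex of $D$; it is minimal if no proper subset is dominating. A simple branching algorithm is a classical branching algorithm in which the exploration of each root-to-leaf path of its search tree is independent of the other paths; it enumerates a family if each leaf finds at most one member and collectively the leaves find all members (duplicates allowed). $O^*$ hides polynomial factors. *)

(* Defs.v *)
From HB Require Import structures.
From mathcomp Require Import all_boot all_order all_algebra.
From mathcomp Require Import reals.

Set Implicit Arguments.
Unset Strict Implicit.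
Unset Printing Implicit Defensive.

(* Computation model: a WHILE language on binary trees, extended with a binary
   branching command.  Trees are manipulated only by cons, head, tail and a
   test for nil, each of which takes constant time on a pointer machine, so
   step counts are polynomially related to Turing machine time. *)

Inductive data : Type := Nil | Cons of data & data.

Definition hd (v : data) : data := if v is Cons a _ then a else Nil.
Definition tl (v : data) : data := if v is Cons _ b then b else Nil.
Definition truthy (v : data) : bool := if v is Cons _ _ then true else false.

Inductive expr : Type :=
  | EVar of nat
  | ENil
  | ECons of expr & expr
  | EHd of expr
  | ETl of expr.

Definition store : Type := nat -> data.

Definition update (s : store) (x : nat) (v : data) : store :=
  fun y => if y == x then v else s y.

Fixpoint eval (s : store) (a : expr) : data :=
  match a with
  | EVar x => s x
  | ENil => Nil
  | ECons a1 a2 => Cons (eval s a1) (eval s a2)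
  | EHd a1 => hd (eval s a1)
  | ETl a1 => tl (eval s a1)
  end.

Inductive com : Type :=
  | Skip
  | Assign of nat & expr
  | Seq of com & com
  | If of expr & com & com
  | While of expr & com
  | Branch of com & com.

(* A search tree records every elementary step.  Its root-to-leaf paths are the
   runs of the program under the possible resolutions of Branch; each leaf
   carries the value that its run reports. *)
Inductive search_tree : Type :=
  | Leaf of data
  | Step of search_tree
  | Fork of search_tree & search_tree.

(* [explores k s t]: running the commands of the stack k from the store s
   terminates on all branches, with search tree t.  At a Branch both sides
   continue from their own copy of the store, so nothing is communicated
   between different root-to-leaf paths.  Register 0 holds the result. *)
Inductive explores : seq com -> store -> search_tree -> Prop :=
  | explores_halt s : explores [::] s (Leaf (s 0))
  | explores_skip k s t :
      explores k s t -> explores (Skip :: k) s (Step t)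
  | explores_assign x a k s t :
      explores k (update s x (eval s a)) t ->
      explores (Assign x a :: k) s (Step t)
  | explores_seq c1 c2 k s t :
      explores [:: c1, c2 & k] s t -> explores (Seq c1 c2 :: k) s (Step t)
  | explores_if a c1 c2 k s t :
      explores ((if truthy (eval s a) then c1 else c2) :: k) s t ->
      explores (If a c1 c2 :: k) s (Step t)
  | explores_while a c k s t :
      explores (if truthy (eval s a) then [:: c, While a c & k] else k) s t ->
      explores (While a c :: k) s (Step t)
  | explores_branch c1 c2 k s t1 t2 :
      explores (c1 :: k) s t1 -> explores (c2 :: k) s t2 ->
      explores (Branch c1 c2 :: k) s (Fork t1 t2).

Definition init_store (v : data) : store :=
  fun x => if x == 0 then v else Nil.

Definition search_tree_of (A : com) (v : data) (t : search_tree) : Prop :=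
  explores [:: A] (init_store v) t.

(* Time needed to explore the whole search tree. *)
Fixpoint total_time (t : search_tree) : nat :=
  match t with
  | Leaf _ => 1
  | Step t1 => (total_time t1).+1
  | Fork t1 t2 => (total_time t1 + total_time t2).+1
  end.

(* Time spent along the longest root-to-leaf path. *)
Fixpoint path_time (t : search_tree) : nat :=
  match t with
  | Leaf _ => 1
  | Step t1 => (path_time t1).+1
  | Fork t1 t2 => (maxn (path_time t1) (path_time t2)).+1
  end.

Fixpoint has_leaf (t : search_tree) (v : data) : Prop :=
  match t with
  | Leaf w => w = v
  | Step t1 => has_leaf t1 v
  | Fork t1 t2 => has_leaf t1 v \/ has_leaf t2 v
  end.

Lemma search_tree_of_uniq (A : com) (v : data) (t t' : search_tree) :
  search_tree_of A v t -> search_tree_of A v t' -> t = t'.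
Proof.
rewrite /search_tree_of; move: [:: A] (init_store v) => k s Ht.
elim: Ht t' => {k s t} [s|k s t _ IH|x a k s t _ IH|c1 c2 k s t _ IH
  |a c1 c2 k s t _ IH|a c k s t _ IH|c1 c2 k s t1 t2 _ IH1 _ IH2] t' Ht';
  inversion Ht'; subst=> //; f_equal; auto.
Qed.

Definition data_of_bool (b : bool) : data := if b then Cons Nil Nil else Nil.

Definition data_of_seq (s : seq data) : data := foldr Cons Nil s.

Definition data_of_set (V : finType) (D : {set V}) : data :=
  data_of_seq [seq data_of_bool (x \in D) | x <- enum V].

Definition data_of_rel (V : finType) (e : rel V) : data :=
  data_of_seq
    [seq data_of_seq [seq data_of_bool (e x y) | y <- enum V] | x <- enum V].

Definition data_of_instance (V : finType) (e : rel V) (X : {set V}) : data :=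
  Cons (data_of_rel e) (data_of_set X).

Definition found_nothing : data := Nil.
(* The outer Cons tells "the empty set was found" (for V empty) apart from
   "nothing was found". *)
Definition found (V : finType) (D : {set V}) : data := Cons Nil (data_of_set D).

(* A leaf finds at most one member, nothing else is ever reported, and every
   member is found by at least one leaf. *)
Definition enumerates (V : finType) (t : search_tree) (F : pred {set V}) : Prop :=
  (forall v, has_leaf t v ->
     v = found_nothing \/ (exists D : {set V}, F D /\ v = found D)) /\
  (forall D : {set V}, F D -> has_leaf t (found D)).

Definition dominating (V : finType) (e : rel V) : pred {set V} :=
  fun D => [forall v, (v \in D) || [exists u in D, e u v]].

Definition minimal_dominating (V : finType) (e : rel V) : pred {set V} :=
  minset (dominating e).

(* Main.v *)
Require Import Defs.
From HB Require Import structures.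
From mathcomp Require Import all_boot all_order all_algebra.
From mathcomp Require Import reals.
From mathcomp Require Import zify ring lra.
(* mathcomp's seq.v shadows the constructors Nil and Cons of data. *)
Import Defs.

Set Implicit Arguments.
Unset Strict Implicit.
Unset Printing Implicit Defensive.

(* The minimal dominating sets inside X are the minimal transversals of the
   hyperedges N[v] :&: X; there are n <= C * #|X| of them on N = #|X| vertices.
   Fix a large block size k.  Going through the hyperedges, choose in each a
   block of k vertices, using no vertex in more than D blocks.  A hyperedge is
   long if this succeeds and short otherwise; the vertices used D times are
   saturated, there are at most k n / D <= N / 4 of them, and a short hyperedge
   has fewer than k unsaturated vertices.

   Let T be a minimal transversal, so that each vertex of T is the only vertex
   of T in some (private) hyperedge.  If there are q = N / (4 k D) disjoint
   blocks with at most one vertex in T, guess them: each costs k + 1 patterns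
   instead of 2^k, which for large k pays for guessing which blocks they are.
   Otherwise at most k D q <= N / 4 blocks contain at most one vertex of T, so
   few vertices of T have a long private hyperedge.  Guess T on the saturated
   vertices, then go through the short hyperedges and, while one is not hit,
   branch on its undecided vertices up to the first one in T: a hyperedge with
   j < k of them costs b^-1 + ... + b^-j <= 1 for b = 2 - 2^-k.  An undecided
   vertex of T then has a long private hyperedge, hence at most N / 4 of the
   remaining vertices are in T.

   The blocks must be chosen beforehand, independently of T: guessing private
   long hyperedges adaptively would cost as much as the branching on short ones
   saves. *)

(** * A structured language compiled to com *)

(** A run cannot know which case T falls into, so the program branches into both strategies and
    tests every candidate at the end. Soundness then rests on the test alone; what remains is a path
    to each T and a count of leaves. Leaves are counted by weights whose sum over the children does
    not exceed the weight of the parent. With u undecided vertices and q blocks still to declare,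
    the weight is 2^u / 2^q times a factor per remaining hyperedge. Declaring a block trades 2^k for
    k + 1 patterns and a factor 2, so a hyperedge costs 1 + 2 (k + 1) / 2^k. There are at most C N
    of them and N / q is about 4 k D, polynomial in k, so a large k keeps the total cost below
    (4/3)^(q + 1), against the gain 2^q. In the other strategy, with b vertices still allowed, the
    weight is lam^b beta^u up to a linear factor, where beta = 2 - delta, lam = 1 / (1 - delta) and
    delta = 2^-k. To first order lam costs 1 + delta and each beta / 2 gains 1 - delta / 2. Hence 2
    lam beta^3 < 2^4, which is why it is enough that a quarter of the vertices is saturated and the
    budget b is a quarter. *)

Lemma data_eq_dec (u v : data) : decidable (u = v).
Proof. by rewrite /decidable; decide equality. Qed.
HB.instance Definition _ := hasDecEq.Build data (compareP data_eq_dec).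

Inductive fexpr : Type :=
  | FId
  | FNil
  | FCons of fexpr & fexpr
  | FHd of fexpr
  | FTl of fexpr.

Fixpoint feval (v : data) (a : fexpr) : data :=
  match a with
  | FId => v
  | FNil => Nil
  | FCons a1 a2 => Cons (feval v a1) (feval v a2)
  | FHd a1 => hd (feval v a1)
  | FTl a1 => tl (feval v a1)
  end.

Fixpoint fcompile (a : fexpr) : expr :=
  match a with
  | FId => EVar 0
  | FNil => ENil
  | FCons a1 a2 => ECons (fcompile a1) (fcompile a2)
  | FHd a1 => EHd (fcompile a1)
  | FTl a1 => ETl (fcompile a1)
  end.

Lemma eval_fcompile (s : store) (a : fexpr) :
  eval s (fcompile a) = feval (s 0) a.
Proof. by elim: a => //= [a1 -> a2 ->|a ->|a ->]. Qed.

(** A program acts on one tree instead of a store, and its only loop runs exactly [n] times.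
    Termination and a polynomial time bound can then be read off the syntax. *)
Inductive prog : Type :=
  | PAsg of fexpr
  | PSeq of prog & prog
  | PIf of fexpr & prog & prog
  | PRep of prog
  | PBranch of prog & prog
  | PFirst of prog.

Fixpoint nd_iter (f : data -> seq data) (m : nat) (v : data) : seq data :=
  if m is m'.+1 then flatten [seq nd_iter f m' w | w <- f v] else [:: v].

(** A list with repetitions rather than a set, since its length has to be the number of leaves. *)
Fixpoint sem (n : nat) (p : prog) (v : data) : seq data :=
  match p with
  | PAsg a => [:: feval v a]
  | PSeq p1 p2 => flatten [seq sem n p2 w | w <- sem n p1 v]
  | PIf a p1 p2 => if truthy (feval v a) then sem n p1 v else sem n p2 v
  | PRep p1 => nd_iter (sem n p1) n v
  | PBranch p1 p2 => sem n p1 v ++ sem n p2 v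
  | PFirst p1 => [seq Cons w (tl v) | w <- sem n p1 (hd v)]
  end.

(* Register 0 holds the state, 1 a list of length n that is never modified,
   2 a stack for the frames of PFirst, and 3 + l the counter of the PRep at
   nesting level l. *)
Fixpoint compile (l : nat) (p : prog) : com :=
  match p with
  | PAsg a => Assign 0 (fcompile a)
  | PSeq p1 p2 => Seq (compile l p1) (compile l p2)
  | PIf a p1 p2 => If (fcompile a) (compile l p1) (compile l p2)
  | PRep p1 =>
      Seq (Assign l.+3 (EVar 1))
          (While (EVar l.+3)
             (Seq (Assign l.+3 (ETl (EVar l.+3))) (compile l.+1 p1)))
  | PBranch p1 p2 => Branch (compile l p1) (compile l p2)
  | PFirst p1 =>
      Seq (Assign 2 (ECons (ETl (EVar 0)) (EVar 2)))
     (Seq (Assign 0 (EHd (EVar 0)))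
     (Seq (compile l p1)
     (Seq (Assign 0 (ECons (EVar 0) (EHd (EVar 2))))
          (Assign 2 (ETl (EVar 2))))))
  end.

Fixpoint ptime (n : nat) (p : prog) : nat :=
  match p with
  | PAsg _ => 1
  | PSeq p1 p2 => (ptime n p1 + ptime n p2).+1
  | PIf _ p1 p2 => (maxn (ptime n p1) (ptime n p2)).+1
  | PRep p1 => n * (ptime n p1).+3 + 3
  | PBranch p1 p2 => (maxn (ptime n p1) (ptime n p2)).+1
  | PFirst p1 => (ptime n p1) + 8
  end.

(** One number serves as coefficient and as exponent, the shape of the bounds in the theorem. *)
Fixpoint pdeg (p : prog) : nat :=
  match p with
  | PAsg _ => 1
  | PSeq p1 p2 => (pdeg p1 + pdeg p2).+1
  | PIf _ p1 p2 => (pdeg p1 + pdeg p2).+1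
  | PRep p1 => pdeg p1 + 6
  | PBranch p1 p2 => (pdeg p1 + pdeg p2).+1
  | PFirst p1 => pdeg p1 + 8
  end.

Lemma ptime_le (n : nat) (p : prog) : ptime n p <= pdeg p * n.+1 ^ pdeg p.
Proof.
have S a b c d : c <= a * n.+1 ^ a -> d <= b * n.+1 ^ b ->
    (c + d).+1 <= (a + b).+1 * n.+1 ^ (a + b).+1.
  move=> ca db; rewrite -addnS.
  have ha : n.+1 ^ a <= n.+1 ^ (a + b.+1) by rewrite leq_pexp2l // leq_addr.
  have hb : n.+1 ^ b <= n.+1 ^ (a + b.+1).
    by rewrite leq_pexp2l // addnS leqW // leq_addl.
  have h1 : 0 < n.+1 ^ (a + b.+1) by rewrite expn_gt0.
  rewrite -addnS mulnDl mulSn.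
  have := leq_mul (leqnn a) ha; have := leq_mul (leqnn b) hb; lia.
have S' a b c d : c <= a * n.+1 ^ a -> d <= b * n.+1 ^ b ->
    (maxn c d).+1 <= (a + b).+1 * n.+1 ^ (a + b).+1.
  by move=> ca db; apply: leq_trans (S _ _ _ _ ca db); lia.
elim: p => [a|p1 IH1 p2 IH2|a p1 IH1 p2 IH2|p IH|p1 IH1 p2 IH2|p IH] //=.
- exact: S.
- exact: S'.
- have h : n.+1 ^ (pdeg p) * n.+1 <= n.+1 ^ (pdeg p + 6).
    by rewrite -expnSr leq_pexp2l // addnS ltnS leq_addr.
  have h1 : 0 < n.+1 ^ pdeg p by rewrite expn_gt0.
  apply: (@leq_trans ((pdeg p + 6) * (n.+1 ^ pdeg p * n.+1))).
    rewrite mulnA; move: IH h1; rewrite mulnDl; nia.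
  by rewrite leq_mul2l h orbT.
- exact: S'.
- have h : n.+1 ^ (pdeg p) <= n.+1 ^ (pdeg p + 8).
    by rewrite leq_pexp2l // leq_addr.
  have h1 : 0 < n.+1 ^ (pdeg p + 8) by rewrite expn_gt0.
  have := leq_mul (leqnn (pdeg p)) h; rewrite mulnDl; lia.
Qed.

(** * Leaves of search trees and correctness of the compiler *)

Fixpoint leaves (t : search_tree) : seq data :=
  match t with
  | Leaf v => [:: v]
  | Step t1 => leaves t1
  | Fork t1 t2 => leaves t1 ++ leaves t2
  end.

Lemma has_leafE (t : search_tree) (v : data) :
  has_leaf t v <-> v \in leaves t.
Proof.
elim: t => [w|t IH|t1 IH1 t2 IH2] //=.
  by rewrite inE; split=> [->|/eqP ->].
rewrite mem_cat; split.
  by case=> [/IH1 ->|/IH2 ->] //; rewrite orbT.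
by case/orP => [/IH1|/IH2]; [left|right].
Qed.

Lemma leaves_gt0 (t : search_tree) : 0 < size (leaves t).
Proof. by elim: t => //= t1 IH1 t2 IH2; rewrite size_cat addn_gt0 IH1. Qed.

(** Every node lies on a root-to-leaf path. This reduces the time bound to counting leaves. *)
Lemma total_time_le (t : search_tree) :
  total_time t <= size (leaves t) * path_time t.
Proof.
elim: t => [w|t IH|t1 IH1 t2 IH2] //=.
  by have := leaves_gt0 t; nia.
rewrite size_cat; have := leaves_gt0 t1; have := leaves_gt0 t2.
move: IH1 IH2 (leq_maxl (path_time t1) (path_time t2)).
move: (leq_maxr (path_time t1) (path_time t2)); set m := maxn _ _; nia.
Qed.

Definition runs (k : seq com) (s : store) (T : nat) (vs : seq data) : Prop :=
  exists t, [/\ explores k s t, path_time t <= T & leaves t = vs].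

Lemma runs_halt s T : 0 < T -> runs [::] s T [:: s 0].
Proof. by move=> T0; exists (Leaf (s 0)); split=> //; constructor. Qed.

Lemma runs_assign x a k s T vs :
  runs k (update s x (eval s a)) T vs -> runs (Assign x a :: k) s T.+1 vs.
Proof. by case=> t [h1 h2 h3]; exists (Step t); split=> //; constructor. Qed.

Lemma runs_seq c1 c2 k s T vs :
  runs [:: c1, c2 & k] s T vs -> runs (Seq c1 c2 :: k) s T.+1 vs.
Proof. by case=> t [h1 h2 h3]; exists (Step t); split=> //; constructor. Qed.

Lemma runs_if a c1 c2 k s T vs :
  runs ((if truthy (eval s a) then c1 else c2) :: k) s T vs ->
  runs (If a c1 c2 :: k) s T.+1 vs.
Proof. by case=> t [h1 h2 h3]; exists (Step t); split=> //; constructor. Qed.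

Lemma runs_while a c k s T vs :
  runs (if truthy (eval s a) then [:: c, While a c & k] else k) s T vs ->
  runs (While a c :: k) s T.+1 vs.
Proof. by case=> t [h1 h2 h3]; exists (Step t); split=> //; constructor. Qed.

Lemma runs_branch c1 c2 k s T vs1 vs2 :
  runs (c1 :: k) s T vs1 -> runs (c2 :: k) s T vs2 ->
  runs (Branch c1 c2 :: k) s T.+1 (vs1 ++ vs2).
Proof.
move=> [t1 [h1 p1 <-]] [t2 [h2 p2 <-]]; exists (Fork t1 t2).
by split=> //=; [constructor|rewrite ltnS geq_max p1].
Qed.

Lemma runs_le k s T T' vs : T <= T' -> runs k s T vs -> runs k s T' vs.
Proof.
by move=> TT' [t [h1 h2 h3]]; exists t; split=> //; apply: leq_trans TT'.
Qed.

(** What code at nesting level [l] must leave alone: the loop bound, the stack and the counters of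
    the enclosing loops. Counters of deeper loops may hold anything. *)
Definition same_frame (l : nat) (s s' : store) : Prop :=
  forall x, 0 < x < l.+3 -> s' x = s x.

Lemma same_frameW l s s' : same_frame l.+1 s s' -> same_frame l s s'.
Proof. by move=> h x /andP[x0 xl]; apply: h; rewrite x0 ltnW. Qed.

Lemma same_frame_trans l s s' s'' :
  same_frame l s s' -> same_frame l s' s'' -> same_frame l s s''.
Proof. by move=> h h' x xl; rewrite h' // h. Qed.

Lemma same_frame_update l s x v :
  (x == 0) || (l.+3 <= x) -> same_frame l s (update s x v).
Proof.
by move=> hx y hy; rewrite /update; case: eqP => // yx; lia.
Qed.

Fixpoint spine (v : data) : nat := if v is Cons _ b then (spine b).+1 else 0.

(** Continuation-passing form: the leaves of the rest [k] are a function [F] of register 0 alone,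
    for every store with the same frame. This makes the induction go through sequencing and through
    the two sides of a branch. *)
Lemma runs_compile (p : prog) (l : nat) (k : seq com) (s : store) (T : nat)
    (F : data -> seq data) :
  (forall s', same_frame l s s' -> runs k s' T (F (s' 0))) ->
  runs (compile l p :: k) s (ptime (spine (s 1)) p + T)
       (flatten [seq F v | v <- sem (spine (s 1)) p (s 0)]).
Proof.
elim: p l k s T F => [a|p1 IH1 p2 IH2|a p1 IH1 p2 IH2|p IH|p1 IH1 p2 IH2|p IH]
  l k s T F hk /=.
- rewrite cats0 add1n; apply: runs_assign; rewrite eval_fcompile.
  by apply: (hk (update s 0 _)); exact: same_frame_update.
- rewrite addSn -addnA; apply: runs_seq.
  rewrite [X in runs _ _ _ X](_ : _ = flatten
     [seq flatten [seq F v | v <- sem (spine (s 1)) p2 w]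
         | w <- sem (spine (s 1)) p1 (s 0)]); last first.
    by elim: (sem _ p1 _) => //= w ws <-; rewrite map_cat flatten_cat.
  apply: (IH1 l (compile l p2 :: k) s _
    (fun w => flatten [seq F v | v <- sem (spine (s 1)) p2 w])).
  move=> s' ss'; rewrite -(ss' 1) //; apply: IH2 => s'' ss''.
  by apply: hk; apply: same_frame_trans ss''.
- rewrite addSn; apply: runs_if; rewrite eval_fcompile; case: ifP => _.
    by apply: runs_le (IH1 _ _ _ _ _ hk); rewrite leq_add2r leq_maxl.
  by apply: runs_le (IH2 _ _ _ _ _ hk); rewrite leq_add2r leq_maxr.
- set n := spine (s 1); set W := While _ _.
  (* The body is compiled one level deeper and so preserves this counter, whose length [m] is the
     number of rounds left. *)
  have loop m s0 : same_frame l s s0 -> spine (s0 l.+3) = m ->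
      runs (W :: k) s0 ((m * (ptime n p).+3 + T).+1)
        (flatten [seq F v | v <- nd_iter (sem n p) m (s0 0)]).
    elim: m s0 => [|m IHm] s0 fr0 h0 /=; apply: runs_while => /=.
      by rewrite cats0 mul0n add0n; case: (s0 l.+3) h0 => //= _; apply: hk.
    case E: (s0 l.+3) h0 => [|a b] //= [hb].
    rewrite mulSn -addnA !addSn.
    apply: runs_seq; apply: runs_assign => /=; rewrite E /=.
    set s1 := update _ _ _.
    have fr1 : same_frame l s0 s1.
      by apply: same_frame_update; rewrite leqnn orbT.
    have s11 : s1 1 = s 1 by rewrite fr1 // fr0.
    have -> : s0 0 = s1 0 by [].
    rewrite [X in runs _ _ _ X](_ : _ = flatten
       [seq flatten [seq F v | v <- nd_iter (sem n p) m w]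
           | w <- sem n p (s1 0)]); last first.
      by elim: (sem n p _) => //= w ws <-; rewrite map_cat flatten_cat.
    have -> : n = spine (s1 1) by rewrite s11.
    rewrite -addnS.
    apply: (IH l.+1 _ s1 _
      (fun w => flatten [seq F v | v <- nd_iter (sem (spine (s1 1)) p) m w])).
    move=> s2 fr2; rewrite s11; apply: IHm.
      by apply: same_frame_trans (same_frameW fr2); apply: same_frame_trans fr1.
    by rewrite fr2 ?ltnS ?leqnn // /s1 /update eqxx.
  have -> : n * (ptime n p).+3 + 3 + T = (n * (ptime n p).+3 + T).+3 by lia.
  apply: runs_seq; apply: runs_assign => /=.
  set s0 := update _ _ _; have -> : s 0 = s0 0 by [].
  apply: loop; last by rewrite /s0 /update eqxx.
  by apply: same_frame_update; rewrite leqnn orbT.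
- by rewrite map_cat flatten_cat addSn; apply: runs_branch;
    [apply: runs_le (IH1 _ _ _ _ _ hk)|apply: runs_le (IH2 _ _ _ _ _ hk)];
    rewrite leq_add2r ?leq_maxl ?leq_maxr.
- have -> : ptime (spine (s 1)) p + 8 + T = (ptime (spine (s 1)) p + T.+3).+4.+1.
    by lia.
  do 2 (apply: runs_seq; apply: runs_assign); apply: runs_seq.
  set s1 := update _ _ _.
  have s10 : s1 0 = hd (s 0) by [].
  have s12 : s1 2 = Cons (tl (s 0)) (s 2) by [].
  have fr x : x != 0 -> x != 2 -> s1 x = s x.
    by rewrite /s1 /update /= => /negPf -> /negPf ->.
  have -> : s 1 = s1 1 by rewrite fr.
  rewrite -s10 -map_comp.
  apply: (IH l _ s1 T.+3 (fun w => F (Cons w (tl (s 0))))) => s2 fr2.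
  apply: runs_seq; do 2 apply: runs_assign.
  set s3 := update _ _ _.
  have s30 : s3 0 = Cons (s2 0) (tl (s 0)).
    by rewrite /s3 /update /= (fr2 2) // s12.
  rewrite -s30; apply: hk => x /andP[x0 xl].
  rewrite /s3 /update /=; case: eqP => [->|/eqP x2].
    by rewrite (fr2 2) // s12.
  by rewrite (gtn_eqF x0) fr2 ?x0 // fr // -lt0n.
Qed.

(** The head of the input is the adjacency matrix. As a list it has one entry per vertex, so it can
    be used directly as the loop bound. *)
Definition algorithm_of (p : prog) : com :=
  Seq (Assign 1 (EHd (EVar 0))) (compile 0 p).

Lemma search_tree_of_algorithm (p : prog) (v : data) :
  exists t, [/\ search_tree_of (algorithm_of p) v t,
    path_time t <= ptime (spine (hd v)) p + 3
    & leaves t = sem (spine (hd v)) p v].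
Proof.
suff [t [h1 h2 h3]] : runs [:: algorithm_of p] (init_store v)
    (ptime (spine (hd v)) p + 1).+2 (sem (spine (hd v)) p v).
  by exists t; split=> //; apply: leq_trans h2 _; lia.
apply: runs_seq; apply: runs_assign => /=.
set s := update _ _ _.
have -> : sem (spine (hd v)) p v =
   flatten [seq [:: w] | w <- sem (spine (s 1)) p (s 0)].
  by rewrite flatten_map1 map_id.
apply: (@runs_compile p 0 [::] s 1 (fun w => [:: w])) => s' _.
exact: runs_halt.
Qed.

Lemma sem_seq n p1 p2 v :
  sem n (PSeq p1 p2) v = flatten [seq sem n p2 w | w <- sem n p1 v].
Proof. by []. Qed.

Lemma sem_asg_seq n a p v : sem n (PSeq (PAsg a) p) v = sem n p (feval v a).
Proof. by rewrite /= cats0. Qed.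

Lemma sem_if n a p1 p2 v :
  sem n (PIf a p1 p2) v =
  if truthy (feval v a) then sem n p1 v else sem n p2 v.
Proof. by []. Qed.

Lemma sem_branch n p1 p2 v :
  sem n (PBranch p1 p2) v = sem n p1 v ++ sem n p2 v.
Proof. by []. Qed.

Lemma sem_first n p v :
  sem n (PFirst p) v = [seq Cons w (tl v) | w <- sem n p (hd v)].
Proof. by []. Qed.

(** * Nondeterministic loops over parallel lists *)

Lemma flatten_map_cons (A B : Type) (f : A -> seq B) (x : A) (l : seq A) :
  flatten [seq f y | y <- x :: l] = f x ++ flatten [seq f y | y <- l].
Proof. by []. Qed.

Fixpoint foldM (A I : Type) (g : A -> I -> seq A) (a : A) (l : seq I) : seq A :=
  if l is i :: l' then flatten [seq foldM g b l' | b <- g a i] else [:: a].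

(** Weaker than being the encoding of [l]: since [hd] and [tl] of [Nil] are [Nil], a tree that is
    too short reads as if padded with values encoded by [Nil]. Dummy lists can therefore be passed
    as [Nil]. *)
Fixpoint reads (A : Type) (enc : A -> data) (v : data) (l : seq A) : Prop :=
  if l is x :: l' then hd v = enc x /\ reads enc (tl v) l' else True.

Lemma reads_data_of_seq (A : Type) (enc : A -> data) (l : seq A) :
  reads enc (data_of_seq (map enc l)) l.
Proof. by elim: l. Qed.

Lemma reads_Nil (A : Type) (enc : A -> data) (x : A) (m : nat) :
  enc x = Nil -> reads enc Nil (nseq m x).
Proof. by move=> e; elim: m => //= m IH; rewrite e. Qed.

(* The state is [Cons a (Cons R (Cons U S))]: an accumulator and three lists
   that are consumed in parallel. *)
Definition loop (p : prog) : prog :=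
  let a := FHd FId in
  let r := FHd (FTl FId) in
  let u := FHd (FTl (FTl FId)) in
  let s := FTl (FTl (FTl FId)) in
  PSeq (PRep (PSeq
     (PAsg (FCons (FCons a (FCons (FHd r) (FCons (FHd u) (FHd s))))
                  (FCons (FTl r) (FCons (FTl u) (FTl s)))))
     (PFirst p)))
   (PAsg (FHd FId)).

(** Loop bodies meet their specification only on lists of the right length; [I] and [J] carry this
    condition through the loop. *)
Lemma sem_loop_inv (A X Y Z : Type) (ea : A -> data) (ex : X -> data)
    (ey : Y -> data) (ez : Z -> data) (g : A -> X * (Y * Z) -> seq A)
    (I : pred A) (J : pred (X * (Y * Z))) (n : nat) (p : prog) :
  (forall a x y z, I a -> J (x, (y, z)) ->
     sem n p (Cons (ea a) (Cons (ex x) (Cons (ey y) (ez z)))) =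
     [seq ea b | b <- g a (x, (y, z))]) ->
  (forall a i, I a -> J i -> all I (g a i)) ->
  forall (a : A) (R U S : data) (l : seq (X * (Y * Z))),
  I a -> all J l -> size l = n ->
  reads ex R (unzip1 l) -> reads ey U (unzip1 (unzip2 l)) ->
  reads ez S (unzip2 (unzip2 l)) ->
  sem n (loop p) (Cons (ea a) (Cons R (Cons U S))) =
  [seq ea b | b <- foldM g a l].
Proof.
move=> hp hI a R U S l; rewrite /loop; set B := PSeq (PAsg _) (PFirst p).
have E : I a -> all J l -> reads ex R (unzip1 l) ->
    reads ey U (unzip1 (unzip2 l)) -> reads ez S (unzip2 (unzip2 l)) ->
    [seq ea b | b <- foldM g a l] = flatten [seq [:: hd w]
    | w <- nd_iter (sem n B) (size l) (Cons (ea a) (Cons R (Cons U S)))].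
  elim: l a R U S => [|[x [y z]] l IH] a R U S //= Ia /andP[Jx Jl].
  move=> [hx hR] [hy hU] [hz hS]; rewrite cats0 hx hy hz hp //.
  elim: (g a _) (hI _ _ Ia Jx) => //= b bs IHb /andP[Ib Ibs].
  by rewrite !map_cat flatten_cat IHb // (IH _ _ _ _ Ib Jl hR hU hS).
by move=> Ia Jl hn hR hU hS; rewrite E // hn.
Qed.

Lemma sem_loop (A X Y Z : Type) (ea : A -> data) (ex : X -> data)
    (ey : Y -> data) (ez : Z -> data) (g : A -> X * (Y * Z) -> seq A)
    (n : nat) (p : prog) :
  (forall a x y z, sem n p (Cons (ea a) (Cons (ex x) (Cons (ey y) (ez z)))) =
     [seq ea b | b <- g a (x, (y, z))]) ->
  forall (a : A) (R U S : data) (l : seq (X * (Y * Z))),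
  size l = n ->
  reads ex R (unzip1 l) -> reads ey U (unzip1 (unzip2 l)) ->
  reads ez S (unzip2 (unzip2 l)) ->
  sem n (loop p) (Cons (ea a) (Cons R (Cons U S))) =
  [seq ea b | b <- foldM g a l].
Proof.
move=> hp a R U S l.
apply: (@sem_loop_inv _ _ _ _ ea ex ey ez g predT predT) => //.
- by move=> *; apply: all_predT.
- exact: all_predT.
Qed.

(** The nondeterministic version of a map with accumulator: [c] is threaded from left to right
    through the elements. *)
Fixpoint wfold (T A B : Type) (f : T -> A -> seq (T * B)) (c : T) (l : seq A) :
    seq (T * seq B) :=
  if l is x :: l' then
    flatten [seq [seq (r.1, y.2 :: r.2) | r <- wfold f y.1 l'] | y <- f c x]
  else [:: (c, [::])].

Definition walk_step (p : prog) : prog :=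
  PSeq (PAsg (FCons (FCons (FHd (FHd FId)) (FTl FId)) (FTl (FHd FId))))
 (PSeq (PFirst p)
       (PAsg (FCons (FHd (FHd FId)) (FCons (FTl (FHd FId)) (FTl FId))))).

Definition unzip_step : prog :=
  let a := FHd FId in let i := FHd (FTl FId) in
  PAsg (FCons (FCons (FHd i) (FHd a)) (FCons (FTl i) (FTl a))).

(** The first loop conses its outputs and so reverses them; the second one restores the order while
    splitting the pairs into two lists. *)
Definition walk (p : prog) : prog :=
  PSeq (PAsg (FCons (FCons (FHd FId) FNil) (FTl FId)))
 (PSeq (loop (walk_step p))
 (PSeq (PAsg (FCons (FCons (FCons FNil FNil)
                           (FCons (FTl FId) (FCons FNil FNil))) (FHd FId)))
 (PSeq (PFirst (loop unzip_step))
       (PAsg (FCons (FTl FId) (FHd FId)))))).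

Lemma foldM_wfold (T A B : Type) (f : T -> A -> seq (T * B)) (c : T)
    (acc : seq B) (l : seq A) :
  foldM (fun a x => [seq (y.1, y.2 :: a.2) | y <- f a.1 x]) (c, acc) l =
  [seq (r.1, catrev r.2 acc) | r <- wfold f c l].
Proof.
elim: l c acc => //= x l IH c acc.
elim: (f c x) => //= y ys ->; rewrite IH map_cat -map_comp.
by congr (_ ++ _); apply: eq_map => r.
Qed.

Lemma all_wfold (T A B : Type) (f : T -> A -> seq (T * B))
    (P : A -> B -> bool) (c : T) (l : seq A) :
  (forall c x, all (fun y => P x y.2) (f c x)) ->
  all (fun r => all2 P l r.2) (wfold f c l).
Proof.
move=> hP; elim: l c => //= x l IH c.
elim: (f c x) (hP c x) => //= y ys IHy /andP[hy hys].
rewrite all_cat IHy // andbT; elim: (wfold _ _ _) (IH y.1) => //= r rs IHr.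
by case/andP=> h hrs; rewrite hy h IHr.
Qed.

Lemma size_wfold (T A B : Type) (f : T -> A -> seq (T * B)) (c : T)
    (l : seq A) :
  all (fun r => size r.2 == size l) (wfold f c l).
Proof.
have := @all_wfold T A B f (fun _ _ => true) c l (fun c x => all_predT _).
by apply: sub_all => r; rewrite all2E eq_sym => /andP[].
Qed.

Lemma sem_walk (T X Y Z O C : Type) (et : T -> data) (ex : X -> data)
    (ey : Y -> data) (ez : Z -> data) (eo : O -> data) (ec : C -> data)
    (f : T -> X * (Y * Z) -> seq (T * (O * C))) (n : nat) (p : prog) :
  (forall c x y z, sem n p (Cons (et c) (Cons (ex x) (Cons (ey y) (ez z)))) =
     [seq Cons (et r.1) (Cons (eo r.2.1) (ec r.2.2)) | r <- f c (x, (y, z))]) ->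
  forall (c : T) (R U S : data) (l : seq (X * (Y * Z))),
  size l = n ->
  reads ex R (unzip1 l) -> reads ey U (unzip1 (unzip2 l)) ->
  reads ez S (unzip2 (unzip2 l)) ->
  sem n (walk p) (Cons (et c) (Cons R (Cons U S))) =
  [seq Cons (et r.1) (Cons (data_of_seq (map eo (unzip1 r.2)))
                           (data_of_seq (map ec (unzip2 r.2))))
    | r <- wfold f c l].
Proof.
move=> hp c R U S l hn hR hU hS.
pose eb (b : O * C) := Cons (eo b.1) (ec b.2).
pose ea (a : T * seq (O * C)) := Cons (et a.1) (data_of_seq (map eb a.2)).
pose ga (a : T * seq (O * C)) (x : X * (Y * Z)) :=
  [seq (y.1, y.2 :: a.2) | y <- f a.1 x].
have h1 a x y z :
    sem n (walk_step p) (Cons (ea a) (Cons (ex x) (Cons (ey y) (ez z)))) =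
    [seq ea b | b <- ga a (x, (y, z))].
  case: a => [t acc]; rewrite /= cats0 hp /ga /= -!map_comp.
  by elim: (f t _) => //= r rs ->.
pose er (a : seq O * seq C) :=
  Cons (data_of_seq (map eo a.1)) (data_of_seq (map ec a.2)).
pose gr (a : seq O * seq C) (x : (O * C) * (unit * unit)) :=
  [:: (x.1.1 :: a.1, x.1.2 :: a.2)].
have h2 a x y z : sem n unzip_step
    (Cons (er a) (Cons (eb x) (Cons ((fun=> Nil) y) ((fun=> Nil) z)))) =
    [seq er b | b <- gr a (x, (y, z))] by [].
have h3 : sem n (loop (walk_step p))
    (Cons (ea (c, [::])) (Cons R (Cons U S))) =
    [seq ea (r.1, rev r.2) | r <- wfold f c l].
  by rewrite (sem_loop h1 _ hn) // foldM_wfold -map_comp.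
have h4 (bs : seq (O * C)) t : size bs = n ->
    sem n (PFirst (loop unzip_step))
      (Cons (Cons (Cons Nil Nil)
         (Cons (data_of_seq (map eb (rev bs))) (Cons Nil Nil))) t) =
    [:: Cons (er (unzip1 bs, unzip2 bs)) t].
  move=> hb; pose l' := [seq (b, (tt, tt)) | b <- rev bs].
  have u1 : unzip1 l' = rev bs by rewrite /unzip1 -map_comp map_id.
  have u2 : unzip2 l' = nseq (size bs) (tt, tt).
    by rewrite /l' /unzip2 -map_comp -size_rev; elim: (rev bs) => //= b s ->.
  change (sem n (PFirst (loop unzip_step)) _) with
    [seq Cons w t | w <- sem n (loop unzip_step) (Cons (er ([::], [::]))
       (Cons (data_of_seq (map eb (rev bs))) (Cons Nil Nil)))].
  rewrite (@sem_loop _ _ _ _ er eb (fun=> Nil) (fun=> Nil) gr n unzip_step h2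
    _ _ _ _ l') ?u1 ?u2; first last.
  - by elim: (size bs).
  - by elim: (size bs).
  - exact: reads_data_of_seq.
  - by rewrite size_map size_rev.
  have -> : foldM gr ([::], [::]) l' = [:: (unzip1 bs, unzip2 bs)].
    rewrite /l'; suff H bs' a : foldM gr a [seq (b, (tt, tt)) | b <- bs'] =
        [:: (catrev (unzip1 bs') a.1, catrev (unzip2 bs') a.2)].
      by rewrite H /= /unzip1 /unzip2 !map_rev -!/(rev _) !revK.
    by elim: bs' a => [|b bs' IH] [a1 a2] //=; rewrite cats0 IH.
  by [].
rewrite /walk sem_asg_seq sem_seq [feval _ _]/= h3 -map_comp.
have := size_wfold f c l; rewrite hn.
elim: (wfold f c l) => [//|r rs IH] /andP[/eqP hr hrs].
by rewrite flatten_map_cons IH // [_ r]/= sem_asg_seq sem_seq [feval _ _]/= h4.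
Qed.

(** * The algorithm *)

(* The status of a vertex: excluded, undecided (with the number of blocks that
   contain it), or chosen (with a mark telling whether a private hyperedge has
   been seen). *)
Inductive cell : Type := Out | Und of nat | In of bool.

Definition is_und (c : cell) : bool := if c is Und _ then true else false.
Definition is_in (c : cell) : bool := if c is In _ then true else false.

Definition unary (m : nat) : data := iter m (Cons Nil) Nil.

(** Chosen so that an input bit already encodes the initial status of its vertex: false is [Out] and
    true is [Und 0], see [enc_initial]. *)
Definition enc_cell (c : cell) : data :=
  match c with
  | Out => Nil
  | Und l => Cons Nil (unary l)
  | In m => Cons (data_of_bool true) (data_of_bool m)
  end.

Definition enc_list (A : Type) (enc : A -> data) (l : seq A) : data :=
  data_of_seq (map enc l).

(* The counters [(q, (b, w))]: blocks still to be declared, chosen vertices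
   still allowed (0 on a path that has been given up), scratch. *)
Definition ctl : Type := (nat * (nat * nat))%type.

Definition enc_ctl (c : ctl) : data :=
  Cons (unary c.1) (Cons (unary c.2.1) (unary c.2.2)).

Definition enc_pair (x : bool * bool) : data :=
  Cons (data_of_bool x.1) (data_of_bool x.2).

Definition enc_state (a : ctl * seq cell) : data :=
  Cons (enc_ctl a.1) (enc_list enc_cell a.2).

(* A hyperedge: the room left in its block, and for each vertex the pair
   (member of the hyperedge, member of the block). *)
Definition item : Type := (nat * seq (bool * bool))%type.

Definition enc_item (i : item) : data :=
  Cons (unary i.1) (enc_list enc_pair i.2).

Lemma tl_unary m : tl (unary m) = unary m.-1.
Proof. by case: m. Qed.

Lemma truthy_unary m : truthy (unary m) = (0 < m).
Proof. by case: m. Qed.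

Lemma iter_tl_unary j m : iter j tl (unary m) = unary (m - j).
Proof. by elim: j => [|j IH] /=; rewrite ?subn0 // IH tl_unary subnS. Qed.

Lemma iter_cons_unary j m : iter j (Cons Nil) (unary m) = unary (j + m).
Proof. by rewrite /unary iterD. Qed.

Lemma feval_iter_cons v j a :
  feval v (iter j (FCons FNil) a) = iter j (Cons Nil) (feval v a).
Proof. by elim: j => //= j ->. Qed.

Lemma feval_iter_tl v j a : feval v (iter j FTl a) = iter j tl (feval v a).
Proof. by elim: j => //= j ->. Qed.

Definition xq := FHd (FHd FId).
Definition xb := FHd (FTl (FHd FId)).
Definition xw := FTl (FTl (FHd FId)).
Definition xr := FHd (FTl FId).
Definition xu := FHd (FTl (FTl FId)).
Definition xc := FTl (FTl (FTl FId)).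
Definition xunary (m : nat) := iter m (FCons FNil) FNil.
Definition xtrue := FCons FNil FNil.
Definition xin := FCons xtrue FNil.

Definition ret (q b w o c : fexpr) : prog :=
  PAsg (FCons (FCons q (FCons b w)) (FCons o c)).
Definition keep : prog := ret xq xb xw FNil xc.
Definition PIfUnd (p1 p2 : prog) : prog := PIf xc (PIf (FHd xc) p2 p1) p2.

Section Algorithm.

(* [k] is the block size, [D] the maximal number of blocks that may share a
   vertex, and each [t] vertices of X buy one unit of [q] and [s] units of
   [b]. *)
Variables k D s t : nat.

(* In each pass over the vertices, [f_x] is the effect on one vertex and [p_x]
   its program.  The passes compute the budgets (bud), choose the block of a
   hyperedge ([w] = room left in it) (sel), guess the saturated vertices (A),
   guess a block with at most [w] chosen vertices, giving up if it is not
   entirely undecided (decl), count the chosen vertices of a hyperedge in [w]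
   (hit), branch on a hyperedge that is not hit (B), guess all that is left (C),
   mark the vertex whose private hyperedge this is (mark), and set [w] if the
   chosen set is not minimal or not inside X (fin). *)
Definition f_bud (c : ctl) (x : unit * cell) : seq (ctl * cell) :=
  let: (q, (b, w)) := c in
  if x.2 is Out then [:: (c, x.2)]
  else if 0 < w.-1 then [:: ((q, (b, w.-1)), x.2)]
  else [:: ((q.+1, (s + b, t)), x.2)].

Definition p_bud : prog :=
  PIf xc (PIf (FTl xw) (ret xq xb (FTl xw) FNil xc)
     (ret (FCons FNil xq) (iter s (FCons FNil) xb) (xunary t) FNil xc)) keep.

Definition f_sel (c : ctl) (x : bool * (bool * cell)) :
    seq (ctl * ((bool * bool) * cell)) :=
  let: (q, (b, w)) := c in let: (r, (u, z)) := x in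
  if r || u then
    if z is Und l then
      if D <= l then [:: (c, ((true, false), z))]
      else if 0 < w then [:: ((q, (b, w.-1)), ((true, true), Und l.+1))]
      else [:: (c, ((true, false), z))]
    else [:: (c, ((true, false), z))]
  else [:: (c, ((false, false), z))].

(** Comparison with a constant without a loop: [l.+1] in unary is nonempty after [D] removals
    exactly if [D <= l]. *)
Definition xsat := iter D FTl (FCons FNil (FTl xc)).

Definition p_sel : prog :=
  let kept := ret xq xb xw (FCons xtrue FNil) xc in
  let hit := PIfUnd (PIf xsat kept (PIf xw
     (ret xq xb (FTl xw) (FCons xtrue xtrue) (FCons FNil (FCons FNil (FTl xc))))
     kept)) kept in
  PIf xr hit (PIf xu hit (ret xq xb xw (FCons FNil FNil) xc)).

Definition f_A (c : ctl) (x : unit * cell) : seq (ctl * cell) :=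
  if x.2 is Und l then
    if D <= l then [:: (c, In false); (c, Out)] else [:: (c, x.2)]
  else [:: (c, x.2)].

Definition p_A : prog :=
  PIfUnd (PIf xsat (PBranch (ret xq xb xw FNil xin) (ret xq xb xw FNil FNil))
     keep) keep.

Definition f_decl (c : ctl) (x : (bool * bool) * cell) : seq (ctl * cell) :=
  let: (q, (b, w)) := c in
  if x.1.2 then
    if is_und x.2 then
      if 0 < w then [:: ((q, (b, 0)), In false); (c, Out)] else [:: (c, Out)]
    else [:: ((0, (0, 0)), x.2)]
  else [:: (c, x.2)].

Definition p_decl : prog :=
  PIf (FTl xr) (PIfUnd
    (PIf xw (PBranch (ret xq xb FNil FNil xin) (ret xq xb xw FNil FNil))
            (ret xq xb xw FNil FNil))
    (ret FNil FNil FNil FNil xc)) keep.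

Definition f_hit (c : ctl) (x : (bool * bool) * cell) : seq (ctl * cell) :=
  let: (q, (b, w)) := c in
  if x.1.1 && is_in x.2 then [:: ((q, (b, w.+1)), x.2)] else [:: (c, x.2)].

Definition p_hit : prog :=
  PIf (FHd xr) (PIf (FHd xc) (ret xq xb (FCons FNil xw) FNil xc) keep) keep.

Definition f_B (c : ctl) (x : (bool * bool) * cell) : seq (ctl * cell) :=
  let: (q, (b, w)) := c in
  if [&& x.1.1, is_und x.2, w == 0 & 0 < b] then
    [:: ((q, (b, 1)), In false); (c, Out)]
  else [:: (c, x.2)].

Definition p_B : prog :=
  PIf (FHd xr) (PIfUnd (PIf xw keep (PIf xb
    (PBranch (ret xq xb xtrue FNil xin) (ret xq xb xw FNil FNil)) keep))
    keep) keep.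

Definition f_C (dec : bool) (c : ctl) (x : unit * cell) : seq (ctl * cell) :=
  let: (q, (b, w)) := c in
  match x.2 with
  | Out => [:: (c, Out)]
  | In _ => [:: (c, In false)]
  | Und _ =>
      if 0 < b then [:: ((q, (b - dec, w)), In false); (c, Out)]
      else [:: (c, Out)]
  end.

Definition p_C (dec : bool) : prog :=
  PIf xc (PIf (FHd xc) (ret xq xb xw FNil xin)
    (PIf xb (PBranch (ret xq (if dec then FTl xb else xb) xw FNil xin)
       (ret xq xb xw FNil FNil)) (ret xq xb xw FNil FNil))) keep.

Definition f_mark (c : ctl) (x : (bool * bool) * cell) : seq (ctl * cell) :=
  if [&& x.1.1, is_in x.2 & c.2.2 == 1] then [:: (c, In true)]
  else [:: (c, x.2)].

Definition p_mark : prog :=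
  PIf (FHd xr) (PIf (FHd xc) (PIf (FTl xw) keep
    (PIf xw (ret xq xb xw FNil (FCons xtrue xtrue)) keep)) keep) keep.

Definition f_fin (c : ctl) (x : unit * (bool * cell)) :
    seq (ctl * (bool * cell)) :=
  let: (q, (b, w)) := c in
  if x.2.2 is In m then
    if m && x.2.1 then [:: (c, (true, x.2.2))]
    else [:: ((q, (b, 1)), (true, x.2.2))]
  else [:: (c, (false, x.2.2))].

Definition p_fin : prog :=
  let bad := ret xq xb xtrue xtrue xc in
  PIf (FHd xc) (PIf (FTl xc) (PIf xu (ret xq xb xw xtrue xc) bad) bad)
    (ret xq xb xw FNil xc).

Definition enc_unit (_ : unit) : data := Nil.

Definition cell_spec (n : nat) (X : Type) (ex : X -> data) (p : prog)
    (f : ctl -> X * cell -> seq (ctl * cell)) : Prop :=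
  forall c x u z,
  sem n p (Cons (enc_ctl c) (Cons (ex x) (Cons u (enc_cell z)))) =
  [seq Cons (enc_ctl r.1) (Cons Nil (enc_cell r.2)) | r <- f c (x, z)].

Lemma truthy_sat j l : truthy (iter j tl (Cons Nil (unary l))) = (j <= l).
Proof.
rewrite -[Cons Nil (unary l)]/(unary l.+1) iter_tl_unary truthy_unary.
by rewrite subn_gt0 ltnS.
Qed.

Lemma spec_bud n : cell_spec n enc_unit p_bud f_bud.
Proof.
move=> [q [b w]] [] u z /=.
by case: z => [|l|m] //=; rewrite tl_unary truthy_unary; case: ifP => //= _;
   rewrite !feval_iter_cons /= iter_cons_unary.
Qed.

Lemma spec_A n : cell_spec n enc_unit p_A f_A.
Proof.
move=> [q [b w]] [] u z; rewrite /p_A /PIfUnd /xsat !sem_if feval_iter_tl.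
by case: z => [|l|m] //=; rewrite truthy_sat /f_A /=; case: ifP.
Qed.

Lemma spec_decl n : cell_spec n enc_pair p_decl f_decl.
Proof.
move=> [q [b w]] [[] []] u z //=.
- by case: z => [|l|m] //=; rewrite truthy_unary; case: ifP.
- by case: z => [|l|m] //=; rewrite truthy_unary; case: ifP.
Qed.

Lemma spec_hit n : cell_spec n enc_pair p_hit f_hit.
Proof. by move=> [q [b w]] [[] r] u [|l|m]. Qed.

Lemma spec_B n : cell_spec n enc_pair p_B f_B.
Proof.
move=> [q [b w]] [[] r] u [|l|m] //=; rewrite !truthy_unary.
by case: w => [|w] //=; case: b.
Qed.

Lemma spec_C n dec : cell_spec n enc_unit (p_C dec) (f_C dec).
Proof.
move=> [q [b w]] [] u [|l|m] //=; rewrite !truthy_unary.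
by case: b => [|b] //=; case: dec => //=; rewrite ?subn1 ?subn0.
Qed.

Lemma spec_mark n : cell_spec n enc_pair p_mark f_mark.
Proof.
move=> [q [b w]] [[] r] u [|l|m] //=; rewrite /f_mark /= ?andbF //.
by case: w => [|[|w]].
Qed.

Lemma spec_sel n c x y z :
  sem n p_sel (Cons (enc_ctl c)
    (Cons (data_of_bool x) (Cons (data_of_bool y) (enc_cell z)))) =
  [seq Cons (enc_ctl r.1) (Cons (enc_pair r.2.1) (enc_cell r.2.2))
    | r <- f_sel c (x, (y, z))].
Proof.
case: c => [q [b w]]; rewrite /p_sel /PIfUnd /xsat !sem_if !feval_iter_tl.
case: z => [|l|m]; case: x; case: y => //=; rewrite truthy_sat;
  by rewrite /f_sel /=; case: ifP => //= _; rewrite truthy_unary tl_unary; case: ifP.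
Qed.

Lemma spec_fin n c x y z :
  sem n p_fin (Cons (enc_ctl c)
    (Cons (enc_unit x) (Cons (data_of_bool y) (enc_cell z)))) =
  [seq Cons (enc_ctl r.1) (Cons (data_of_bool r.2.1) (enc_cell r.2.2))
    | r <- f_fin c (x, (y, z))].
Proof. by case: c => [q [b w]]; case: z => [|l|[]] //=; case: y. Qed.

(* Runs a cell program over the state [Cons (Cons ctl st) ctx]. *)
Definition pass (row : fexpr) (p : prog) : prog :=
  PSeq (PAsg (FCons (FCons (FHd (FHd FId))
          (FCons row (FCons FNil (FTl (FHd FId))))) (FTl FId)))
 (PSeq (PFirst (walk p))
       (PAsg (FCons (FCons (FHd (FHd FId)) (FTl (FTl (FHd FId)))) (FTl FId)))).

Lemma wfold_lift (X : Type) (f : ctl -> X * cell -> seq (ctl * cell)) c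
    (row : seq X) (us : seq bool) (st : seq cell) :
  size us = size st ->
  [seq (r.1, unzip2 r.2) | r <- wfold (fun c (x : X * (bool * cell)) =>
      [seq (y.1, (false, y.2)) | y <- f c (x.1, x.2.2)]) c
      (zip row (zip us st))] =
  wfold f c (zip row st).
Proof.
elim: row us st c => [|x row IH] [|u us] [|z st] c //= [hs].
elim: (f c _) => //= y ys <-; rewrite map_cat; congr (_ ++ _).
by rewrite -(IH us) // -!map_comp.
Qed.

Lemma sem_pass n (X : Type) (ex : X -> data) p
    (f : ctl -> X * cell -> seq (ctl * cell)) :
  cell_spec n ex p f ->
  forall (row : fexpr) (rs : seq X) (a : ctl * seq cell) (ctx : data),
  size rs = n -> size a.2 = n ->
  reads ex (feval (Cons (enc_state a) ctx) row) rs ->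
  sem n (pass row p) (Cons (enc_state a) ctx) =
  [seq Cons (enc_state r) ctx | r <- wfold f a.1 (zip rs a.2)].
Proof.
move=> hp row rs [c st] ctx; rewrite [(c, st).2]/= [(c, st).1]/=.
move=> hrs hst hread.
pose l := zip rs (zip (nseq n false) st).
have hz : size (zip (nseq n false) st) = n by rewrite size_zip size_nseq hst minnn.
rewrite /pass sem_asg_seq [feval _ _]/= sem_seq sem_first [hd _]/= [tl _]/=.
rewrite (@sem_walk _ _ _ _ _ _ enc_ctl ex data_of_bool enc_cell data_of_bool
  enc_cell (fun c (x : X * (bool * cell)) =>
      [seq (y.1, (false, y.2)) | y <- f c (x.1, x.2.2)]) n p _ c _ _ _ l).
- rewrite -map_comp -(@wfold_lift _ f c rs (nseq n false) st); last first.
    by rewrite size_nseq hst.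
  by rewrite -/l -map_comp; elim: (wfold _ _ _) => //= r r' ->.
- by move=> c' x y z; rewrite hp -map_comp.
- by rewrite size_zip hrs hz minnn.
- by rewrite unzip1_zip // hrs hz.
- rewrite unzip2_zip ?hrs ?hz // unzip1_zip ?size_nseq ?hst //.
  exact: reads_Nil.
- rewrite unzip2_zip ?hrs ?hz // unzip2_zip ?size_nseq ?hst //.
  exact: reads_data_of_seq.
Qed.

(* The [x]-expressions above are relative to the state of a cell program, the
   [y]-expressions below to [Cons (Cons ctl st) (Cons item _)]. *)
Definition yq := FHd (FHd (FHd FId)).
Definition yb := FHd (FTl (FHd (FHd FId))).
Definition yw := FTl (FTl (FHd (FHd FId))).
Definition yroom := FHd (FHd (FTl FId)).
Definition yrow := FTl (FHd (FTl FId)).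
Definition setc (q b w : fexpr) : prog :=
  PAsg (FCons (FCons (FCons q (FCons b w)) (FTl (FHd FId))) (FTl FId)).
Definition skip : prog := PAsg FId.
Definition done : prog := PAsg (FHd FId).

Definition bindM (A B : Type) (l : seq A) (f : A -> seq B) : seq B :=
  flatten [seq f x | x <- l].

Definition g_1 (a : ctl * seq cell) (i : item) : seq (ctl * seq cell) :=
  let: ((q, (b, w)), st) := a in
  if 0 < i.1 then [:: a]
  else if 0 < q then a :: wfold f_decl (q.-1, (b, 1)) (zip i.2 st)
  else [:: a].

Definition p_1 : prog :=
  PIf yroom done (PIf yq (PBranch done
    (PSeq (setc (FTl yq) yb xtrue) (PSeq (pass yrow p_decl) done))) done).

(** If [w] is still 0 after the branching, the hyperedge is missed and all its vertices are decided,
    so no transversal extends the state. *)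
Definition kill (c : ctl) : ctl :=
  let: (q, (b, w)) := c in if w == 0 then (q, (0, w)) else c.

Definition g_2 (a : ctl * seq cell) (i : item) : seq (ctl * seq cell) :=
  let: ((q, (b, w)), st) := a in
  if 0 < i.1 then
    bindM (wfold f_hit (q, (b, 0)) (zip i.2 st)) (fun r =>
      [seq (kill r'.1, r'.2) | r' <- wfold f_B r.1 (zip i.2 r.2)])
  else [:: a].

Definition p_2 : prog :=
  PIf yroom
    (PSeq (setc yq yb FNil) (PSeq (pass yrow p_hit) (PSeq (pass yrow p_B)
       (PSeq (PIf yw skip (setc yq FNil yw)) done)))) done.

(** The final test reuses [q] as an error flag, raised by a hyperedge without chosen vertex. *)
Definition flag (c : ctl) : ctl :=
  let: (q, (b, w)) := c in if w == 0 then (1, (b, w)) else c.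

Definition g_3 (a : ctl * seq cell) (i : item) : seq (ctl * seq cell) :=
  let: ((q, (b, w)), st) := a in
  bindM (wfold f_hit (q, (b, 0)) (zip i.2 st)) (fun r =>
    wfold f_mark (flag r.1) (zip i.2 r.2)).

Definition p_3 : prog :=
  PSeq (setc yq yb FNil) (PSeq (pass yrow p_hit)
    (PSeq (PIf yw skip (setc xtrue yb yw)) (PSeq (pass yrow p_mark) done))).

Definition sized (n : nat) (a : ctl * seq cell) : bool := size a.2 == n.
Definition sized_item (n : nat) (i : item) : bool := size i.2 == n.

Definition edge_spec (n : nat) (p : prog)
    (g : ctl * seq cell -> item -> seq (ctl * seq cell)) : Prop :=
  forall a i, sized n a -> sized_item n i ->
  sem n p (Cons (enc_state a) (Cons (enc_item i) (Cons Nil Nil))) =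
    [seq enc_state b | b <- g a i] /\ all (sized n) (g a i).

Lemma sized_wfold (X : Type) n (f : ctl -> X * cell -> seq (ctl * cell)) c
    (rs : seq X) (st : seq cell) :
  size rs = n -> size st = n -> all (sized n) (wfold f c (zip rs st)).
Proof.
move=> hr hs; apply: sub_all (size_wfold _ _ _) => r /eqP.
by rewrite size_zip hr hs minnn => h; apply/eqP.
Qed.

Lemma eq_bindM_all (A B : Type) (P : pred A) (l : seq A) (f g : A -> seq B) :
  all P l -> (forall x, P x -> f x = g x) -> bindM l f = bindM l g.
Proof.
move=> hl h; rewrite /bindM; elim: l hl => //= x l IH /andP[hx hl].
by rewrite h // IH.
Qed.

Lemma all_bindM (A B : Type) (P : pred A) (Q : pred B) (l : seq A)
    (f : A -> seq B) :
  all P l -> (forall x, P x -> all Q (f x)) -> all Q (bindM l f).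
Proof.
move=> hl h; rewrite /bindM; elim: l hl => //= x l IH /andP[hx hl].
by rewrite all_cat h // IH.
Qed.

Lemma map_bindM (A B C : Type) (h : B -> C) (l : seq A) (f : A -> seq B) :
  [seq h y | y <- bindM l f] = bindM l (fun x => [seq h y | y <- f x]).
Proof. by rewrite /bindM; elim: l => //= x l <-; rewrite map_cat. Qed.

Lemma bindM_map (A B C : Type) (h : A -> B) (l : seq A) (f : B -> seq C) :
  bindM [seq h x | x <- l] f = bindM l (fun x => f (h x)).
Proof. by rewrite /bindM -map_comp. Qed.

Lemma bindM_ret (A B : Type) (h : A -> B) (l : seq A) :
  bindM l (fun x => [:: h x]) = [seq h x | x <- l].
Proof. by rewrite /bindM flatten_map1. Qed.

Lemma bindM1 (A B : Type) (x : A) (f : A -> seq B) : bindM [:: x] f = f x.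
Proof. by rewrite /bindM /= cats0. Qed.

Lemma sem_seqM n p1 p2 v : sem n (PSeq p1 p2) v = bindM (sem n p1 v) (sem n p2).
Proof. by []. Qed.

Lemma sem_pass_row n p (f : ctl -> (bool * bool) * cell -> seq (ctl * cell))
    a i ctx :
  cell_spec n enc_pair p f -> sized n a -> sized_item n i ->
  sem n (pass yrow p) (Cons (enc_state a) (Cons (enc_item i) ctx)) =
  [seq Cons (enc_state r) (Cons (enc_item i) ctx)
    | r <- wfold f a.1 (zip i.2 a.2)].
Proof.
move=> hf /eqP ha /eqP hi; rewrite (sem_pass hf hi ha) //.
exact: reads_data_of_seq.
Qed.

Lemma sem_setc n q b w a ctx :
  sem n (setc q b w) (Cons (enc_state a) ctx) =
  let v := Cons (enc_state a) ctx in
  [:: Cons (Cons (Cons (feval v q) (Cons (feval v b) (feval v w)))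
             (enc_list enc_cell a.2)) ctx].
Proof. by []. Qed.

Lemma spec_1 n : edge_spec n p_1 g_1.
Proof.
move=> [[q [b w]] st] [room row] ha hi; rewrite /p_1 /g_1 !sem_if.
set v := Cons _ _.
have -> : truthy (feval v yroom) = (0 < room) by exact: truthy_unary.
have -> : truthy (feval v yq) = (0 < q) by exact: truthy_unary.
rewrite [(room, row).1]/=; case: ifP => [_|_]; first by rewrite /= ha.
case: ifP => [_|_]; last by rewrite /= ha.
have ha' : sized n ((q.-1, (b, 1)), st) by [].
split; last by rewrite /= ha; apply: sized_wfold; apply/eqP.
rewrite sem_branch sem_seqM sem_setc; cbv zeta; rewrite -/v.
have -> : feval v (FTl yq) = unary q.-1 by exact: tl_unary.
rewrite bindM1.
rewrite sem_seqM -[Cons (Cons (Cons _ _) _) _]/(Cons (enc_state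
  ((q.-1, (b, 1)), st)) (Cons (enc_item (room, row)) (Cons Nil Nil))).
by rewrite (sem_pass_row _ (@spec_decl n) ha' hi) bindM_map bindM_ret.
Qed.

Lemma spec_2 n : edge_spec n p_2 g_2.
Proof.
move=> [[q [b w]] st] [room row] ha hi; rewrite /p_2 /g_2 sem_if.
have -> : truthy (feval (Cons (enc_state (q, (b, w), st))
     (Cons (enc_item (room, row)) (Cons Nil Nil))) yroom) = (0 < room).
  exact: truthy_unary.
rewrite [(room, row).1]/=; case: ifP => [_|_]; last by rewrite /= ha.
have ha' : sized n ((q, (b, 0)), st) by [].
have hs := @sized_wfold _ n f_hit (q, (b, 0)) row st (eqP hi) (eqP ha).
split; last first.
  apply: (all_bindM hs) => -[c' st'] /= h'; rewrite all_map.
  by apply: sized_wfold; apply/eqP.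
rewrite sem_seqM sem_setc; cbv zeta; rewrite bindM1.
rewrite sem_seqM -[Cons (Cons (Cons _ _) _) _]/(Cons (enc_state ((q, (b, 0)), st))
  (Cons (enc_item (room, row)) (Cons Nil Nil))).
rewrite (sem_pass_row _ (@spec_hit n) ha' hi) map_bindM bindM_map.
apply: (eq_bindM_all hs) => a1 h1.
rewrite sem_seqM (sem_pass_row _ (@spec_B n) h1 hi) bindM_map -map_comp.
rewrite -bindM_ret; apply: (eq_bindM_all (P := predT)); first exact: all_predT.
move=> [[q' [b' w']] st'] _; rewrite sem_seqM sem_if /=.
by rewrite /yw /= truthy_unary /kill; case: w'.
Qed.

Lemma spec_3 n : edge_spec n p_3 g_3.
Proof.
move=> [[q [b w]] st] [room row] ha hi; rewrite /p_3 /g_3.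
have ha' : sized n ((q, (b, 0)), st) by [].
have hs := @sized_wfold _ n f_hit (q, (b, 0)) row st (eqP hi) (eqP ha).
split; last first.
  apply: (all_bindM hs) => -[c' st'] /= h'.
  by apply: sized_wfold; apply/eqP.
rewrite sem_seqM sem_setc; cbv zeta; rewrite bindM1.
rewrite sem_seqM -[Cons (Cons (Cons _ _) _) _]/(Cons (enc_state ((q, (b, 0)), st))
  (Cons (enc_item (room, row)) (Cons Nil Nil))).
rewrite (sem_pass_row _ (@spec_hit n) ha' hi) map_bindM bindM_map.
apply: (eq_bindM_all hs) => -[c1 st1] h1.
rewrite sem_seqM sem_if.
have -> : (if truthy (feval (Cons (enc_state (c1, st1)) (Cons (enc_item (room, row))
     (Cons Nil Nil))) yw) then
   sem n skip (Cons (enc_state (c1, st1)) (Cons (enc_item (room, row)) (Cons Nil Nil)))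
   else sem n (setc xtrue yb yw) (Cons (enc_state (c1, st1))
     (Cons (enc_item (room, row)) (Cons Nil Nil)))) =
   [:: Cons (enc_state (flag c1, st1)) (Cons (enc_item (room, row)) (Cons Nil Nil))].
  by case: c1 h1 => q1 [b1 [|w1]].
rewrite bindM1 sem_seqM.
have h1' : sized n (flag c1, st1) by [].
by rewrite (sem_pass_row _ (@spec_mark n) h1' hi) bindM_map bindM_ret.
Qed.

Definition eloop (p : prog) : prog :=
  PSeq (PAsg (FCons (FCons (FHd FId) (FCons (FHd (FTl FId)) (FCons FNil FNil)))
                    (FTl FId)))
       (PFirst (loop p)).

Lemma foldM_map (A I J : Type) (g : A -> J -> seq A) (h : I -> J) a l :
  foldM g a (map h l) = foldM (fun b i => g b (h i)) a l.
Proof.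
elim: l a => //= i l IH a; congr flatten; apply: eq_map => b; exact: IH.
Qed.

Lemma sem_eloop n p g a (E : seq item) ctx :
  edge_spec n p g -> sized n a -> all (sized_item n) E -> size E = n ->
  sem n (eloop p) (Cons (enc_state a) (Cons (enc_list enc_item E) ctx)) =
  [seq Cons (enc_state b) (Cons (enc_list enc_item E) ctx) | b <- foldM g a E].
Proof.
move=> hp ha hE hn; rewrite /eloop sem_asg_seq [feval _ _]/= sem_first.
rewrite [hd _]/= [tl _]/=.
pose l := [seq (i, (tt, tt)) | i <- E].
have hl : unzip2 l = nseq (size E) (tt, tt).
  by rewrite /l; elim: (E) => //= i E' ->.
rewrite (@sem_loop_inv _ _ _ _ enc_state enc_item enc_unit enc_unit
  (fun a i => g a i.1) (sized n) (fun i => sized_item n i.1) n p _ _ _ _ _ _ l).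
- by rewrite foldM_map -map_comp.
- by move=> a' i [] [] h1 h2; case: (hp _ _ h1 h2).
- by move=> a' i h1 h2; case: (hp _ _ h1 h2).
- exact: ha.
- by rewrite all_map.
- by rewrite size_map.
- by rewrite /unzip1 -map_comp map_id; apply: reads_data_of_seq.
- by rewrite hl; elim: (size E).
- by rewrite hl; elim: (size E).
Qed.

(** * Choosing the blocks of all hyperedges *)

Definition sel_state : Type := ((ctl * seq cell) * (nat * seq item))%type.

(** The hyperedges are closed neighbourhoods, so row [i] of the adjacency matrix needs its diagonal
    entry added. Consing one [Nil] gives the indicator for the next row; the missing tail reads as
    false. *)
Definition unit_row (i : nat) : data := iter i (Cons Nil) (Cons (Cons Nil Nil) Nil).

Definition enc_sel (a : sel_state) : data :=
  Cons (enc_state a.1) (Cons (unit_row a.2.1) (enc_list enc_item a.2.2)).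

Definition g_sel (n : nat) (a : sel_state) (row : seq bool) : seq sel_state :=
  let: (((q, (b, w)), st), (i, E)) := a in
  [seq ((r.1, unzip2 r.2), (i.+1, (r.1.2.2, unzip1 r.2) :: E))
    | r <- wfold f_sel (q, (b, k))
             (zip row (zip (mkseq (fun j => j == i) n) st))].

Definition p_gsel : prog :=
  let c := FHd (FHd (FHd FId)) in
  let st := FTl (FHd (FHd FId)) in
  let u := FHd (FTl (FHd FId)) in
  let E := FTl (FTl (FHd FId)) in
  PSeq (PAsg (FCons
      (FCons (FCons (FHd c) (FCons (FHd (FTl c)) (xunary k)))
             (FCons (FHd (FTl FId)) (FCons u st))) (FCons u E)))
 (PSeq (PFirst (walk p_sel))
       (PAsg (FCons
          (FCons (FHd (FHd FId)) (FTl (FTl (FHd FId))))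
          (FCons (FCons FNil (FHd (FTl FId)))
            (FCons (FCons (FTl (FTl (FHd (FHd FId)))) (FHd (FTl (FHd FId))))
              (FTl (FTl FId))))))).

Lemma reads_Nil_map (A B : Type) (enc : A -> data) (h : B -> A) (l : seq B) :
  (forall x, enc (h x) = Nil) -> reads enc Nil (map h l).
Proof. by move=> e; elim: l => //= x l IH; rewrite e. Qed.

Lemma reads_unit_row i m :
  reads data_of_bool (unit_row i) (mkseq (fun j => j == i) m).
Proof.
rewrite /mkseq; elim: m i => [|m IH] [|i] //=.
  split=> //; rewrite (iotaDl 1 0) -map_comp.
  by apply: reads_Nil_map => //.
split=> //; have := IH i; rewrite (iotaDl 1 0) -map_comp.
by congr reads; apply: eq_map => j.
Qed.

Definition initial (X : seq bool) : seq cell :=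
  [seq if x then Und 0 else Out | x <- X].

Lemma enc_initial X : enc_list enc_cell (initial X) = enc_list data_of_bool X.
Proof. by rewrite /enc_list /initial -map_comp; congr data_of_seq; apply: eq_map => -[]. Qed.

Lemma sem_gsel n (a : sel_state) row ctx :
  size a.1.2 = n -> size row = n ->
  sem n p_gsel (Cons (enc_sel a) (Cons (enc_list data_of_bool row) ctx)) =
  [seq enc_sel b | b <- g_sel n a row].
Proof.
case: a => [[[q [b w]] st] [i E]]; rewrite [_.1.2]/= => hst hrow.
rewrite /p_gsel sem_asg_seq [feval _ _]/= sem_seqM sem_first [hd _]/= [tl _]/=.
rewrite feval_iter_cons [feval _ FNil]/=.
pose l := zip row (zip (mkseq (fun j => j == i) n) st).
have hz : size (zip (mkseq (fun j => j == i) n) st) = n.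
  by rewrite size_zip size_mkseq hst minnn.
have := @sem_walk _ _ _ _ _ _ enc_ctl data_of_bool data_of_bool enc_cell
  enc_pair enc_cell f_sel n p_sel (@spec_sel n) (q, (b, k))
  (enc_list data_of_bool row) (unit_row i) (enc_list enc_cell st) l.
rewrite {1}/enc_ctl [(_, _).1]/= [(_, _).2]/= => ->.
- rewrite bindM_map bindM_map bindM_ret /g_sel -map_comp; exact: eq_map.
- by rewrite size_zip hrow hz minnn.
- by rewrite unzip1_zip ?hrow ?hz //; apply: reads_data_of_seq.
- rewrite unzip2_zip ?hrow ?hz // unzip1_zip ?size_mkseq ?hst //.
  exact: reads_unit_row.
- rewrite unzip2_zip ?hrow ?hz // unzip2_zip ?size_mkseq ?hst //.
  exact: reads_data_of_seq.
Qed.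

(** * The two strategies, the final test and the whole program *)

Definition ticks (n : nat) : seq unit := nseq n tt.

Lemma sem_pass_ticks n p f a ctx :
  cell_spec n enc_unit p f -> sized n a ->
  sem n (pass FNil p) (Cons (enc_state a) ctx) =
  [seq Cons (enc_state r) ctx | r <- wfold f a.1 (zip (ticks n) a.2)].
Proof.
move=> hf /eqP ha; rewrite (sem_pass hf (rs := ticks n)) // ?size_nseq //.
exact: reads_Nil.
Qed.

Lemma all_foldM (A I : Type) (P : pred A) (J : pred I) (g : A -> I -> seq A)
    a l :
  (forall a i, P a -> J i -> all P (g a i)) -> P a -> all J l ->
  all P (foldM g a l).
Proof.
move=> h; elim: l a => [|i l IH] a /=; first by move=> ->.
move=> Pa /andP[Ji Jl]; rewrite -/(bindM (g a i) (foldM g ^~ l)).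
by apply: (all_bindM (h _ _ Pa Ji)) => b Pb; apply: IH.
Qed.

(** A path that has not declared all its blocks has not earned the right to branch freely: with [b]
    set to 0 the last pass excludes everything undecided and yields a single leaf. *)
Definition m_type1 n (E : seq item) (a : ctl * seq cell) :=
  bindM (foldM g_1 a E) (fun r =>
    let: (q, (b, w)) := r.1 in
    wfold (f_C false) (if 0 < q then (q, (0, w)) else r.1)
      (zip (ticks n) r.2)).

Definition p_type1 : prog :=
  PSeq (eloop p_1) (PSeq (PIf yq (setc yq FNil yw) skip)
    (pass FNil (p_C false))).

Definition m_type2 n (E : seq item) (a : ctl * seq cell) :=
  bindM (wfold f_A a.1 (zip (ticks n) a.2)) (fun r =>
  bindM (foldM g_2 r E) (fun r =>
    wfold (f_C true) r.1 (zip (ticks n) r.2))).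

Definition p_type2 : prog :=
  PSeq (pass FNil p_A) (PSeq (eloop p_2) (pass FNil (p_C true))).

(** The error flag of [g_3], kept in [q], becomes the initial [w] of the last pass, so that [w]
    collects both kinds of errors. Given-up paths reach this test too and need no separate
    treatment. *)
Definition m_check n (E : seq item) (X : seq bool) (a : ctl * seq cell) :
    seq data :=
  bindM (foldM g_3 ((0, a.1.2), a.2) E) (fun r =>
  [seq if 0 < r.1.2.2 then Nil else Cons Nil (enc_list data_of_bool (unzip1 r.2))
   | r <- wfold f_fin (r.1.1, (r.1.2.1, r.1.1))
            (zip (ticks n) (zip X r.2))]).

Definition p_check : prog :=
  PSeq (setc FNil yb yw) (PSeq (eloop p_3)
 (PSeq (PAsg (FCons (FCons (FCons yq (FCons yb yq))
     (FCons FNil (FCons (FTl (FTl FId)) (FTl (FHd FId))))) FNil))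
 (PSeq (PFirst (walk p_fin))
   (PIf (FTl (FTl (FHd (FHd FId)))) (PAsg FNil)
      (PAsg (FCons FNil (FHd (FTl (FHd FId))))))))).

(** The initial [b] is 1, not 0: thus [b] is positive even when no unit is bought, and 0 is free to
    mark given-up paths. *)
Definition m_main n (M : seq (seq bool)) (X : seq bool) : seq data :=
  bindM (wfold f_bud (0, (1, t)) (zip (ticks n) (initial X))) (fun r =>
  bindM (foldM (g_sel n) (r, (0, [::])) M) (fun a =>
  bindM (m_type1 n a.2.2 a.1 ++ m_type2 n a.2.2 a.1) (m_check n a.2.2 X))).

Definition p_main : prog :=
  PSeq (PAsg (FCons (FCons (FCons FNil (FCons xtrue (xunary t))) (FTl FId)) FId))
 (PSeq (pass FNil p_bud)
 (PSeq (PAsg (FCons (FCons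
     (FCons (FHd FId) (FCons (FCons xtrue FNil) FNil))
     (FCons (FHd (FTl FId)) (FCons FNil FNil))) (FTl (FTl FId))))
 (PSeq (PFirst (loop p_gsel))
 (PSeq (PAsg (FCons (FHd (FHd FId)) (FCons (FTl (FTl (FHd FId))) (FTl FId))))
 (PSeq (PBranch p_type1 p_type2) p_check))))).

Lemma sem_type1 n E a ctx :
  sized n a -> all (sized_item n) E -> size E = n ->
  sem n p_type1 (Cons (enc_state a) (Cons (enc_list enc_item E) ctx)) =
  [seq Cons (enc_state r) (Cons (enc_list enc_item E) ctx)
    | r <- m_type1 n E a].
Proof.
move=> ha hE hn; rewrite /p_type1 sem_seqM (sem_eloop _ (@spec_1 n)) //.
rewrite bindM_map map_bindM.
apply: (@eq_bindM_all _ _ (sized n)).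
  by apply: (all_foldM _ ha hE) => a' i h1 h2; case: (@spec_1 n _ _ h1 h2).
move=> [[q [b w]] st] h; rewrite sem_seqM sem_if.
have -> : truthy (feval (Cons (enc_state ((q, (b, w)), st))
   (Cons (enc_list enc_item E) ctx)) yq) = (0 < q) by exact: truthy_unary.
rewrite [(_, st).1]/= [(_, st).2]/=; case hq: (0 < q).
  rewrite sem_setc; cbv zeta; rewrite bindM1.
  rewrite -[Cons (Cons (Cons _ _) _) _]/(Cons (enc_state
    ((q, (0, w)), st)) (Cons (enc_list enc_item E) ctx)).
  by rewrite (sem_pass_ticks _ (@spec_C n false)) //= hq.
by rewrite [sem n skip _]/= bindM1 (sem_pass_ticks _ (@spec_C n false)) //= hq.
Qed.

Lemma sem_type2 n E a ctx :
  sized n a -> all (sized_item n) E -> size E = n ->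
  sem n p_type2 (Cons (enc_state a) (Cons (enc_list enc_item E) ctx)) =
  [seq Cons (enc_state r) (Cons (enc_list enc_item E) ctx)
    | r <- m_type2 n E a].
Proof.
move=> ha hE hn; rewrite /p_type2 sem_seqM (sem_pass_ticks _ (@spec_A n)) //.
rewrite bindM_map map_bindM.
apply: (@eq_bindM_all _ _ (sized n)).
  by apply: sized_wfold; [rewrite size_nseq|apply/eqP].
move=> r hr; rewrite sem_seqM (sem_eloop _ (@spec_2 n)) //.
rewrite bindM_map map_bindM.
apply: (@eq_bindM_all _ _ (sized n)).
  by apply: (all_foldM _ hr hE) => a' i h1 h2; case: (@spec_2 n _ _ h1 h2).
by move=> r' hr'; rewrite (sem_pass_ticks _ (@spec_C n true)).
Qed.

Lemma sem_check n E X a :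
  sized n a -> all (sized_item n) E -> size E = n -> size X = n ->
  sem n p_check (Cons (enc_state a)
     (Cons (enc_list enc_item E) (enc_list data_of_bool X))) =
  m_check n E X a.
Proof.
case: a => [[q [b w]] st] ha hE hn hX; rewrite /p_check sem_seqM sem_setc.
cbv zeta; rewrite bindM1 -[Cons (Cons (Cons _ _) _) _]/(Cons (enc_state
    ((0, (b, w)), st)) (Cons (enc_list enc_item E) (enc_list data_of_bool X))).
have ha' : sized n ((0, (b, w)), st) by [].
rewrite sem_seqM (sem_eloop _ (@spec_3 n)) // bindM_map.
apply: (@eq_bindM_all _ _ (sized n)).
  by apply: (all_foldM _ ha' hE) => a' i h1 h2; case: (@spec_3 n _ _ h1 h2).
move=> {ha ha'}[[{}q [{}b {}w]] {}st] /eqP; rewrite [(_, st).2]/= => hst.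
rewrite sem_asg_seq [feval _ _]/= sem_seqM sem_first [hd _]/= [tl _]/=.
have hz : size (zip X st) = n by rewrite size_zip hX hst minnn.
have := @sem_walk _ _ _ _ _ _ enc_ctl enc_unit data_of_bool enc_cell
  data_of_bool enc_cell f_fin n p_fin (@spec_fin n) (q, (b, q))
  Nil (enc_list data_of_bool X) (enc_list enc_cell st)
  (zip (ticks n) (zip X st)).
rewrite {1}/enc_ctl [(_, _).1]/= [(_, _).2]/= => ->.
- rewrite -map_comp bindM_map -bindM_ret.
  apply: (@eq_bindM_all _ _ predT); first exact: all_predT.
  move=> [[q' [b' w']] l] _; rewrite sem_if.
  set v := Cons _ _.
  have -> : truthy (feval v (FTl (FTl (FHd (FHd FId))))) = (0 < w').
    exact: truthy_unary.
  by rewrite [(_, l).1]/=; case: (0 < w').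
- by rewrite size_zip hz size_nseq minnn.
- by rewrite unzip1_zip ?hz ?size_nseq //; apply: reads_Nil.
- rewrite unzip2_zip ?hz ?size_nseq // unzip1_zip ?hX ?hst //.
  exact: reads_data_of_seq.
- rewrite unzip2_zip ?hz ?size_nseq // unzip2_zip ?hX ?hst //.
  exact: reads_data_of_seq.
Qed.

Lemma sized_type1 n E a :
  sized n a -> all (sized_item n) E -> all (sized n) (m_type1 n E a).
Proof.
move=> ha hE; apply: (@all_bindM _ _ (sized n)).
  by apply: (all_foldM _ ha hE) => a' i h1 h2; case: (@spec_1 n _ _ h1 h2).
move=> [[q [b w]] st] /eqP h; apply: sized_wfold => //; exact: size_nseq.
Qed.

Lemma sized_type2 n E a :
  sized n a -> all (sized_item n) E -> all (sized n) (m_type2 n E a).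
Proof.
move=> ha hE; apply: (@all_bindM _ _ (sized n)).
  by apply: sized_wfold; [rewrite size_nseq|apply/eqP].
move=> r hr; apply: (@all_bindM _ _ (sized n)).
  by apply: (all_foldM _ hr hE) => a' i h1 h2; case: (@spec_2 n _ _ h1 h2).
move=> r' /eqP h; apply: sized_wfold => //; exact: size_nseq.
Qed.

Definition sized_sel (n : nat) (a : sel_state) : bool :=
  sized n a.1 && all (sized_item n) a.2.2.

Lemma sized_gsel n a row :
  sized_sel n a -> size row == n -> all (sized_sel n) (g_sel n a row).
Proof.
case: a => [[[q [b w]] st] [i E]] /andP[/eqP /= hst hE] /eqP hrow.
rewrite all_map; apply: sub_all (size_wfold _ _ _) => r /eqP.
rewrite !size_zip size_mkseq hst hrow !minnn => hr.
by rewrite /sized_sel /sized /sized_item /= !size_map hr eqxx.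
Qed.

Lemma size_items_foldM n a M :
  all (fun b => size b.2.2 == size a.2.2 + size M) (foldM (g_sel n) a M).
Proof.
elim: M a => [|row M IH] a /=; first by rewrite addn0 eqxx.
rewrite -/(bindM (g_sel n a row) (foldM (g_sel n) ^~ M)).
apply: (@all_bindM _ _ (fun b => size b.2.2 == (size a.2.2).+1)).
  case: a => [[[q [b w]] st] [i E]] /=; rewrite all_map.
  by apply: sub_all (all_predT _) => r _ /=.
by move=> b /eqP hb; rewrite addnS -addSn -hb.
Qed.

(** From here on only the list [m_main] matters: its members are the reports and its length is the
    number of leaves. *)
Lemma sem_main n M X :
  size M = n -> all (fun r => size r == n) M -> size X = n ->
  sem n p_main (Cons (enc_list (enc_list data_of_bool) M)
                     (enc_list data_of_bool X)) =
  m_main n M X.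
Proof.
move=> hM hMr hX; rewrite /p_main sem_asg_seq [feval _ _]/= -enc_initial.
rewrite feval_iter_cons [feval _ FNil]/= -/(unary t).
have ha : sized n ((0, (1, t)), initial X).
  by rewrite /sized /= size_map hX.
rewrite -[Cons (Cons (Cons _ _) _) _]/(Cons (enc_state
    ((0, (1, t)), initial X)) (Cons (enc_list (enc_list data_of_bool) M)
     (enc_list enc_cell (initial X)))).
rewrite sem_seqM (sem_pass_ticks _ (@spec_bud n)) // bindM_map.
apply: (@eq_bindM_all _ _ (sized n)).
  by apply: sized_wfold; [rewrite size_nseq|apply/eqP].
move=> r hr; rewrite sem_asg_seq [feval _ _]/= sem_seqM sem_first.
rewrite [hd _]/= [tl _]/=.
have hr' : sized_sel n (r, (0, [::])) by rewrite /sized_sel hr.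
pose l := [seq (x, (tt, tt)) | x <- M].
have hl : unzip2 l = nseq (size M) (tt, tt).
  by rewrite /l; elim: (M) => //= i M' ->.
rewrite -[Cons (enc_state r) (Cons _ Nil)]/(enc_sel (r, (0, [::]))).
rewrite (@sem_loop_inv _ _ _ _ enc_sel (enc_list data_of_bool) enc_unit enc_unit
  (fun a i => g_sel n a i.1) (sized_sel n) (fun i => size i.1 == n) n p_gsel
  _ _ _ _ _ _ l); first last.
- by rewrite hl; elim: (size M).
- by rewrite hl; elim: (size M).
- by rewrite /unzip1 -map_comp map_id; apply: reads_data_of_seq.
- by rewrite size_map.
- by rewrite all_map.
- exact: hr'.
- by move=> a i h1 h2; apply: sized_gsel.
- by move=> a i [] [] /andP[/eqP h1 _] /eqP h2; apply: sem_gsel.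
rewrite foldM_map bindM_map bindM_map.
pose P a := sized_sel n a && (size a.2.2 == n).
have hP : all P (foldM (g_sel n) (r, (0, [::])) M).
  rewrite all_predI (all_foldM (@sized_gsel n) hr' hMr) /=.
  by have := size_items_foldM n (r, (0, [::])) M; rewrite hM.
apply: (eq_bindM_all hP) => -[a [i E]] /andP[/andP[h1 h2] /eqP h3].
rewrite /= in h1 h2 h3.
rewrite sem_asg_seq [feval _ _]/= sem_seqM sem_branch.
rewrite (sem_type1 _ h1) // (sem_type2 _ h1) // -map_cat bindM_map.
apply: (@eq_bindM_all _ _ (sized n)).
  by rewrite all_cat sized_type1 // sized_type2.
by move=> b hb; rewrite enc_initial sem_check.
Qed.

End Algorithm.

(** * Preparation and final test *)

Lemma cell_eq_dec (u v : cell) : decidable (u = v).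
Proof. by rewrite /decidable; decide equality; [exact: eq_comparable|decide equality]. Qed.
HB.instance Definition _ := hasDecEq.Build cell (compareP cell_eq_dec).

Notation hbit e j := (nth (false, false) e.2 j).1.
Notation sbit e j := (nth (false, false) e.2 j).2.

Lemma count_zip_nth (A B : Type) (x0 : A) (y0 : B) (P : pred (A * B)) (l : seq A) (l' : seq B) n :
  size l = n -> size l' = n ->
  count P (zip l l') = \sum_(j < n) P (nth x0 l j, nth y0 l' j).
Proof.
move=> <-; elim: l l' => [|x l IH] [|y l'] //=; first by rewrite big_ord0.
by move=> [hs]; rewrite big_ord_recl /= IH.
Qed.

Lemma count_nth (A : Type) (x0 : A) (P : pred A) (l : seq A) n :
  size l = n -> count P l = \sum_(j < n) P (nth x0 l j).
Proof.
move=> <-; elim: l => [|x l IH] //=; first by rewrite big_ord0.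
by rewrite big_ord_recl /= IH.
Qed.

Lemma count_sum (A : Type) (P : pred A) (l : seq A) :
  count P l = \sum_(x <- l) P x.
Proof. by elim: l => [|x l IH]; rewrite ?big_nil ?big_cons //= IH. Qed.

Lemma foldM_cons (A I : Type) (g : A -> I -> seq A) a i l :
  foldM g a (i :: l) = bindM (g a i) (foldM g ^~ l).
Proof. by []. Qed.

Lemma wfold_cons (T A B : Type) (f : T -> A -> seq (T * B)) c x l :
  wfold f c (x :: l) =
  bindM (f c x) (fun y => [seq (r.1, y.2 :: r.2) | r <- wfold f y.1 l]).
Proof. by []. Qed.

Section Check.

Lemma wfold_fixed (T A B : Type) (f : T -> A -> seq (T * B)) (h : A -> B) c l :
  (forall x, f c x = [:: (c, h x)]) -> wfold f c l = [:: (c, map h l)].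
Proof. by move=> hf; elim: l => //= x l IH; rewrite hf /= cats0 IH. Qed.

Definition hits (l : seq ((bool * bool) * cell)) : nat :=
  count (fun x => x.1.1 && is_in x.2) l.

Lemma wfold_hit q b w l :
  wfold f_hit (q, (b, w)) l = [:: ((q, (b, w + hits l)), unzip2 l)].
Proof.
elim: l w => [|x l IH] w /=; first by rewrite addn0.
by case: ifP => _ /=; rewrite cats0 IH /= ?addnA ?addn1 // add0n.
Qed.

Definition chosen (D : seq bool) (m : nat -> bool) : seq cell :=
  mkseq (fun j => if nth false D j then In (m j) else Out) (size D).

Definition hcount (e : item) (D : seq bool) : nat :=
  \sum_(j < size D) (hbit e j && nth false D j).

Lemma hits_chosen e D m :
  size e.2 = size D -> hits (zip e.2 (chosen D m)) = hcount e D.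
Proof.
move=> he; rewrite /hits (count_zip_nth (false, false) Out _ he); last first.
  by rewrite size_mkseq.
by apply: eq_bigr => j _; rewrite nth_mkseq //=; case: (nth false D j).
Qed.

Lemma g_3_chosen q b w e D m :
  size e.2 = size D ->
  g_3 ((q, (b, w)), chosen D m) e =
  [:: ((if hcount e D == 0 then 1 else q, (b, hcount e D)),
      chosen D (fun j => m j || (hbit e j && (hcount e D == 1))))].
Proof.
move=> he; rewrite /g_3 wfold_hit bindM1 hits_chosen // add0n.
have hu : unzip2 (zip e.2 (chosen D m)) = chosen D m.
  by rewrite unzip2_zip // size_mkseq he.
rewrite [(_, _).2]/= hu [(_, _).1]/=.
set c := flag _; have -> : c = (if hcount e D == 0 then 1 else q, (b, hcount e D)).
  by rewrite /c /flag; case: ifP.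
rewrite (@wfold_fixed _ _ _ f_mark
  (fun x => if [&& x.1.1, is_in x.2 & hcount e D == 1] then In true else x.2)).
  congr [:: (_, _)]; apply: (@eq_from_nth _ Out).
    by rewrite size_map size_zip !size_mkseq he minnn.
  move=> j; rewrite size_map size_zip size_mkseq he minnn => hj.
  rewrite (nth_map ((false, false), Out)) ?size_zip ?size_mkseq ?he ?minnn //.
  rewrite nth_zip ?size_mkseq // !nth_mkseq //=.
  by case: (nth false D j) => //=; rewrite ?andbF //; case: (hbit e j) => //=;
    rewrite ?orbF //; case: (hcount e D == 1); rewrite ?orbF ?orbT.
by move=> x; rewrite /f_mark /=; case: ifP.
Qed.

Lemma foldM_g_3 q b w E D m :
  all (sized_item (size D)) E ->
  exists w', foldM g_3 ((q, (b, w)), chosen D m) E =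
  [:: ((if has (fun e => hcount e D == 0) E then 1 else q, (b, w')),
      chosen D (fun j =>
        m j || has (fun e => hbit e j && (hcount e D == 1)) E))].
Proof.
elim: E q w m => [|e E IH] q w m; first by
  exists w; congr [:: (_, _)]; apply: eq_mkseq => j; rewrite orbF.
case/andP=> /eqP he hE; rewrite foldM_cons g_3_chosen // bindM1.
have [w' ->] := IH (if hcount e D == 0 then 1 else q) (hcount e D)
  (fun j => m j || (hbit e j && (hcount e D == 1))) hE.
exists w'; congr [:: (_, _)]; last first.
  by apply: eq_mkseq => j; rewrite orbA.
by rewrite /=; case: (hcount e D == 0) => //=; case: ifP.
Qed.

Definition valid (E : seq item) (X D : seq bool) : bool :=
  all (fun e => 0 < hcount e D) E &&
  all (fun j => nth false D j ==>
         nth false X j && has (fun e => hbit e j && (hcount e D == 1)) E)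
      (iota 0 (size D)).

Lemma m_check_chosen E X D c :
  all (sized_item (size D)) E -> size X = size D ->
  m_check (size D) E X (c, chosen D (fun=> false)) =
  [:: if valid E X D then Cons Nil (enc_list data_of_bool D) else Nil].
Proof.
case: c => q [b w] hE hX; rewrite /m_check /=.
have [w' ->] := foldM_g_3 0 b w (fun=> false) hE; rewrite bindM1 /=.
set bad := has _ E; set m := (fun j => has _ E).
set q' := if bad then 1 else 0.
have H (c : ctl) (l : seq (unit * (bool * cell))) : wfold f_fin c l =
   [:: ((c.1, (c.2.1, if has (fun x => if x.2.2 is In b then ~~ (b && x.2.1) else false) l
          then 1 else c.2.2)), [seq (is_in x.2.2, x.2.2) | x <- l])].
  elim: l c => [|[[] [u z]] l IH] [q1 [b1 w1]] //=.
  by case: z => [|y|y] /=; rewrite ?IH /= ?orbF //; case: ifP => _ /=;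
    rewrite ?cats0 IH //=; case: ifP.
rewrite H /= /valid; congr [:: _].
set l := zip _ _.
have hl : size l = size D.
  by rewrite !size_zip size_mkseq hX size_nseq !minnn.
have hnth j : j < size D -> nth (tt, (false, Out)) l j =
    (tt, (nth false X j, if nth false D j then In (m j) else Out)).
  move=> hj; rewrite !nth_zip ?size_zip ?size_mkseq ?hX ?minnn ?size_nseq //.
  by rewrite nth_nseq hj nth_mkseq.
have -> : has (fun x => if x.2.2 is In b0 then ~~ (b0 && x.2.1) else false) l =
    ~~ all (fun j => nth false D j ==> nth false X j && m j) (iota 0 (size D)).
  rewrite -has_predC; apply/hasP/hasP.
    case=> x /(nthP (tt, (false, Out))) [j]; rewrite hl => hj <-.
    rewrite hnth // /=; case E1: (nth false D j) => // h; exists j.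
      by rewrite mem_iota add0n hj.
    by rewrite /= E1 /= andbC.
  case=> j; rewrite mem_iota add0n => /= hj; case E1: (nth false D j) => //= h.
  exists (nth (tt, (false, Out)) l j); first by rewrite mem_nth // hl.
  by rewrite hnth //= E1 andbC.
have -> : all (fun e => 0 < hcount e D) E = ~~ bad.
  rewrite -all_predC; apply: eq_all => e /=; exact: lt0n.
rewrite /q' {q'}; case: bad => /=; first by rewrite if_same.
case: (all _ _) => //=; congr Cons; congr enc_list.
apply: (@eq_from_nth _ false); first by rewrite !size_map hl.
move=> j; rewrite !size_map hl => hj.
rewrite (nth_map (false, Out)) ?size_map ?hl //.
by rewrite (nth_map (tt, (false, Out))) ?hl // hnth //=; case: (nth false D j).
Qed.

End Check.

(** * Invariants of the budget and block selection passes *)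

Section Prep.
Variables k D s t : nat.

(** Division by [t] with a counter: [t - w] is the running remainder, and every wrap-around buys one
    unit of [q] and [s] units of [b]. *)
Lemma wfold_bud q b w (l : seq (unit * cell)) :
  0 < w <= t -> exists q' w',
  wfold (f_bud s t) (q, (b, w)) l = [:: ((q + q', (s * q' + b, w')), unzip2 l)] /\
  [/\ 0 < w' <= t & count (fun x => is_und x.2 || is_in x.2) l + (t - w) = t * q' + (t - w')].
Proof.
elim: l q b w => [|[[] z] l IH] q b w hw /=.
  by exists 0, w; rewrite !(addn0, muln0, add0n).
case: z => [|y|y] /=.
- by have [q' [w' [-> h]]] := IH q b w hw; exists q', w'; rewrite add0n.
- case: ifP => hw1 /=.
    have [|q' [w' [-> [h1 h2]]]] := IH q b w.-1; first by lia.
    by exists q', w'; split=> //; split=> //; lia.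
  have [|q' [w' [-> [h1 h2]]]] := IH q.+1 (s + b) t; first by lia.
  exists q'.+1, w'; rewrite /= addnS addSn mulnS addnCA addnA; split=> //.
  by split=> //; rewrite mulnS; lia.
- case: ifP => hw1 /=.
    have [|q' [w' [-> [h1 h2]]]] := IH q b w.-1; first by lia.
    by exists q', w'; split=> //; split=> //; lia.
  have [|q' [w' [-> [h1 h2]]]] := IH q.+1 (s + b) t; first by lia.
  exists q'.+1, w'; rewrite /= addnS addSn mulnS addnCA addnA; split=> //.
  by split=> //; rewrite mulnS; lia.
Qed.

(** Here [w] is the room left at the end of the row. Room only shrinks, so if some is left at the
    end there was some at this vertex, and an undecided vertex kept out of the block must be
    saturated. *)
Definition sel_ok (w : nat) (x : bool * (bool * cell))
    (y : (bool * bool) * cell) : bool :=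
  (y.1.1 == x.1 || x.2.1) &&
  if y.1.2 then y.1.1 && (if x.2.2 is Und l then (l < D) && (y.2 == Und l.+1)
                          else false)
  else (y.2 == x.2.2) &&
       ([&& 0 < w, y.1.1 & is_und x.2.2] ==>
        if x.2.2 is Und l then D <= l else true).

Lemma wfold_sel q b w l :
  exists w' res,
  [/\ wfold (f_sel D) (q, (b, w)) l = [:: ((q, (b, w')), res)],
      count (fun y => y.1.2) res + w' = w & all2 (sel_ok w') l res].
Proof.
elim: l w => [|x l IH] w; first by exists w, [::].
suff [w1 [y [fE hy1 hy2]]] : exists w1 y,
    [/\ f_sel D (q, (b, w)) x = [:: ((q, (b, w1)), y)], y.1.2 + w1 = w
      & forall w', w' <= w1 -> sel_ok w' x y].
  have [w' [res [h1 h2 h3]]] := IH w1.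
  exists w', (y :: res); rewrite wfold_cons fE bindM1 h1; split=> //=.
    by rewrite -addnA h2.
  by rewrite h3 hy2 // -h2 leq_addl.
case: x => r [u z]; rewrite /f_sel; case hru: (r || u); last first.
  exists w, ((false, false), z); split=> // w' _.
  by rewrite /sel_ok /= hru !eqxx andbF.
have triv : (w == 0) || (if z is Und l then D <= l else true) ->
    forall w', w' <= w -> sel_ok w' (r, (u, z)) ((true, false), z).
  move=> h w' hw; rewrite /sel_ok /= hru !eqxx /=; apply/implyP => /andP[hw' _].
  by move: h; rewrite -leqn0 leqNgt (leq_trans hw' hw).
case: z triv => [|y|y] triv;
  try by [exists w, ((true, false), Out); split; rewrite ?orbT //; apply: triv;
          rewrite orbT
         |exists w, ((true, false), In y); split; rewrite ?orbT //; apply: triv;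
          rewrite orbT].
case: ifP => hy.
  by exists w, ((true, false), Und y); split=> //; apply: triv; rewrite hy orbT.
case: ifP => hw; last first.
  by exists w, ((true, false), Und y); split=> //; apply: triv; lia.
exists w.-1, ((true, true), Und y.+1); split=> //=; first by lia.
by move=> w' _; rewrite /sel_ok /= hru !eqxx /= ltnNge hy.
Qed.

Lemma all2_nth (A B : Type) (x0 : A) (y0 : B) (P : A -> B -> bool) l l' j :
  all2 P l l' -> j < size l -> P (nth x0 l j) (nth y0 l' j).
Proof.
elim: l l' j => [|x l IH] [|y l'] [|j] //= /andP[hx hl]; first by [].
exact: IH.
Qed.

Definition load (E : seq item) (j : nat) : nat := count (fun e => sbit e j) E.

Definition st_of (n : nat) (X : seq bool) (E : seq item) : seq cell :=
  mkseq (fun j => if nth false X j then Und (load E j) else Out) n.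

Definition scount (e : item) : nat := count (fun y => y.2) e.2.

(** Saturation is judged by the loads of all of [E]. Loads only grow, so a bound on this number,
    once reached, survives the later selections. *)
Definition free_count (n : nat) (X : seq bool) (E : seq item) (e : item) : nat :=
  \sum_(j < n) [&& hbit e j, nth false X j & load E j < D].

Definition good_items (n : nat) (X : seq bool) (E : seq item) : Prop :=
  [/\ forall e, e \in E -> size e.2 = n,
      forall e j, e \in E -> sbit e j -> hbit e j && nth false X j,
      forall e, e \in E -> scount e + e.1 = k,
      forall e, e \in E -> 0 < e.1 -> free_count n X E e < k
    & forall j, load E j <= D].

Definition closed_row (n i : nat) (row : seq bool) : seq bool :=
  mkseq (fun j => nth false row j || (j == i)) n.

Lemma g_sel_good n X q b w i E row :
  size row = n -> good_items n X E ->
  exists e w', g_sel k D n (((q, (b, w)), st_of n X E), (i, E)) row =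
    [:: (((q, (b, w')), st_of n X (e :: E)), (i.+1, e :: E))] /\
    [/\ good_items n X (e :: E) & unzip1 e.2 = closed_row n i row].
Proof.
move=> hrow [G1 G2 G3 G4 G5]; rewrite /g_sel.
set l := zip row _.
have hl : size l = n by rewrite !size_zip !size_mkseq hrow !minnn.
have hnth j : j < n -> nth (false, (false, Out)) l j =
    (nth false row j, (j == i, if nth false X j then Und (load E j) else Out)).
  move=> hj; rewrite !nth_zip ?size_zip ?size_mkseq ?minnn //.
  by rewrite !nth_mkseq.
have [w' [res [-> hc hres]]] := wfold_sel q b k l.
have hsz : size res = n by move: hres; rewrite all2E hl => /andP[/eqP <-].
set e : item := (w', unzip1 res).
have hP j : j < n -> sel_ok w' (nth (false, (false, Out)) l j)
    (nth ((false, false), Out) res j).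
  by move=> hj; apply: all2_nth; rewrite ?hl.
have he j : j < n -> nth (false, false) e.2 j = (nth ((false, false), Out) res j).1.
  by move=> hj; rewrite (nth_map ((false, false), Out)) ?hsz.
have he' j : n <= j -> nth (false, false) e.2 j = (false, false).
  by move=> hj; rewrite nth_default // size_map hsz.
exists e, w'; split.
  rewrite /=; congr [:: ((_, _), _)].
  rewrite /st_of; apply: (@eq_from_nth _ Out).
    by rewrite size_map hsz size_mkseq.
  move=> j; rewrite size_map hsz => hj.
  rewrite (nth_map ((false, false), Out)) ?hsz // nth_mkseq //=.
  move: (hP j hj); rewrite hnth // /sel_ok /= => /andP[_].
  rewrite /load /= he //; case: ifP => _.
    case/andP=> _; case: ifP => // _ /andP[_ /eqP ->]; by rewrite add1n.
  by case/andP=> /eqP -> _.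
have mono j : load E j <= load (e :: E) j by rewrite /load /= leq_addl.
split; last first.
  apply: (@eq_from_nth _ false); first by rewrite /closed_row size_mkseq !size_map hsz.
  move=> j; rewrite !size_map hsz => hj.
  rewrite (nth_map (false, false)) ?size_map ?hsz // he // nth_mkseq //.
  by move: (hP j hj); rewrite hnth // /sel_ok /= => /andP[/eqP].
split.
- by move=> e'; rewrite inE => /orP[/eqP ->|/G1 //]; rewrite size_map hsz.
- move=> e' j; rewrite inE => /orP[/eqP ->|/G2]; last exact.
  have [hj|hj] := ltnP j n; last by rewrite he'.
  move: (hP j hj); rewrite hnth // he // /sel_ok /= => /andP[_]; case: ifP => // _.
  by case/andP=> -> ; case: ifP.
- move=> e'; rewrite inE => /orP[/eqP ->|/G3 //].
  by rewrite /scount -hc /= count_map.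
- move=> e'; rewrite inE => /orP[/eqP -> /= hw|h1 h2]; last first.
    apply: leq_ltn_trans (G4 _ h1 h2); apply: leq_sum => j _.
    case: (hbit _ _) => //=; case: (nth false X j) => //=.
    by case: (ltnP (load (e :: E) j)) => //= /(leq_ltn_trans (mono j)) ->.
  (* With room left, every unsaturated vertex of the hyperedge is in the block, and the block has
     fewer than [k] vertices. *)
  suff hf : free_count n X (e :: E) e <= scount e.
    apply: leq_ltn_trans hf _; rewrite -hc /scount count_map -[X in X < _]addn0 ltn_add2l;
    exact: hw.
  rewrite /scount (@count_nth _ (false, false) _ _ n) ?size_map ?hsz //.
  apply: leq_sum => j _; case h: [&& _, _ & _] => //.
  case/and3P: h => hh hX hlo; rewrite he ?ltn_ord //.
  move: (hP j (ltn_ord j)); rewrite hnth // /sel_ok /= -he // hX.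
  case: ifP => // _ /andP[_ /andP[_]]; rewrite hw hh /=.
  by rewrite leqNgt (leq_ltn_trans (mono j) hlo).
- move=> j; rewrite /load /= -/(load E j).
  have [hj|hj] := ltnP j n; last by rewrite he' // add0n.
  move: (hP j hj); rewrite hnth // he // /sel_ok /= => /andP[_]; case: ifP => _.
    by case/andP=> _; case: ifP => // _ /andP[].
  by rewrite add0n.
Qed.

(** Selection does not branch and looks only at the graph and X, so all root-to-leaf paths share one
    family of blocks. *)
Lemma foldM_sel n X q b w M :
  size M = n -> all (fun r => size r == n) M ->
  exists E w' i', foldM (g_sel k D n) (((q, (b, w)), st_of n X [::]), (0, [::])) M =
    [:: (((q, (b, w')), st_of n X E), (i', E))] /\
    [/\ good_items n X E, size E = n &
        rev [seq unzip1 e.2 | e <- E] =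
        mkseq (fun i => closed_row n i (nth [::] M i)) n].
Proof.
move=> hM hr; suff H M' i E : all (fun r => size r == n) M' -> good_items n X E ->
  exists E' w' i', foldM (g_sel k D n) (((q, (b, w)), st_of n X E), (i, E)) M' =
    [:: (((q, (b, w')), st_of n X (E' ++ E)), (i', E' ++ E))] /\
    [/\ good_items n X (E' ++ E), size E' = size M' &
        rev [seq unzip1 e.2 | e <- E'] =
        mkseq (fun j => closed_row n (j + i) (nth [::] M' j)) (size M')].
  have [|E' [w' [i' [h1 [h2 h3 h4]]]]] := H M 0 [::] hr; first by split.
  exists E', w', i'; rewrite h1 cats0; split=> //; split=> //.
  - by move: h2; rewrite cats0.
  - by rewrite h3.
  - by rewrite h4 hM; apply: eq_mkseq => j; rewrite addn0.
elim: M' i E w => {M hM hr} [|row M IH] i E w hr hE.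
  by exists [::], w, i.
case/andP: hr => /eqP hrow hM; rewrite foldM_cons.
have [e [w1 [-> [h1 h2]]]] := g_sel_good q b w i hrow hE; rewrite bindM1.
have [E' [w' [i' [h3 [h4 h5 h6]]]]] := IH i.+1 (e :: E) w1 hM h1.
exists (rcons E' e), w', i'; rewrite cat_rcons h3; split=> //; split=> //.
  by rewrite size_rcons h5.
rewrite map_rcons rev_rcons h6 h2 /mkseq /= add0n; congr cons.
rewrite (iotaDl 1 0) -map_comp; apply: eq_map => j /=; by rewrite addnS.
Qed.

Lemma sum_load n X E : good_items n X E ->
  \sum_(j < n) load E j <= k * size E.
Proof.
move=> [G1 _ G3 _ _].
have -> : \sum_(j < n) load E j = \sum_(e <- E) scount e.
  have lE (j : 'I_n) : true -> load E j = \sum_(e <- E) sbit e j.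
    by rewrite /load count_sum.
  rewrite (eq_bigr _ lE) exchange_big /= big_seq [RHS]big_seq; apply: eq_bigr => e he.
  by rewrite /scount (@count_nth _ (false, false) _ _ n) // G1.
rewrite mulnC -sum1_size big_distrl /= big_seq [leqRHS]big_seq.
by apply: leq_sum => e he; rewrite mul1n -(G3 _ he) leq_addr.
Qed.

(** Markov's inequality for the loads; by [sum_load] they sum to at most [k] per hyperedge. *)
Lemma saturated_count n X E : good_items n X E ->
  D * (\sum_(j < n) (nth false X j && (D <= load E j))) <= k * size E.
Proof.
move=> hE; apply: leq_trans (sum_load hE); rewrite big_distrr /=.
by apply: leq_sum => j _; case: (nth false X j) => //=; case: leqP; lia.
Qed.

End Prep.

(** * Completeness *)

Section Paths.

Definition agree (z : cell) (d : bool) : bool :=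
  match z with Out => ~~ d | Und _ => true | In _ => d end.

(** The target [d] is a function on all of [nat], so that passing to the tail is a shift. The
    default [Out] forces [d] to be false beyond the end. *)
Definition agrees (st : seq cell) (d : nat -> bool) : Prop :=
  forall j, agree (nth Out st j) (d j).

Definition refine (z z' : cell) : bool :=
  (z' == z) || (is_und z && ~~ is_und z').

Definition refines (st st' : seq cell) : Prop :=
  forall j, refine (nth Out st j) (nth Out st' j).

Lemma refine_refl z : refine z z.
Proof. by rewrite /refine eqxx. Qed.

Lemma refine_trans z2 z1 z3 : refine z1 z2 -> refine z2 z3 -> refine z1 z3.
Proof.
rewrite /refine => /orP[/eqP -> //|/andP[h1 h2]] /orP[/eqP ->|/andP[h3 h4]].
  by rewrite h1 h2 orbT.
by rewrite h1 h4 orbT.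
Qed.

Lemma refines_refl st : refines st st.
Proof. by move=> j; apply: refine_refl. Qed.

Lemma refines_trans st2 st1 st3 :
  refines st1 st2 -> refines st2 st3 -> refines st1 st3.
Proof. by move=> h1 h2 j; apply: refine_trans (h2 j). Qed.

Lemma refine_in z z' : refine z z' -> is_in z -> is_in z'.
Proof. by rewrite /refine => /orP[/eqP ->|/andP[]] //; case: z. Qed.

Lemma refine_und z z' : refine z z' -> is_und z' -> is_und z.
Proof. by rewrite /refine => /orP[/eqP ->|/andP[-> _]]. Qed.

Lemma refines_cons z st z' st' :
  refine z z' -> refines st st' -> refines (z :: st) (z' :: st').
Proof. by move=> h1 h2 [|j] //=; exact: h2. Qed.

Lemma agrees_cons z st (d : nat -> bool) :
  agree z (d 0) -> agrees st (fun j => d j.+1) -> agrees (z :: st) d.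
Proof. by move=> h1 h2 [|j] //=; exact: h2. Qed.

Lemma mem_bindM (A B : eqType) (l : seq A) (f : A -> seq B) x y :
  x \in l -> y \in f x -> y \in bindM l f.
Proof. by move=> hx hy; apply/flatten_mapP; exists x. Qed.

Lemma mem_wfold_cons (T A B : eqType) (f : T -> A -> seq (T * B)) c x l y r :
  y \in f c x -> r \in wfold f y.1 l ->
  (r.1, y.2 :: r.2) \in wfold f c (x :: l).
Proof.
move=> hy hr; rewrite wfold_cons; apply: (mem_bindM hy).
by apply/mapP; exists r.
Qed.

Definition decided (d : nat -> bool) (n : nat) : seq cell :=
  mkseq (fun j => if d j then In false else Out) n.

Lemma decidedS d n :
  decided d n.+1 =
  (if d 0 then In false else Out) :: decided (fun j => d j.+1) n.
Proof.
by rewrite /decided /mkseq /= (iotaDl 1 0) -map_comp.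
Qed.

Lemma path_C dec q b w st (d : nat -> bool) :
  agrees st d ->
  (if dec then \sum_(j < size st) (is_und (nth Out st j) && d j) <= b
   else 0 < b) ->
  exists c, (c, decided d (size st)) \in
    wfold (f_C dec) (q, (b, w)) (zip (ticks (size st)) st).
Proof.
elim: st b d => [|z st IH] b d ha hb; first by exists (q, (b, w)); rewrite inE.
have ha0 : agree z (d 0) := ha 0.
have ha1 : agrees st (fun j => d j.+1) by move=> j; exact: (ha j.+1).
have hsum : \sum_(j < size (z :: st)) (is_und (nth Out (z :: st) j) && d j) =
    (is_und z && d 0) + \sum_(j < size st) (is_und (nth Out st j) && d j.+1).
  by rewrite big_ord_recl.
rewrite hsum in hb; rewrite [size _]/= decidedS.
pose b' := if dec && (is_und z && d 0) then b.-1 else b.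
have hb' : if dec then \sum_(j < size st) (is_und (nth Out st j) && d j.+1) <= b'
   else 0 < b'.
  move: hb; rewrite /b'; case: (dec) => //=.
  by case: (is_und z && d 0); rewrite ?add0n // add1n; lia.
have [c hc] := IH b' _ ha1 hb'.
exists c; rewrite [ticks _]/=.
apply: (@mem_wfold_cons _ _ _ (f_C dec) (q, (b, w)) (tt, z) _
  ((q, (b', w)), if d 0 then In false else Out) (c, _)) hc.
rewrite /f_C /= /b'; case: z ha ha0 hb {b' hb' hsum} => [|y|y] _ /=.
- by move=> /negPf ->; rewrite andbF inE.
- move=> _ hb; case E: (d 0) => /=.
    have -> : 0 < b.
      by move: hb; case: (dec) => //; rewrite E add1n; case: (b).
    by rewrite andbT; case: (dec); rewrite ?subn1 ?subn0 inE eqxx.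
  by rewrite andbF; case: ifP => _; rewrite !inE eqxx ?orbT.
- by move=> ->; rewrite andbF inE.
Qed.

Lemma path_A D c st (d : nat -> bool) :
  agrees st d ->
  exists st', [/\ (c, st') \in wfold (f_A D) c (zip (ticks (size st)) st),
    agrees st' d & size st' = size st].
Proof.
elim: st d => [|z st IH] d ha; first by exists [::]; rewrite inE.
have ha0 : agree z (d 0) := ha 0.
have ha1 : agrees st (fun j => d j.+1) by move=> j; exact: (ha j.+1).
have [st' [h1 h2 h3]] := IH _ ha1.
suff [z' hz hz'] : exists2 z', (c, z') \in f_A D c (tt, z) & agree z' (d 0).
  exists (z' :: st'); split; last by rewrite /= h3.
    exact: (@mem_wfold_cons _ _ _ (f_A D) c (tt, z) _ (c, z') (c, st')).
  exact: agrees_cons.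
rewrite /f_A /=; case: z {ha} ha0 => [|y|y] /= ha0.
- by exists Out; rewrite ?inE.
- case: ifP => _; last by exists (Und y); rewrite ?inE.
  by exists (if d 0 then In false else Out); case: (d 0); rewrite ?inE ?eqxx ?orbT.
- by exists (In y); rewrite ?inE.
Qed.

(** The path excludes the undecided vertices of the hyperedge up to the first one in [d]; choosing
    it sets [w] to 1, and the later vertices stay undecided. The last clause says that a newly
    positive [w] comes from a vertex of the hyperedge. *)
Lemma path_B q b w row st (d : nat -> bool) :
  0 < b -> size row = size st -> agrees st d ->
  exists w' st', [/\ ((q, (b, w')), st') \in wfold f_B (q, (b, w)) (zip row st),
    agrees st' d, refines st st', size st' = size st &
    [/\ 0 < w -> 0 < w',
        forall j, [&& (nth (false, false) row j).1, d j &
                      is_und (nth Out st j)] -> 0 < w' &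
        w = 0 -> 0 < w' -> exists j, (nth (false, false) row j).1 &&
                                     is_in (nth Out st' j)]].
Proof.
move=> b0; elim: st row d w => [|z st IH] [|x row] d w //.
  move=> _ ha; exists w, [::]; split=> //; first by rewrite inE.
    exact: refines_refl.
  by split=> [//|j|-> //]; rewrite nth_nil.
move=> [hs] ha.
have ha0 : agree z (d 0) := ha 0.
have ha1 : agrees st (fun j => d j.+1) by move=> j; exact: (ha j.+1).
have step w1 z' : ((q, (b, w1)), z') \in f_B (q, (b, w)) (x, z) ->
    agree z' (d 0) -> refine z z' -> (0 < w -> 0 < w1) ->
    (x.1 && d 0 && is_und z -> 0 < w1) ->
    (w = 0 -> 0 < w1 -> x.1 && is_in z') ->
  exists w' st', [/\ ((q, (b, w')), st') \in
      wfold f_B (q, (b, w)) (zip (x :: row) (z :: st)),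
    agrees st' d, refines (z :: st) st', size st' = size (z :: st) &
    [/\ 0 < w -> 0 < w',
        forall j, [&& (nth (false, false) (x :: row) j).1, d j &
                      is_und (nth Out (z :: st) j)] -> 0 < w' &
        w = 0 -> 0 < w' -> exists j, (nth (false, false) (x :: row) j).1 &&
                                     is_in (nth Out st' j)]].
  move=> h1 h2 h3 h4 h5 h6.
  have [w' [st' [H1 H2 H3 H4 [H5 H6 H7]]]] := IH row _ w1 hs ha1.
  exists w', (z' :: st'); split.
  - exact: (@mem_wfold_cons _ _ _ f_B _ (x, z) _ ((q, (b, w1)), z') (_, st')).
  - exact: agrees_cons.
  - exact: refines_cons.
  - by rewrite /= H4.
  split.
  - by move=> /h4 /H5.
  - move=> [|j] /=; last exact: H6.
    by move=> h; apply: H5; apply: h5; rewrite -andbA.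
  - move=> hw hw'; case: (posnP w1) => [/H7 /(_ hw') [j hj]|hw1].
      by exists j.+1.
    by exists 0; exact: h6.
case E: [&& x.1, is_und z, w == 0 & 0 < b].
  case/and4P: (E) => hx hz /eqP hw _; case Ed: (d 0).
    apply: (step 1 (In false)) => //.
    - by rewrite /f_B E inE eqxx.
    - by rewrite /refine hz orbT.
    - by rewrite hx.
  apply: (step w Out) => //.
  - by rewrite /f_B E !inE eqxx orbT.
  - by rewrite Ed.
  - by rewrite /refine hz orbT.
  - by rewrite Ed andbF.
  - by move=> ->.
apply: (step w z) => //.
- by rewrite /f_B E inE.
- exact: refine_refl.
- move=> /andP[/andP[hx _] hz]; move: E; rewrite hx hz b0 andbT /=.
  by rewrite lt0n => ->.
- by move=> ->.
Qed.

Definition hit_by (st : seq cell) (e : item) : Prop :=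
  exists j, hbit e j && is_in (nth Out st j).

Lemma hit_by_refines st st' e : refines st st' -> hit_by st e -> hit_by st' e.
Proof.
by move=> hr [j /andP[h1 h2]]; exists j; rewrite h1 (refine_in (hr j)).
Qed.

Lemma hits_gt0 (e : item) st : size e.2 = size st ->
  0 < hits (zip e.2 st) <-> hit_by st e.
Proof.
move=> hs; rewrite /hits -has_count; split.
  case/(has_nthP ((false, false), Out)) => j; rewrite size_zip hs minnn => hj.
  by rewrite nth_zip // => h; exists j.
case=> j /andP[h1 h2]; apply/(has_nthP ((false, false), Out)); exists j.
  rewrite size_zip hs minnn ltnNge; apply/negP => hj.
  by move: h2; rewrite nth_default.
by rewrite nth_zip //= h1.
Qed.

Lemma path_2 q b w st e (d : nat -> bool) :
  0 < b -> size e.2 = size st -> agrees st d -> (exists j, hbit e j && d j) ->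
  exists w' st', [/\ ((q, (b, w')), st') \in g_2 ((q, (b, w)), st) e,
    agrees st' d, refines st st', size st' = size st & 0 < e.1 -> hit_by st' e].
Proof.
move=> b0 hs ha [j0 /andP[hj0 hd]]; rewrite /g_2; case: ifP => he; last first.
  by exists w, st; rewrite inE eqxx; split=> //; apply: refines_refl.
rewrite wfold_hit bindM1 add0n [(_, _).1]/= [(_, _).2]/= unzip2_zip ?hs //.
have [w' [st' [H1 H2 H3 H4 [H5 H6 H7]]]] :=
  path_B q (hits (zip e.2 st)) b0 hs ha.
have hh : hit_by st' e /\ 0 < w'.
  case: (posnP (hits (zip e.2 st))) => hh.
    (* The vertex [j0] is undecided: if chosen it would already hit [e], and if excluded it would
       contradict [d]. *)
    have hw' : 0 < w'.
      apply: (H6 j0); rewrite hj0 hd /=.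
      have := ha j0; rewrite hd; case E: (nth Out st j0) => [|y|y] //= _.
      suff : 0 < hits (zip e.2 st) by rewrite hh.
      by apply/hits_gt0 => //; exists j0; rewrite E hj0.
    by split=> //; case: (H7 hh hw') => j hj; exists j.
  by split; [apply: hit_by_refines H3 _; apply/hits_gt0|exact: H5].
case: hh => hh hw'; exists w', st'; split=> //.
apply/mapP; exists ((q, (b, w')), st') => //=.
by rewrite /kill; case: ifP => // /eqP h; move: hw'; rewrite h.
Qed.

Lemma path_foldM_2 q b w st E (d : nat -> bool) :
  0 < b -> {in E, forall e, size e.2 = size st} -> agrees st d ->
  {in E, forall e, exists j, hbit e j && d j} ->
  exists w' st', [/\ ((q, (b, w')), st') \in foldM g_2 ((q, (b, w)), st) E,
    agrees st' d, refines st st', size st' = size st &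
    {in E, forall e, 0 < e.1 -> hit_by st' e}].
Proof.
move=> b0; elim: E w st => [|e E IH] w st hs ha hE.
  by exists w, st; split=> //; [rewrite inE|exact: refines_refl].
have [w1 [st1 [H1 H2 H3 H4 H5]]] := path_2 q w b0 (hs e (mem_head _ _)) ha
  (hE e (mem_head _ _)).
have hs1 : {in E, forall e, size e.2 = size st1}.
  by move=> e' he'; rewrite H4 hs // inE he' orbT.
have hE1 : {in E, forall e, exists j, hbit e j && d j}.
  by move=> e' he'; apply: hE; rewrite inE he' orbT.
have [w2 [st2 [K1 K2 K3 K4 K5]]] := IH w1 st1 hs1 H2 hE1.
exists w2, st2; split=> //.
- by rewrite foldM_cons; apply: (mem_bindM H1).
- exact: refines_trans K3.
- by rewrite K4.
- move=> e'; rewrite inE => /orP[/eqP ->|he'] h; last exact: K5.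
  by apply: hit_by_refines K3 _; exact: H5.
Qed.

Lemma path_decl q b w row st (d : nat -> bool) :
  size row = size st -> agrees st d -> w <= 1 ->
  (forall j, (nth (false, false) row j).2 -> is_und (nth Out st j)) ->
  \sum_(j < size row) ((nth (false, false) row j).2 && d j) <= w ->
  exists w' st', [/\
    ((q, (b, w')), st') \in wfold f_decl (q, (b, w)) (zip row st),
    agrees st' d, refines st st', size st' = size st &
    (forall j, (nth (false, false) row j).2 -> ~~ is_und (nth Out st' j)) /\
    count is_und st' + count (fun x => x.2) row = count is_und st].
Proof.
elim: st row d w => [|z st IH] [|x row] d w //.
  move=> _ ha _ _ _; exists w, [::]; split=> //; first by rewrite inE.
    exact: refines_refl.
  by split=> // j; rewrite nth_nil.
move=> [hs] ha hw hu.
have -> : \sum_(j < size (x :: row)) ((nth (false, false) (x :: row) j).2 && d j) =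
    (x.2 && d 0) + \sum_(j < size row) ((nth (false, false) row j).2 && d j.+1).
  by rewrite big_ord_recl.
move=> hd.
have ha0 : agree z (d 0) := ha 0.
have ha1 : agrees st (fun j => d j.+1) by move=> j; exact: (ha j.+1).
have hu0 : x.2 -> is_und z := hu 0.
have hu1 j : (nth (false, false) row j).2 -> is_und (nth Out st j) := hu j.+1.
pose w1 := if x.2 && d 0 then 0 else w.
pose z' := if x.2 then if d 0 then In false else Out else z.
have hd1 : \sum_(j < size row) ((nth (false, false) row j).2 && d j.+1) <= w1.
  by move: hd; rewrite /w1; case: (x.2 && d 0); lia.
have hw1 : w1 <= 1 by rewrite /w1; case: ifP.
have [w' [st' [H1 H2 H3 H4 [H5 H6]]]] := IH row _ w1 hs ha1 hw1 hu1 hd1.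
exists w', (z' :: st'); split.
- apply: (@mem_wfold_cons _ _ _ f_decl _ (x, z) _ ((q, (b, w1)), z') (_, st')) => //.
  rewrite /f_decl /w1 /z' /=; case: (x.2) hu0 hd => [|_ _] /=; last by rewrite inE.
  move=> -> //; case: (d 0) => /= hd.
    by have -> : 0 < w by [lia]; rewrite inE eqxx.
  by case: ifP; rewrite !inE eqxx ?orbT.
- apply: agrees_cons => //; rewrite /z'; case: (x.2) => //; by case: (d 0).
- apply: refines_cons => //; rewrite /z'; case: (x.2) hu0 => [/(_ isT) hz|_]; last first.
    exact: refine_refl.
  by rewrite /refine hz; case: (d 0); rewrite orbT.
- by rewrite /= H4.
split.
  move=> [|j] /=; last exact: H5.
  by rewrite /z' => ->; case: (d 0).
rewrite /= -H6 /z'; case: (x.2) hu0 => [/(_ isT) ->|_] /=; last by lia.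
by case: (d 0); rewrite /=; lia.
Qed.

Variable k : nat.
Hypothesis k_gt0 : 0 < k.

Definition scnt (e : item) (d : nat -> bool) : nat :=
  \sum_(j < size e.2) (sbit e j && d j).

Definition blocked (st : seq cell) (e : item) : Prop :=
  exists j, sbit e j && ~~ is_und (nth Out st j).

Lemma blocked_refines st st' e : refines st st' -> blocked st e -> blocked st' e.
Proof.
move=> hr [j /andP[h1 h2]]; exists j; rewrite h1 /=.
by apply: contra h2; apply: refine_und.
Qed.

(* The greedy path: declare a block whenever the target set allows it. *)
Lemma path_foldM_1 q b w st E (d : nat -> bool) :
  {in E, forall e, size e.2 = size st} ->
  {in E, forall e, e.1 = 0 -> scount e = k} -> agrees st d ->
  exists q' w' st', [/\ ((q', (b, w')), st') \in foldM g_1 ((q, (b, w)), st) E,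
    agrees st' d, refines st st', size st' = size st &
    [/\ q' <= q, count is_und st' + k * (q - q') = count is_und st &
        q' = 0 \/ {in E, forall e, e.1 = 0 -> scnt e d <= 1 -> blocked st' e}]].
Proof.
elim: E q w st => [|e E IH] q w st hs hk ha.
  exists q, w, st; split=> //; first by rewrite inE.
    exact: refines_refl.
  by rewrite subnn muln0 addn0; split=> //; right.
have hs0 := hs e (mem_head _ _).
have hs1 : {in E, forall e, size e.2 = size st}.
  by move=> e' he'; rewrite hs // inE he' orbT.
have hk1 : {in E, forall e, e.1 = 0 -> scount e = k}.
  by move=> e' he'; apply: hk; rewrite inE he' orbT.
have skip : ((q, (b, w)), st) \in g_1 ((q, (b, w)), st) e ->
    (q = 0 \/ (e.1 = 0 -> scnt e d <= 1 -> blocked st e)) ->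
  exists q' w' st', [/\ ((q', (b, w')), st') \in foldM g_1 ((q, (b, w)), st) (e :: E),
    agrees st' d, refines st st', size st' = size st &
    [/\ q' <= q, count is_und st' + k * (q - q') = count is_und st &
        q' = 0 \/ {in e :: E, forall e, e.1 = 0 -> scnt e d <= 1 -> blocked st' e}]].
  move=> hin hb; have [q' [w' [st' [H1 H2 H3 H4 [H5 H6 H7]]]]] := IH q w st hs1 hk1 ha.
  exists q', w', st'; split=> //; first by rewrite foldM_cons; apply: (mem_bindM hin).
  split=> //; case: hb => [hq|hb]; first by left; lia.
  case: H7 => H7; [by left|right] => e'; rewrite inE => /orP[/eqP ->|/H7 //].
  by move=> h1 h2; apply: blocked_refines H3 _; exact: hb.
case: (posnP e.1) => he; last first.
  by apply: skip; [rewrite /g_1 he inE|right=> h; rewrite h in he].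
case: (posnP q) => hq; first by apply: skip; [rewrite /g_1 hq /= if_same inE|left].
have hg : g_1 ((q, (b, w)), st) e =
    ((q, (b, w)), st) :: wfold f_decl (q.-1, (b, 1)) (zip e.2 st).
  by rewrite /g_1 he hq.
case E1: (scnt e d <= 1); last first.
  by apply: skip; [rewrite hg mem_head|right=> _; rewrite E1].
(* Declaring a block that is not wholly undecided would make the path give up. It is passed over,
   being [blocked] already. *)
case E2: (all (fun x => x.1.2 ==> is_und x.2) (zip e.2 st)); last first.
  apply: skip; [by rewrite hg mem_head|right=> _ _].
  move/negbT: E2; rewrite -has_predC => /(has_nthP ((false, false), Out)) [j].
  rewrite size_zip hs0 minnn => hj; rewrite nth_zip //= negb_imply => h.
  by exists j.
have hu j : sbit e j -> is_und (nth Out st j).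
  move=> hj; have [hlt|hge] := ltnP j (size st); last first.
    by move: hj; rewrite nth_default // hs0.
  move/(all_nthP ((false, false), Out)): E2 => /(_ j); rewrite size_zip hs0 minnn.
  by move=> /(_ hlt); rewrite nth_zip //= hj.
have [w1 [st1 [H1 H2 H3 H4 [H5 H6]]]] :=
  path_decl q.-1 b hs0 ha (leqnn 1) hu E1.
have hs2 : {in E, forall e, size e.2 = size st1} by move=> e' /hs1 ->; rewrite H4.
have [q' [w' [st' [K1 K2 K3 K4 [K5 K6 K7]]]]] := IH q.-1 w1 st1 hs2 hk1 H2.
exists q', w', st'; split=> //.
- rewrite foldM_cons; apply: (@mem_bindM _ _ _ _ ((q.-1, (b, w1)), st1)) => //.
  by rewrite hg inE H1 orbT.
- exact: refines_trans K3.
- by rewrite K4.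
split; first by lia.
- rewrite -H6 -K6; have -> : count (fun x => x.2) e.2 = k.
    by rewrite -(hk e (mem_head _ _) he).
  by rewrite -addnA; congr addn; rewrite -mulnSr; congr muln; lia.
- case: K7 => K7; [by left|right] => e'; rewrite inE => /orP[/eqP ->|/K7 //] _ _.
  (* The block just declared is blocked as well: it has [k > 0] vertices, and all of them are
     decided now. *)
  have : 0 < scount e by rewrite hk // mem_head.
  rewrite /scount -has_count => /(has_nthP (false, false)) [j hj hsj].
  exists j; rewrite hsj /=; apply: contra (H5 j hsj); apply: refine_und; exact: K3.
Qed.

Variable D : nat.

(** * Charging arguments for a fixed target set *)

Section Target.
Variables (n : nat) (X T : seq bool) (E : seq item).
Hypothesis hE : good_items k D n X E.
Hypothesis hT : size T = n.
Hypothesis hX : size X = n.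
Hypothesis hv : valid E X T.

Let d j := nth false T j.
Let st := st_of n X E.

Lemma size_st_of : size st = n.
Proof. by rewrite /st /st_of size_mkseq. Qed.

Lemma target_lt j : d j -> j < n.
Proof. by rewrite /d ltnNge => h; apply/negP => hj; rewrite nth_default ?hT in h. Qed.

Lemma target_private j : d j ->
  nth false X j /\ exists2 e, e \in E & hbit e j && (hcount e T == 1).
Proof.
move=> hj; case/andP: hv => _ /allP /(_ j); rewrite mem_iota hT add0n (target_lt hj).
move=> /(_ isT); rewrite -/(d j) hj /= => /andP[-> /hasP[e h1 h2]].
by split=> //; exists e.
Qed.

Lemma nth_st_of j :
  nth Out st j = if nth false X j then Und (load E j) else Out.
Proof.
have [hj|hj] := ltnP j n; first by rewrite nth_mkseq.
by rewrite !nth_default ?size_st_of ?hX.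
Qed.

Lemma target_agrees : agrees st d.
Proof.
move=> j; rewrite nth_st_of; case: ifP => //= h; apply/negP => /target_private [].
by rewrite h.
Qed.

Lemma target_hit : {in E, forall e, exists j, hbit e j && d j}.
Proof.
move=> e he; case/andP: hv => /allP /(_ e he) + _; rewrite /hcount.
case: (pickP (fun j : 'I_(size T) => hbit e j && nth false T j)) => [j hj _|h0].
  by exists j.
by rewrite big1 // => j _; rewrite h0.
Qed.

Definition exceptional (e : item) : bool := (e.1 == 0) && (scnt e d <= 1).

(** Charge each exceptional block to one of its vertices decided between [st] and [st']. A vertex is
    charged at most [D] times, as it lies in at most [D] blocks. *)
Lemma exceptional_le st' :
  refines st st' -> {in E, forall e, exceptional e -> blocked st' e} ->
  size st' = n ->
  \sum_(e <- E) exceptional e + D * count is_und st' <= D * count is_und st.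
Proof.
move=> hr hb hs'; case: hE => G1 G2 _ _ G5.
pose U j := is_und (nth Out st j) && ~~ is_und (nth Out st' j).
have h1 : \sum_(e <- E) exceptional e <= \sum_(e <- E) \sum_(j < n) (sbit e j && U j).
  rewrite big_seq [leqRHS]big_seq; apply: leq_sum => e he.
  case ee: (exceptional e) => //; have [j /andP[hj hj']] := hb e he ee.
  have /andP[_ hXj] := G2 _ _ he hj.
  have hjn : j < n.
    by rewrite ltnNge; apply/negP => hn; move: hXj; rewrite nth_default ?hX.
  rewrite (bigD1 (Ordinal hjn)) //= hj /U nth_st_of hXj hj' /=; lia.
have h2 : \sum_(e <- E) \sum_(j < n) (sbit e j && U j) <= \sum_(j < n) D * U j.
  rewrite exchange_big /=; apply: leq_sum => j _.
  case: (U j); last by rewrite big1 // => e _; rewrite andbF.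
  rewrite muln1; apply: leq_trans (G5 j); rewrite /load count_sum.
  by apply: leq_sum => e _; rewrite andbT.
apply: leq_trans (leq_add (leq_trans h1 h2) (leqnn _)) _.
rewrite -big_distrr /= -mulnDr leq_mul2l; apply/orP; right.
rewrite (count_nth Out is_und hs') (count_nth Out is_und size_st_of) -big_split /=.
apply: leq_sum => j _; have := @refine_und _ _ (hr j); rewrite /U.
by case: (is_und (nth Out st' j)) => [->|_] //=; case: (is_und _).
Qed.

(** Charge an undecided target vertex to a private hyperedge, whose only target vertex it is. That
    hyperedge is long, for a short one is hit by a chosen vertex, which would be a second target
    vertex in it. Its block lies inside it and so contains at most one target vertex. *)
Lemma undecided_target_le st2 :
  agrees st2 d -> {in E, forall e, 0 < e.1 -> hit_by st2 e} ->
  \sum_(j < n) (is_und (nth Out st2 j) && d j) <= \sum_(e <- E) exceptional e.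
Proof.
move=> ha hh; case: hE => G1 G2 _ _ _.
apply: (@leq_trans (\sum_(j < n) \sum_(e <- E)
   [&& exceptional e, hcount e T == 1 & hbit e j && d j])).
  apply: leq_sum => j _; case Ej: (is_und (nth Out st2 j) && d j) => //.
  case/andP: Ej => hu hd; have [_ [e he /andP[h1 h2]]] := target_private hd.
  rewrite (big_rem e) //=; suff -> : exceptional e by rewrite h1 h2 hd.
  apply/andP; split.
    rewrite -leqn0 leqNgt; apply/negP => /(hh e he) [j' /andP[hj1 hj2]].
    have hd' : d j' by have := ha j'; case: (nth Out st2 j') hj2.
    have hj' : j' < n := target_lt hd'.
    (* One of the two vertices is chosen and the other undecided, so [hcount] would be at least
       2. *)
    have nej : Ordinal hj' != j.
      apply/eqP => ejj; have ej : j' = j by rewrite -ejj.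
      by move: hu hj2; rewrite ej; case: (nth Out st2 j).
    move: h2; rewrite /hcount hT (bigD1 j) //= (bigD1 (Ordinal hj')) //=.
    by rewrite h1 hj1 -/(d j) -/(d j') hd hd'.
  rewrite -(eqP h2) /scnt /hcount hT G1 //; apply: leq_sum => j' _.
  case hs: (sbit e j') => //=; have /andP[-> _] := G2 _ _ he hs; exact: leqnn.
rewrite exchange_big /=; apply: leq_sum => e _.
case: (exceptional e); last by rewrite big1.
case h: (hcount e T == 1); last by rewrite big1.
by move/eqP: h; rewrite /= /hcount hT => ->.
Qed.

(** The greedy path decides the case. If it runs out of blocks to declare, the first strategy
    reaches the target. Otherwise all exceptional blocks are blocked by the at most [k * q] vertices
    of declared ones, and [b] covers what the second strategy has left to choose. *)
Lemma path_main q b w :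
  k * D * q < b -> exists c,
  (c, decided d n) \in m_type1 n E ((q, (b, w)), st) ++
                       m_type2 D n E ((q, (b, w)), st).
Proof.
move=> hb; have b0 : 0 < b by lia.
have hs : {in E, forall e, size e.2 = size st}.
  by case: hE => G1 _ _ _ _ e /G1 ->; rewrite size_st_of.
have hk : {in E, forall e, e.1 = 0 -> scount e = k}.
  by case: hE => _ _ G3 _ _ e /G3 <- ->; rewrite addn0.
have [q' [w' [st' [H1 H2 H3 H4 [H5 H6 H7]]]]] :=
  path_foldM_1 q b w hs hk target_agrees.
rewrite size_st_of in H4.
case: (posnP q') => hq'.
  have [c hc] := @path_C false q' b w' st' d H2 b0.
  exists c; rewrite mem_cat; apply/orP; left.
  apply: (mem_bindM H1) => /=; rewrite hq' /=.
  by move: hc; rewrite H4 hq'.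
case: H7 => H7; first by rewrite H7 in hq'.
have hexc : \sum_(e <- E) exceptional e <= k * D * q.
  have h : {in E, forall e, exceptional e -> blocked st' e}.
    by move=> e he /andP[/eqP h1 h2]; exact: H7.
  have := exceptional_le H3 h H4; rewrite -H6.
  have : D * (k * (q - q')) <= k * D * q.
    by rewrite mulnA [D * k]mulnC leq_mul2l leq_subr orbT.
  rewrite mulnDr; lia.
have [st1 [A1 A2 A3]] := path_A D (q, (b, w)) target_agrees.
have hs1 : {in E, forall e, size e.2 = size st1} by move=> e /hs ->; rewrite A3.
have [w2 [st2 [B1 B2 B3 B4 B5]]] := path_foldM_2 q w b0 hs1 A2 target_hit.
have hs2 : size st2 = n by rewrite B4 A3 size_st_of.
have hle : \sum_(j < size st2) (is_und (nth Out st2 j) && d j) <= b.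
  rewrite hs2; apply: leq_trans (undecided_target_le B2 B5) _.
  by apply: leq_trans hexc _; apply: ltnW.
have [c hc] := @path_C true q b w2 st2 d B2 hle.
exists c; rewrite mem_cat; apply/orP; right.
rewrite size_st_of in A1; apply: (mem_bindM A1); apply: (mem_bindM B1).
by move: hc; rewrite hs2.
Qed.

End Target.

End Paths.


(** * Counting leaves *)

Section Counting.
Import Order.TTheory GRing.Theory Num.Theory.
Local Open Scope ring_scope.
Variable R : realFieldType.

Lemma sum_bindM (A B : Type) (l : seq A) (f : A -> seq B) (F : B -> R) :
  \sum_(y <- bindM l f) F y = \sum_(x <- l) \sum_(y <- f x) F y.
Proof. by rewrite /bindM big_flatten /= big_map. Qed.

Lemma size_bindM (A B : Type) (l : seq A) (f : A -> seq B) :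
  (size (bindM l f))%:R = \sum_(x <- l) (size (f x))%:R :> R.
Proof.
by rewrite /bindM; elim: l => [|x l IH]; rewrite ?big_nil // big_cons /=
  size_cat natrD IH.
Qed.

Lemma bindM_assoc (A B C : Type) (l : seq A) (f : A -> seq B) (g : B -> seq C) :
  bindM (bindM l f) g = bindM l (fun x => bindM (f x) g).
Proof. by rewrite /bindM; elim: l => //= x l <-; rewrite map_cat flatten_cat. Qed.

Lemma ler_sum_all (A : Type) (P : pred A) (l : seq A) (F G : A -> R) :
  all P l -> (forall x, P x -> F x <= G x) ->
  \sum_(x <- l) F x <= \sum_(x <- l) G x.
Proof.
move=> hl h; elim: l hl => [|x l IH] /=; first by rewrite !big_nil.
by case/andP=> hx hl; rewrite !big_cons lerD // ?h // IH.
Qed.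

Lemma ler_sum_const (A : Type) (P : pred A) (l : seq A) (F : A -> R) (c : R) :
  all P l -> (forall x, P x -> F x <= c) ->
  \sum_(x <- l) F x <= (size l)%:R * c.
Proof.
move=> hl h; apply: (le_trans (ler_sum_all (G := fun=> c) hl h)).
elim: l {hl} => [|x l IH]; first by rewrite big_nil mul0r.
by rewrite big_cons /= mulrSr mulrDl mul1r addrC lerD.
Qed.

Lemma all_wfold_ctl (T A B : Type) (P : pred T) (f : T -> A -> seq (T * B)) c l :
  (forall c x, P c -> all (fun y => P y.1) (f c x)) -> P c ->
  all (fun r => P r.1) (wfold f c l).
Proof.
move=> h; elim: l c => [|x l IH] c hc; first by rewrite /= hc.
rewrite wfold_cons; apply: (all_bindM (h c x hc)) => y hy.
by rewrite all_map; apply: IH.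
Qed.

Definition undl (X : Type) (l : seq (X * cell)) : nat :=
  count (fun x => is_und x.2) l.

Lemma undl_zip (X : Type) (rs : seq X) st :
  size rs = size st -> undl (zip rs st) = count is_und st.
Proof.
by move=> h; rewrite /undl -[in RHS](@unzip2_zip _ _ rs st) ?h // count_map.
Qed.

(** * Weights for branching on short hyperedges *)

Section ShortEdges.
Variables (beta lam : R) (a : nat -> R) (k : nat).
Hypothesis beta_ge1 : 1 <= beta.
Hypothesis lam_ge1 : 1 <= lam.
Hypothesis lam_beta : 1 + lam <= lam * beta.
Hypothesis a0 : 0 <= a 0.
Hypothesis aS : forall j, beta * a j.+1 = 1 + a j.
Hypothesis a_le1 : forall j, (j < k)%N -> a j <= 1.

(** Choosing a vertex lowers both exponents by one, excluding it only that of [beta]; [lam_beta]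
    says exactly that the two weights fit into the old one. *)
Lemma size_C_dec q b w l :
  (size (wfold (f_C true) (q, (b, w)) l))%:R <= lam ^+ b * beta ^+ undl l.
Proof.
have b0 : 0 <= beta by apply: le_trans beta_ge1.
have l0 : 0 <= lam by apply: le_trans lam_ge1.
elim: l b => [|[[] z] l IH] b; first by rewrite /undl /= mulr1 exprn_ege1.
rewrite wfold_cons size_bindM; case: z => [|y|y]; rewrite [f_C _ _ _]/=.
- by rewrite big_seq1 size_map; apply: IH.
- case: b => [|b] /=; rewrite /undl /= add1n -/(undl l).
    rewrite big_seq1 size_map; apply: (le_trans (IH _)).
    by rewrite !mul1r exprS ler_peMl // exprn_ge0.
  rewrite big_cons big_seq1 !size_map subn1 /=.
  apply: (le_trans (lerD (IH b) (IH b.+1))).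
  rewrite -mulrDl (exprS lam b) (exprS beta (undl l)) mulrA.
  rewrite ler_wpM2r ?exprn_ge0 //.
  by rewrite -{1}[lam ^+ b]mul1r -mulrDl mulrAC ler_wpM2r ?exprn_ge0.
- by rewrite big_seq1 size_map; apply: IH.
Qed.

Lemma size_C_free q b w l :
  (size (wfold (f_C false) (q, (b, w)) l))%:R <=
  (if b == 0%N then 1 else 2 ^+ undl l) :> R.
Proof.
elim: l => [|[[] z] l IH]; first by rewrite /undl /=; case: ifP.
rewrite wfold_cons size_bindM.
case: z => [|y|y]; rewrite [f_C _ _ _]/= /undl /= -/(undl l);
  try by rewrite big_seq1 size_map add0n.
case: b IH => [|b] IH /=; first by rewrite big_seq1 size_map.
rewrite big_cons big_seq1 !size_map subn0 add1n exprS mulrDl mul1r.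
exact: lerD.
Qed.

Lemma wfold_B_skip q b w l :
  (0 < w)%N || (b == 0)%N -> wfold f_B (q, (b, w)) l = [:: ((q, (b, w)), unzip2 l)].
Proof.
move=> h; rewrite (@wfold_fixed _ _ _ f_B (fun x => x.2)) //.
by move=> x; rewrite /f_B; case: ifP => // /and4P[_ _ /eqP]; lia.
Qed.

Definition hund (l : seq ((bool * bool) * cell)) : nat :=
  count (fun x => x.1.1 && is_und x.2) l.

(** By [aS], [a j] behaves like beta^-1 + ... + beta^-j: if the i-th of the [j] undecided vertices
    is the first chosen one, [i] vertices get decided. The final 1 is the branch that excludes all
    of them, which [kill] turns into a single leaf. *)
Lemma sum_B q b l (G : R) : (0 < b)%N -> 0 <= G ->
  \sum_(r <- wfold f_B (q, (b, 0)) l)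
    (if r.1.2.2 == 0%N then 1 else G * beta ^+ count is_und r.2) <=
  G * beta ^+ undl l * a (hund l) + 1.
Proof.
have b0 : 0 <= beta by apply: le_trans beta_ge1.
move=> hb; elim: l G => [|[x z] l IH] G G0.
  by rewrite big_seq1 /undl /= mulr1 ler_wpDl // mulr_ge0.
rewrite wfold_cons sum_bindM [f_B _ _]/=.
case E: (x.1 && is_und z); last first.
  have -> : [&& x.1, is_und z & (0 < b)%N] = false by rewrite andbA E.
  rewrite big_seq1 big_map /= /hund /= E add0n -/(hund l) /undl /= -/(undl l).
  have G0' : 0 <= G * beta ^+ is_und z by rewrite mulr_ge0 // exprn_ge0.
  rewrite exprD mulrA; apply: le_trans (IH _ G0').
  rewrite le_eqVlt; apply/orP; left; apply/eqP; apply: eq_bigr => r _.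
  by case: ifP => // _; rewrite exprD mulrA.
case/andP: E => hx hz; rewrite hx hz hb /= big_cons big_seq1 !big_map /=.
rewrite wfold_B_skip // big_seq1 /= /hund /undl /= hx hz !add1n -/(hund l) -/(undl l).
have -> : count is_und (unzip2 l) = undl l by rewrite count_map.
rewrite add0n exprS -mulrA [beta * _]mulrC -!mulrA aS mulrDr mulr1 mulrDr -addrA.
rewrite lerD2l; apply: le_trans (IH _ G0) _; by rewrite mulrA.
Qed.

Lemma all2_refine_hund (row : seq (bool * bool)) st st' :
  all2 refine st st' -> (hund (zip row st') <= hund (zip row st))%N.
Proof.
elim: row st st' => [|x row IH] [|z st] [|z' st'] //= /andP[hz hs].
rewrite /hund /= leq_add //; last exact: IH.
case: (x.1) => //=; case h: (is_und z') => //.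
by rewrite (refine_und hz h).
Qed.

Lemma all2_wfold_zip (X : Type) (P : cell -> cell -> bool)
    (f : ctl -> X * cell -> seq (ctl * cell)) c rs st :
  (forall c x, all (fun y => P x.2 y.2) (f c x)) -> size rs = size st ->
  all (fun r => all2 P st r.2) (wfold f c (zip rs st)).
Proof.
move=> hf hs; apply: sub_all (all_wfold (P := fun x y => P x.2 y) c _ hf) => r.
rewrite !all2E size_zip hs minnn => /andP[-> /=].
elim: st rs (r.2) hs => [|z st IH] [|x rs] [|y l] //= [hs] /andP[-> h] /=.
exact: IH h.
Qed.

Lemma refine_B c x : all (fun y => refine x.2 y.2) (f_B c x).
Proof.
case: c => q [b w]; rewrite /f_B; case: ifP => [/and4P[_ h _ _]|_] /=.
  by rewrite /refine h !orbT.
by rewrite refine_refl.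
Qed.

Lemma refine_all2_refl st : all2 refine st st.
Proof. by elim: st => //= z st ->; rewrite refine_refl. Qed.

Lemma refine_g_2 c st e : size e.2 = size st ->
  all (fun r => all2 refine st r.2) (g_2 (c, st) e).
Proof.
case: c => q [b w] hs; rewrite /g_2; case: ifP => _; last first.
  by rewrite /= refine_all2_refl.
rewrite wfold_hit bindM1 /= unzip2_zip ?hs // all_map.
exact: (all2_wfold_zip _ refine_B).
Qed.

(** The factor [m.+1] pays for given-up paths: a hyperedge adds at most one of them, of weight 1, to
    a live state, and the product of powers is at least 1 there. *)
Definition pot2 (m : nat) (r : ctl * seq cell) : R :=
  if r.1.2.1 == 0%N then 1
  else (m.+1)%:R * (lam ^+ r.1.2.1 * beta ^+ count is_und r.2).

Definition short_ok (E : seq item) (st : seq cell) : bool :=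
  all (fun e : item => (0 < e.1)%N ==> (hund (zip e.2 st) < k)%N) E.

Lemma pot2_step m c st e : size e.2 = size st ->
  ((0 < e.1)%N -> (hund (zip e.2 st) < k)%N) ->
  \sum_(r <- g_2 (c, st) e) pot2 m r <= pot2 m.+1 (c, st).
Proof.
have b0 : 0 <= beta by apply: le_trans beta_ge1.
have l0 : 0 <= lam by apply: le_trans lam_ge1.
case: c => q [b w] hs hk.
have mono c' : c'.2.1 = b -> pot2 m (c', st) <= pot2 m.+1 ((q, (b, w)), st).
  rewrite /pot2 /= => ->; case: ifP => // _.
  by rewrite ler_wpM2r ?mulr_ge0 ?exprn_ge0 // ler_nat.
rewrite /g_2; case: ifP => he; last by rewrite big_seq1; apply: mono.
rewrite wfold_hit bindM1 /= unzip2_zip ?hs // big_map add0n.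
case: (boolP ((0 < hits (zip e.2 st))%N || (b == 0)%N)) => h.
  rewrite wfold_B_skip // big_seq1 unzip2_zip ?hs //; apply: mono.
  rewrite /kill; case: ifP => // /eqP h0; move: h; rewrite h0 /=.
  by move/eqP.
move: h; rewrite negb_or -leqNgt leqn0 => /andP[/eqP -> hb].
pose G : R := (m.+1)%:R * lam ^+ b.
have G0 : 0 <= G by rewrite mulr_ge0 // exprn_ge0.
have hb0 : (0 < b)%N by rewrite lt0n.
have hctl : all (fun r => r.1.2.1 == b) (wfold f_B (q, (b, 0)) (zip e.2 st)).
  apply: (all_wfold_ctl (P := fun c : ctl => c.2.1 == b)) => //=.
  by move=> [q' [b' w']] x /= h; case: ifP => _ /=; rewrite h.
apply: (@le_trans _ _ (\sum_(r <- wfold f_B (q, (b, 0)) (zip e.2 st))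
    (if r.1.2.2 == 0%N then 1 else G * beta ^+ count is_und r.2))).
  apply: (ler_sum_all hctl) => -[[q' [b' w']] st'] /= /eqP ->.
  rewrite /pot2 /kill; case: (w' == 0%N) => //=.
  by rewrite (negbTE hb) /G mulrA.
apply: (le_trans (sum_B q (zip e.2 st) hb0 G0)).
rewrite /pot2 /= (negbTE hb) undl_zip //.
have h1 : 1 <= lam ^+ b * beta ^+ count is_und st.
  by rewrite mulr_ege1 // exprn_ege1.
apply: (@le_trans _ _ (G * beta ^+ count is_und st + 1)).
  rewrite lerD2r ler_piMr ?mulr_ge0 ?exprn_ge0 //; exact: a_le1 (hk he).
by rewrite -[m.+2%:R]natr1 mulrDl mul1r /G mulrA lerD2l.
Qed.

Lemma leaf_2 n E c st :
  size st = n -> all (sized_item n) E -> short_ok E st ->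
  \sum_(r <- foldM g_2 (c, st) E)
    (size (wfold (f_C true) r.1 (zip (ticks n) r.2)))%:R <=
  pot2 (size E) (c, st).
Proof.
have b0 : 0 <= beta by apply: le_trans beta_ge1.
have l0 : 0 <= lam by apply: le_trans lam_ge1.
elim: E c st => [|e E IH] [q [b w]] st hs hE hsh.
  rewrite big_seq1 /pot2 /= mul1r; case: ifP => [/eqP ->|_].
    have -> : wfold (f_C true) (q, (0%N, w)) (zip (ticks n) st) =
       [:: ((q, (0%N, w)), map (fun x => if is_in x.2 then In false else Out)
              (zip (ticks n) st))].
      by apply: wfold_fixed => -[[] []].
    by [].
  by apply: (le_trans (size_C_dec _ _ _ _)); rewrite undl_zip // size_nseq.
rewrite foldM_cons sum_bindM; case/andP: hE => /eqP he hE.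
case/andP: hsh => /implyP hk hsh.
have hse : size e.2 = size st by rewrite he hs.
apply: le_trans (pot2_step (size E) (q, (b, w)) hse hk).
have hr := refine_g_2 (q, (b, w)) hse.
apply: (ler_sum_all hr) => -[c' st'] /= hr'; apply: IH => //.
  by move: hr'; rewrite all2E hs => /andP[/eqP].
apply: sub_all hsh => e' /implyP h; apply/implyP => /h.
by apply: leq_ltn_trans; apply: all2_refine_hund.
Qed.

Definition saturated (D : nat) (z : cell) : bool :=
  if z is Und l then (D <= l)%N else false.
Definition unsaturated (D : nat) (z : cell) : bool :=
  if z is Und l then (l < D)%N else false.

Definition after_A (D : nat) (z z' : cell) : bool :=
  if saturated D z then ~~ is_und z' else z' == z.

Lemma is_und_after_A D z z' : after_A D z z' -> is_und z' = unsaturated D z.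
Proof.
rewrite /after_A; case: z => [|y|y] /=; try by move/eqP=> ->.
by rewrite ltnNge; case: (D <= y)%N => [/negPf -> //|/eqP ->].
Qed.

Lemma after_A_f D c x : all (fun y => after_A D x.2 y.2) (f_A D c x).
Proof.
rewrite /f_A /after_A; case: (x.2) => [|y|y] /=; rewrite ?eqxx //.
by case: ifP => //=; rewrite eqxx.
Qed.

Lemma size_A D c st n : size st = n ->
  size (wfold (f_A D) c (zip (ticks n) st)) = (2 ^ count (saturated D) st)%N.
Proof.
elim: st n => [|z st IH] [|n] // [hs].
rewrite [zip _ _]/= wfold_cons /bindM.
case: z => [|y|y]; rewrite [f_A _ _ _]/=; try by rewrite /= cats0 size_map IH.
have -> : f_A D c (tt, Und y) = if (D <= y)%N then [:: (c, In false); (c, Out)]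
   else [:: (c, Und y)] by [].
rewrite [count _ _]/=; case: (D <= y)%N; last by rewrite /= cats0 size_map IH.
by rewrite /= cats0 size_cat !size_map IH // addnn -mul2n -expnS.
Qed.

(** Once the saturated vertices are guessed, exactly the unsaturated ones are undecided. The bound
    on [free_count] then gives each short hyperedge fewer than [k] undecided vertices. *)
Lemma leaf_type2 n D X E q b w :
  good_items k D n X E -> (0 < b)%N -> size E = n ->
  (size (m_type2 D n E ((q, (b, w)), st_of n X E)))%:R <=
  2 ^+ count (saturated D) (st_of n X E) *
    (n.+1%:R * (lam ^+ b * beta ^+ count (unsaturated D) (st_of n X E))).
Proof.
move=> hE hb hn; set st := st_of n X E; case: (hE) => G1 G2 G3 G4 G5.
have hst : size st = n by rewrite size_mkseq.
rewrite /m_type2 size_bindM /=.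
under eq_bigr => r _ do rewrite size_bindM.
have hA := @all2_wfold_zip _ (after_A D) (f_A D) (q, (b, w)) (ticks n) st
  (@after_A_f D).
have {}hA := hA (etrans (size_nseq _ _) (esym hst)).
have hC : all (fun r => r.1 == (q, (b, w)))
    (wfold (f_A D) (q, (b, w)) (zip (ticks n) st)).
  apply: (all_wfold_ctl (P := fun c => c == (q, (b, w)))) => // c x /eqP ->.
  by rewrite /f_A; case: (x.2) => [|y|y] /=; rewrite ?eqxx //; case: ifP => /=;
    rewrite ?eqxx.
rewrite -natrX -(size_A D (q, (b, w)) hst).
apply: (ler_sum_const (P := fun r => (r.1 == (q, (b, w))) && all2 (after_A D) st r.2)).
  by rewrite all_predI hC.
move=> [c st'] /= /andP[/eqP -> h].
have hu : count is_und st' = count (unsaturated D) st.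
  elim: (st) (st') h => [|z l IH] [|z' l'] //= /andP[hz hl].
  by rewrite (is_und_after_A hz) (IH l').
have hst' : size st' = n by move: h; rewrite all2E hst => /andP[/eqP].
have hsz : all (sized_item n) E by apply/allP => e /G1 /eqP.
have hsh : short_ok E st'.
  apply/allP => e he; apply/implyP => he0; apply: leq_ltn_trans (G4 e he he0).
  rewrite /hund (count_zip_nth (false, false) Out _ (G1 e he) hst').
  apply: leq_sum => j _ /=; case: (hbit e j) => //=.
  have hj : (j < size st)%N by rewrite hst.
  rewrite (is_und_after_A (all2_nth Out Out h hj)) nth_mkseq //.
  by case: ifP => //=; case: (load E j < D)%N.
apply: (le_trans (leaf_2 (q, (b, w)) hst' hsz hsh)).
by rewrite /pot2 /= gtn_eqF // hn hu.
Qed.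

End ShortEdges.

(** * Weights for declaring blocks *)

Section LongEdges.
Variables (k : nat) (alpha : R).
Hypothesis alphaE : alpha * 2 ^+ k = k.+1%:R.
Hypothesis k_gt0 : (0 < k)%N.

(** A declaration removes [k] undecided vertices and one unit of [q] and has at most [k.+1]
    outcomes, so its share is [2 * alpha] of the old weight; not declaring has share 1. Hence the
    factor [1 + 2 * alpha] for each of the [m] remaining hyperedges. *)
Definition pot1 (m : nat) (r : ctl * seq cell) : R :=
  if r.1.2.1 == 0%N then 1
  else 2 ^+ count is_und r.2 / 2 ^+ r.1.1 * (1 + 2 * alpha) ^+ m.

(** Enough undecided vertices remain for all blocks still due, so a live state has weight at least 1
    and can pay for a path that ends in a single leaf. *)
Definition inv1 (r : ctl * seq cell) : bool :=
  if r.1.2.1 == 0%N then r.1.1 == 0%N else (k * r.1.1 <= count is_und r.2)%N.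

Definition scells (l : seq ((bool * bool) * cell)) : nat :=
  count (fun x => x.1.2) l.

(** Either no vertex of the block is chosen, or one is and all later ones are excluded. *)
Lemma size_decl q b w l :
  (size (wfold f_decl (q, (b, w)) l) <= 1 + (0 < w) * scells l)%N.
Proof.
elim: l q b w => [|x l IH] q b w; first by rewrite /=; lia.
rewrite wfold_cons /bindM /f_decl -/f_decl /scells /= -/(scells l).
case: (x.1.2) => /=; last by rewrite cats0 size_map.
case: (is_und x.2) => /=; last first.
  by rewrite cats0 size_map; apply: leq_trans (IH _ _ _) _; rewrite mul0n.
case: ifP => hw /=; rewrite ?cats0 ?size_cat !size_map.
  have := IH q b 0%N; rewrite ltnn mul0n addn0 => h0.
  have := IH q b w; rewrite hw !mul1n => h1.
  by apply: leq_add h0 h1.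
by apply: leq_trans (IH _ _ _) _; rewrite hw !mul0n.
Qed.

Lemma all_decl q b w l :
  all (fun r => (r.1.1 == 0%N) && (r.1.2.1 == 0%N) ||
       [&& r.1.1 == q, r.1.2.1 == b & (count is_und r.2 + scells l == undl l)%N])
    (wfold f_decl (q, (b, w)) l).
Proof.
elim: l q b w => [|x l IH] q b w; first by rewrite /= !eqxx orbT.
have step c z' : (c.1 == 0%N) && (c.2.1 == 0%N) ||
    [&& c.1 == q, c.2.1 == b & (is_und z' + x.1.2 == is_und x.2)%N] ->
  all (fun r => (r.1.1 == 0%N) && (r.1.2.1 == 0%N) ||
       [&& r.1.1 == q, r.1.2.1 == b &
           (count is_und r.2 + scells (x :: l) == undl (x :: l))%N])
    [seq (r.1, z' :: r.2) | r <- wfold f_decl c l].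
  case: c => q' [b' w'] /= h; rewrite all_map; apply: sub_all (IH q' b' w') => r /=.
  case/orP=> [->//|/and3P[/eqP -> /eqP -> /eqP hr]].
  case/orP: h => [->//|/and3P[-> -> /eqP h]] /=; apply/orP; right.
  by rewrite addnACA h hr.
rewrite wfold_cons; apply: (all_bindM (P := fun y =>
    (y.1.1 == 0%N) && (y.1.2.1 == 0%N) ||
    [&& y.1.1 == q, y.1.2.1 == b & (is_und y.2 + x.1.2 == is_und x.2)%N])).
  rewrite /f_decl; case: (x.1.2) => /=; last by rewrite !eqxx addn0 eqxx orbT.
  case: (is_und x.2) => //=; case: ifP => _ /=; by rewrite !eqxx ?orbT.
by move=> [c z'] h; apply: step.
Qed.

Lemma alpha_ge0 : 0 <= alpha.
Proof.
have h : 0 < 2 ^+ k :> R by rewrite exprn_gt0.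
by rewrite -(pmulr_lge0 _ h) alphaE.
Qed.

Lemma pot1_step m c st e : size e.2 = size st -> (e.1 = 0%N -> scount e = k) ->
  inv1 (c, st) ->
  \sum_(r <- g_1 (c, st) e) pot1 m r <= pot1 m.+1 (c, st) /\
  all inv1 (g_1 (c, st) e).
Proof.
case: c => q [b w] hs hk hi.
have ha := alpha_ge0.
have hA : 1 <= 1 + 2 * alpha by rewrite lerDl mulr_ge0.
have mono : pot1 m ((q, (b, w)), st) <= pot1 m.+1 ((q, (b, w)), st).
  rewrite /pot1 /=; case: ifP => // _; rewrite ler_wpM2l ?divr_ge0 ?exprn_ge0 //.
  by rewrite ler_weXn2l.
rewrite /g_1; case: (posnP e.1) => he; last first.
  by rewrite big_seq1 /= hi.
case: (posnP q) => hq; first by rewrite big_seq1 /= hi.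
rewrite big_cons.
have hb : b != 0%N.
  by apply: contraTneq hi => hb; rewrite /inv1 /= hb eqxx -lt0n.
move: hi; rewrite /inv1 /= (negbTE hb) => hi.
set l := zip e.2 st.
have hsc : scells l = k.
  rewrite -(hk he) /scount /scells -[in RHS](@unzip1_zip _ _ e.2 st) ?hs //.
  by rewrite count_map.
have hu : undl l = count is_und st by rewrite /l undl_zip.
have hall := all_decl q.-1 b 1 l; rewrite hsc hu in hall.
have hku : (k <= count is_und st)%N.
  by apply: leq_trans hi; rewrite leq_pmulr.
pose T : R := 2 ^+ (count is_und st - k) / 2 ^+ q.-1 * (1 + 2 * alpha) ^+ m.
(* [T] is the weight after a successful declaration; being at least 1, it also covers the outcomes
   that gave up. *)
have hT : 1 <= T.
  rewrite /T mulr_ege1 ?exprn_ege1 //.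
  rewrite ler_pdivlMr ?exprn_gt0 // mul1r ler_weXn2l ?ler1n //.
  have : (q.-1 <= k * q.-1)%N by rewrite leq_pmull.
  have : (k * q = k * q.-1 + k)%N by rewrite -mulnSr prednK.
  lia.
have hle : \sum_(r <- wfold f_decl (q.-1, (b, 1%N)) l) pot1 m r <= k.+1%:R * T.
  apply: (@le_trans _ _ ((size (wfold f_decl (q.-1, (b, 1%N)) l))%:R * T)).
    apply: (ler_sum_const hall) => -[[q' [b' w']] st'] /=.
    case/orP=> [/andP[/eqP -> /eqP ->]|/and3P[/eqP -> /eqP -> /eqP h]].
      by rewrite /pot1 /=.
    by rewrite /pot1 /T /= (negbTE hb) -h addnK.
  rewrite ler_wpM2r ?(le_trans _ hT) // ler_nat.
  by apply: leq_trans (size_decl _ _ _ _) _; rewrite hsc mul1n add1n.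
split; last first.
  rewrite hi /=; apply: sub_all hall => -[[q' [b' w']] st'] /=.
  case/orP=> [/andP[/eqP -> /eqP ->] //|].
  case/and3P=> /eqP -> /eqP -> /eqP h; rewrite (negbTE hb).
  have : (k * q = k * q.-1 + k)%N by rewrite -mulnSr prednK.
  by move: hi; lia.
rewrite /pot1 /= (negbTE hb) exprSr [leRHS]mulrA mulrDr mulr1 lerD2l.
apply: (le_trans hle); rewrite -alphaE /T le_eqVlt; apply/orP; left; apply/eqP.
have hk2 : 2 ^+ count is_und st = 2 ^+ (count is_und st - k) * 2 ^+ k :> R.
  by rewrite -exprD subnK.
have hq2 : 2 ^+ q = 2 * 2 ^+ q.-1 :> R by rewrite -exprS prednK.
rewrite hk2 hq2; field.
by rewrite expf_neq0 ?pnatr_eq0.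
Qed.

Lemma leaf_1 n E c st :
  size st = n -> all (sized_item n) E ->
  {in E, forall e, e.1 = 0%N -> scount e = k} -> inv1 (c, st) ->
  (size (bindM (foldM g_1 (c, st) E) (fun r =>
    let: (q, (b, w)) := r.1 in
    wfold (f_C false) (if (0 < q)%N then (q, (0%N, w)) else r.1)
      (zip (ticks n) r.2))))%:R <= pot1 (size E) (c, st).
Proof.
elim: E c st => [|e E IH] [q [b w]] st hs hE hk hi.
  rewrite bindM1 /=; case: (posnP q) => hq.
    apply: le_trans (size_C_free _ _ _ _) _.
    by rewrite /pot1 /= hq expr0 divr1 mulr1 undl_zip // size_nseq hs.
  apply: le_trans (size_C_free _ _ _ _) _; rewrite eqxx.
  move: hi; rewrite /inv1 /pot1 /=; case: ifP => // _ hi; rewrite mulr1.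
  rewrite ler_pdivlMr ?exprn_gt0 // mul1r ler_weXn2l ?ler1n //.
  by apply: leq_trans hi; rewrite leq_pmull.
case/andP: hE => /eqP he hE.
have hse : size e.2 = size st by rewrite he hs.
have hk1 : {in E, forall e, e.1 = 0%N -> scount e = k}.
  by move=> e' he'; apply: hk; rewrite inE he' orbT.
have [h1 h2] := pot1_step (size E) hse (hk e (mem_head _ _)) hi.
apply: le_trans h1; rewrite foldM_cons bindM_assoc size_bindM.
have hsz : all (sized n) (g_1 ((q, (b, w)), st) e).
  by case: (@spec_1 n ((q, (b, w)), st) e); rewrite /sized ?/sized_item ?he ?hs.
apply: (ler_sum_all (P := fun r => inv1 r && sized n r)).
  by rewrite all_predI h2.
by move=> [c' st'] /andP[hi' /eqP hs']; apply: IH.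
Qed.

End LongEdges.
End Counting.

(** * Assembly *)

Section Main.
Variables (k D : nat).
Hypothesis k_gt0 : 0 < k.
Hypothesis D_gt0 : 0 < D.
Let s := k * D.
Let t := 4 * s.

Lemma m_main_prep n M X :
  size M = n -> all (fun r => size r == n) M -> size X = n ->
  exists q w E,
  [/\ m_main k D s t n M X =
        bindM (m_type1 n E ((q, ((s * q).+1, w)), st_of n X E) ++
               m_type2 D n E ((q, ((s * q).+1, w)), st_of n X E))
              (m_check n E X),
      good_items k D n X E, size E = n,
      rev [seq unzip1 e.2 | e <- E] =
        mkseq (fun i => closed_row n i (nth [::] M i)) n
    & t * q <= count id X < t * q + t].
Proof.
move=> hM hr hX.
have t0 : 0 < t by rewrite !muln_gt0 k_gt0 D_gt0.
have ht : 0 < t <= t by rewrite t0 leqnn.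
have [q [w' [h1 [h2 h3]]]] :=
  wfold_bud s 0 1 (zip (ticks n) (initial X)) ht.
have hi : unzip2 (zip (ticks n) (initial X)) = initial X.
  by rewrite unzip2_zip // size_nseq size_map hX.
have hst : initial X = st_of n X [::].
  apply: (@eq_from_nth _ Out); first by rewrite size_map size_mkseq.
  by move=> j; rewrite size_map => hj; rewrite (nth_map false) // nth_mkseq -?hX.
have hc : count (fun x => is_und x.2 || is_in x.2) (zip (ticks n) (initial X)) =
    count id X.
  rewrite -(count_map snd (fun z => is_und z || is_in z)) -/(unzip2 _) hi count_map.
  by apply: eq_count => -[].
have [E [w [i [h4 [h5 h6 h7]]]]] := @foldM_sel k D n X q (s * q).+1 w' M hM hr.
exists q, w, E; split=> //.
  by rewrite /m_main h1 bindM1 hi hst add0n addn1 h4 bindM1.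
by move: h3; rewrite hc subnn addn0 => ->; lia.
Qed.

Lemma is_chosen st : all (fun z => (z == Out) || (z == In false)) st ->
  st = chosen (map is_in st) (fun=> false).
Proof.
move=> h; apply: (@eq_from_nth _ Out); first by rewrite size_mkseq size_map.
move=> j hj; rewrite nth_mkseq ?size_map // (nth_map Out) //.
by move/all_nthP: h => /(_ Out j hj) /orP[] /eqP ->.
Qed.

Lemma chosen_C dec c n st : size st = n ->
  all (fun r => (size r.2 == n) && (r.2 == chosen (map is_in r.2) (fun=> false)))
    (wfold (f_C dec) c (zip (ticks n) st)).
Proof.
move=> hs; have := @all2_wfold_zip _ (fun _ z => (z == Out) || (z == In false))
  (f_C dec) c (ticks n) st.
move=> H; apply: sub_all (H _ _); last by rewrite size_nseq.
  move=> r; rewrite all2E hs => /andP[/eqP hr h]; rewrite -hr eqxx /=.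
  apply/eqP; apply: is_chosen; rewrite -[r.2](@unzip2_zip _ _ st r.2) ?hs -?hr //.
  by rewrite all_map.
move=> [q [b w]] x; rewrite /f_C; case: (x.2) => [|y|y] //=; rewrite ?eqxx ?orbT //.
by case: ifP => _ /=; rewrite ?eqxx ?orbT.
Qed.

Lemma chosen_main n E a : sized n a -> all (sized_item n) E ->
  all (fun r => (size r.2 == n) && (r.2 == chosen (map is_in r.2) (fun=> false)))
    (m_type1 n E a ++ m_type2 D n E a).
Proof.
move=> ha hE; rewrite all_cat; apply/andP; split.
  apply: (@all_bindM _ _ (sized n)).
    by apply: (all_foldM _ ha hE) => a' i h1 h2; case: (@spec_1 n _ _ h1 h2).
  by move=> [[q [b w]] st] /eqP h; apply: chosen_C.
apply: (@all_bindM _ _ (sized n)).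
  by apply: sized_wfold; [rewrite size_nseq|apply/eqP].
move=> r hr; apply: (@all_bindM _ _ (sized n)).
  by apply: (all_foldM _ hr hE) => a' i h1 h2; case: (@spec_2 n _ _ h1 h2).
by move=> r' /eqP h; apply: chosen_C.
Qed.

(** The final test is deterministic: it decides what a leaf reports but adds no leaves. *)
Lemma check_main n E X a : sized n a -> all (sized_item n) E -> size X = n ->
  bindM (m_type1 n E a ++ m_type2 D n E a) (m_check n E X) =
  [seq (let T := map is_in r.2 in
        if valid E X T then Cons Nil (enc_list data_of_bool T) else Nil)
    | r <- m_type1 n E a ++ m_type2 D n E a].
Proof.
move=> ha hE hX; rewrite -bindM_ret; apply: (eq_bindM_all (chosen_main ha hE)).
move=> [c st] /andP[/eqP /= hs /eqP hst]; set T := map is_in st.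
have hT : size T = n by rewrite size_map.
by rewrite hst -hT m_check_chosen ?hT.
Qed.

Lemma decided_chosen T n : size T = n ->
  decided (fun j => nth false T j) n = chosen T (fun=> false).
Proof. by move=> <-. Qed.

Lemma map_is_in_chosen T : map is_in (chosen T (fun=> false)) = T.
Proof.
apply: (@eq_from_nth _ false); first by rewrite size_map size_mkseq.
move=> j; rewrite size_map size_mkseq => hj.
rewrite (nth_map Out) ?size_mkseq // nth_mkseq //.
by case: (nth false T j).
Qed.

Lemma count_und_st_of n X E : size X = n -> count is_und (st_of n X E) = count id X.
Proof.
move=> hX; rewrite (@count_nth _ Out _ _ n) ?size_mkseq // (@count_nth _ false _ X n) //.
by apply: eq_bigr => j _; rewrite nth_mkseq //; case: (nth false X j).
Qed.

Lemma count_sat_st_of n X E : size X = n ->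
  count (saturated D) (st_of n X E) =
    \sum_(j < n) (nth false X j && (D <= load E j)) /\
  count (saturated D) (st_of n X E) + count (unsaturated D) (st_of n X E) =
    count id X.
Proof.
move=> hX; rewrite -(count_und_st_of E hX) !(@count_nth _ Out _ _ n) ?size_mkseq //.
split; first by apply: eq_bigr => j _; rewrite nth_mkseq //; case: (nth false X j).
rewrite -big_split /=; apply: eq_bigr => j _; rewrite nth_mkseq //.
by case: (nth false X j) => //=; case: leqP.
Qed.

End Main.


(** * Numerical estimates *)

Section Numeric.
Import Order.TTheory GRing.Theory Num.Theory.
Local Open Scope ring_scope.
Variable R : realFieldType.

(** Consecutive values of m^4 (m + 1) have ratio at most (6/5)^2 < 2. The threshold 16 is the least
    m with 5 (m + 1) (m + 2) <= 6 m^2. *)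
Lemma pow_beats_poly_step (c m : nat) : (16 <= m)%N ->
  (c * m.+1 ^ 4 * m.+2 <= 2 * (c * m ^ 4 * m.+1))%N.
Proof.
move=> hm.
have hA : (5 * m.+1 ^ 2 <= 6 * m ^ 2)%N by nia.
have hB : (5 * (m.+1 * m.+2) <= 6 * m ^ 2)%N by nia.
have h' : (m.+1 ^ 2 * (m.+1 * m.+2) <= 2 * (m ^ 2 * m ^ 2))%N.
  have := leq_mul hA hB.
  by move: (m.+1 ^ 2)%N (m ^ 2)%N (m.+1 * m.+2)%N => a b p; nia.
have -> : (c * m.+1 ^ 4 * m.+2 = c * m.+1 * (m.+1 ^ 2 * (m.+1 * m.+2)))%N.
  by rewrite (expnD _ 2 2) expnS expn1; nia.
have -> : (2 * (c * m ^ 4 * m.+1) = c * m.+1 * (2 * (m ^ 2 * m ^ 2)))%N.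
  by rewrite (expnD _ 2 2); nia.
by rewrite leq_mul2l h' orbT.
Qed.

(** Meant for [c = 128] and [p = m = 40], with variables so that the powers stay symbolic. It rests
    on 40 * 25 = 1000 <= 2^10, and the surplus 25^4 absorbs 128 * 41. *)
Lemma pow_beats_poly_base (c p m : nat) :
  (c <= 25 ^ 2)%N -> (p.+1 <= 25 ^ 2)%N -> (p * 25 <= 2 ^ 10)%N ->
  m = (10 * 4)%N -> (c * p ^ 4 * p.+1 <= 2 ^ m)%N.
Proof.
move=> hc hp h ->; rewrite expnM.
have h4 : ((p * 25) ^ 4 <= (2 ^ 10) ^ 4)%N by rewrite leq_exp2r.
apply: leq_trans h4; rewrite expnMn (expnD 25 2 2) mulnAC mulnC leq_mul2l.
by apply/orP; right; apply: leq_mul.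
Qed.

Lemma pow_beats_poly (m : nat) :
  (40 <= m)%N -> (128 * m ^ 4 * m.+1 <= 2 ^ m)%N.
Proof.
elim: m => [|m IH]; first by rewrite leqn0.
rewrite leq_eqVlt => /orP[/eqP hm|hm].
  by apply: pow_beats_poly_base; rewrite -?hm.
have hm' : (16 <= m)%N by lia.
apply: leq_trans (pow_beats_poly_step _ hm') _.
by rewrite (expnS 2) leq_mul2l IH // orbT.
Qed.

(** By induction (1 - m x) (1 + x)^m <= 1, and the first factor is at least 3/4. *)
Lemma expr1D_le (x : R) (m : nat) : 0 <= x -> m%:R * x <= 4^-1 ->
  (1 + x) ^+ m <= 4 / 3.
Proof.
move=> x0 hm; have h : (1 - m%:R * x) * (1 + x) ^+ m <= 1.
  elim: m {hm} => [|m IH]; first by rewrite mul0r subr0 mul1r.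
  rewrite exprS; have hp : 0 <= (1 + x) ^+ m by rewrite exprn_ge0 // addr_ge0.
  apply: le_trans IH; rewrite mulrA ler_wpM2r // -natr1.
  have : 0 <= m%:R * x * x by rewrite !mulr_ge0.
  have := sqr_ge0 x; rewrite expr2; nra.
have hp : 0 <= (1 + x) ^+ m by rewrite exprn_ge0 // addr_ge0.
nra.
Qed.

Lemma bernoulli (y : R) (m : nat) : 0 <= y <= 1 ->
  1 - m%:R * y <= (1 - y) ^+ m.
Proof.
case/andP=> y0 y1; elim: m => [|m IH]; first by rewrite mul0r subr0.
rewrite exprS; apply: (@le_trans _ _ ((1 - y) * (1 - m%:R * y))).
  have h : 0 <= m%:R * (y * y) by rewrite !mulr_ge0.
  by rewrite -natr1; nra.
by rewrite ler_wpM2l // subr_ge0.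
Qed.

(** Since n <= C t (q + 1), guessing the blocks costs at most (4/3)^(q + 1). Against 2^q this leaves
    2 (2/3)^(q + 1). With y = 1 / (3 t), Bernoulli gives (1 - y)^t >= 2/3, which spreads the gain
    evenly over the N < t (q + 1) vertices. *)
Lemma type1_bound (C t q N n : nat) (alpha : R) :
  (0 < t)%N -> 0 <= alpha -> (C * t)%:R * (2 * alpha) <= 4^-1 ->
  (n <= C * N)%N -> (N < t * q + t)%N ->
  2 ^+ N / 2 ^+ q * (1 + 2 * alpha) ^+ n <=
  2 * (2 * (1 - (3 * t)%:R^-1)) ^+ N.
Proof.
move=> t0 a0 ha hn hN.
have hA : (1 + 2 * alpha) ^+ (C * t) <= 4 / 3.
  by apply: expr1D_le => //; rewrite mulr_ge0.
have h1A : 1 <= 1 + 2 * alpha by rewrite lerDl mulr_ge0.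
have hn' : (1 + 2 * alpha) ^+ n <= (4 / 3) ^+ q.+1.
  apply: (@le_trans _ _ ((1 + 2 * alpha) ^+ (C * t * q.+1))).
    rewrite ler_weXn2l //; apply: leq_trans hn _; nia.
  by rewrite exprM lerXn2r // ?nnegrE ?exprn_ge0 ?(le_trans _ h1A) ?divr_ge0.
set y : R := (3 * t)%:R^-1.
have hy : 0 <= y <= 1.
  by rewrite invr_ge0 ler0n /= invf_le1 ?ler1n ?ltr0n ?muln_gt0.
have hty : t%:R * y = 3^-1.
  by rewrite /y natrM invfM mulrCA mulfV ?mulr1 // pnatr_eq0 -lt0n.
have hs : 2 / 3 <= (1 - y) ^+ t by have := bernoulli t hy; rewrite hty; lra.
have y1 : 0 <= 1 - y by rewrite subr_ge0; case/andP: hy.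
have hq : (2 / 3) ^+ q.+1 <= (1 - y) ^+ N.
  apply: (@le_trans _ _ ((1 - y) ^+ (t * q.+1))).
    by rewrite exprM lerXn2r // nnegrE ?exprn_ge0 ?divr_ge0.
  apply: ler_wiXn2l => //; first by rewrite gerBl; case/andP: hy.
  by rewrite mulnS addnC ltnW.
rewrite exprMn [leRHS]mulrCA -mulrA ler_wpM2l ?exprn_ge0 //.
apply: (@le_trans _ _ (2 * (2 / 3) ^+ q.+1)); last by rewrite ler_wpM2l.
rewrite mulrC ler_pdivrMr ?exprn_gt0 //; apply: (le_trans hn').
have -> : 4 / 3 = 2 / 3 * 2 :> R by rewrite mulrAC -natrM.
by rewrite exprMn (exprS 2 q) mulrCA mulrA.
Qed.

Section Type2.
Variables (delta : R).
Hypothesis delta0 : 0 < delta.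
Hypothesis delta1 : 20 * delta <= 1.
Let beta := 2 - delta.
Let lam := (1 - delta)^-1.
(** The coefficient must exceed 3/8 for 2 lam <= beta kappa^4, to first order in delta, and stay
    below 1/2 for beta kappa < 2. The bound on [delta] absorbs the higher-order terms. *)
Let kappa := 1 + 2 / 5 * delta.

Lemma type2_bound (sat uns b N n : nat) :
  (sat + uns = N)%N -> (4 * sat <= N)%N -> (4 * b <= N)%N ->
  2 ^+ sat * (n.+1%:R * (lam ^+ b.+1 * beta ^+ uns)) <=
  2 * n.+1%:R * (beta * kappa) ^+ N.
Proof.
move=> hN hsat hb; have d0' := delta0; have d1' := delta1.
have d1 : 0 < 1 - delta by lra.
have l1 : 1 <= lam by rewrite /lam invf_ge1 //; lra.
have l2 : lam <= 2 by rewrite /lam -[leRHS]invrK lef_pV2 ?posrE ?invr_gt0 //; lra.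
have be1 : 1 <= beta by rewrite /beta; lra.
have be2 : beta <= 2 by rewrite /beta; lra.
have k1 : 1 <= kappa by rewrite /kappa lerDl mulr_ge0 // ?divr_ge0 // ltW.
have be0 : 0 <= beta := le_trans ler01 be1.
have l0 : 0 <= lam := le_trans ler01 l1.
have k0 : 0 <= kappa := le_trans ler01 k1.
(* As [beta <= 2] and [lam >= 1], the worst case has both [sat] and [b] equal to the integer part of
   N / 4. *)
have [f [f4 hsf hbf]] : exists f, [/\ (4 * f <= N)%N, (sat <= f)%N & (b <= f)%N].
  by exists (N %/ 4)%N; split; rewrite 1?mulnC ?leq_trunc_div ?leq_divRL // mulnC.
have fN : (f <= N)%N by apply: leq_trans f4; rewrite leq_pmull.
have h1 : 2 ^+ sat * beta ^+ uns <= 2 ^+ f * beta ^+ (N - f).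
  have -> : uns = ((f - sat) + (N - f))%N.
    by rewrite addnC addnBA // subnK // -hN addKn.
  rewrite -[in leRHS](subnKC hsf) (exprD beta) (exprD 2) mulrA subnKC //.
  rewrite ler_wpM2r ?exprn_ge0 // ler_wpM2l ?exprn_ge0 //.
  by rewrite lerXn2r ?nnegrE.
have h2 : lam ^+ b <= lam ^+ f by rewrite ler_weXn2l.
have h3 : 2 * lam <= beta * kappa ^+ 4.
  rewrite /lam ler_pdivrMr //.
  have : 1 + 8 / 5 * delta <= kappa ^+ 4.
    rewrite /kappa; have := sqr_ge0 delta; nra.
  rewrite /beta; nra.
have h4 : 2 ^+ f * beta ^+ (N - f) * lam ^+ f <= (beta * kappa) ^+ N.
  rewrite mulrAC -exprMn; apply: (@le_trans _ _ ((beta * kappa ^+ 4) ^+ f * beta ^+ (N - f))).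
    rewrite ler_wpM2r ?exprn_ge0 // lerXn2r ?nnegrE //.
      by rewrite mulr_ge0.
    by rewrite mulr_ge0 ?exprn_ge0.
  have -> : (beta * kappa ^+ 4) ^+ f * beta ^+ (N - f) =
      beta ^+ N * kappa ^+ (4 * f).
    by rewrite -[in RHS](subnKC fN) (exprD beta) (exprM kappa) exprMn mulrAC.
  by rewrite [leRHS]exprMn ler_wpM2l ?exprn_ge0 // ler_weXn2l.
have -> : 2 ^+ sat * (n.+1%:R * (lam ^+ b.+1 * beta ^+ uns)) =
   lam * n.+1%:R * ((2 ^+ sat * beta ^+ uns) * lam ^+ b) by rewrite exprS; ring.
apply: ler_pM; rewrite ?mulr_ge0 ?exprn_ge0 //.
  by rewrite ler_wpM2r.
apply: le_trans h4; apply: ler_pM => //.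
  by rewrite mulr_ge0 ?exprn_ge0.
by rewrite exprn_ge0.
Qed.

Lemma rate2_lt2 : beta * kappa < 2.
Proof. by have d0' := delta0; have d1' := delta1; rewrite /beta /kappa; nra. Qed.

End Type2.
End Numeric.

(** * Minimal dominating sets as minimal transversals *)

Section Graph.
Variables (V : finType) (e : rel V).
Hypothesis e_sym : symmetric e.

Definition neighbours (v : V) : {set V} := [set u | e v u || (u == v)].

Lemma dominatingP (A : {set V}) :
  reflect (forall v, neighbours v :&: A != set0) (dominating e A).
Proof.
apply: (iffP forallP) => h v.
  apply/set0Pn; case/orP: (h v) => [hv|/existsP[u /andP[hu huv]]].
    by exists v; rewrite !inE eqxx orbT.
  by exists u; rewrite !inE e_sym huv.
case/set0Pn: (h v) => u; rewrite !inE => /andP[/orP[huv|/eqP <-] hu].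
  by apply/orP; right; apply/existsP; exists u; rewrite hu e_sym.
by rewrite hu.
Qed.

(** Private neighbours: a vertex left undominated by [A :\ v] has [v] as its only dominator in [A],
    and conversely a dominating subset of [A] must keep the only dominator of any vertex. *)
Lemma minimal_dominatingP (A : {set V}) :
  reflect ((forall v, 0 < #|neighbours v :&: A|) /\
           (forall v, v \in A ->
              exists w, (v \in neighbours w) && (#|neighbours w :&: A| == 1)))
    (minimal_dominating e A).
Proof.
apply: (iffP minsetP) => [[/dominatingP hA hmin]|[h1 h2]].
  split=> [v|v hv]; first by rewrite card_gt0.
  have : ~~ dominating e (A :\ v).
    apply/negP => hd; have := hmin _ hd (subD1set _ _) => hE.
    by move: hv; rewrite -hE !inE eqxx.
  rewrite /dominating negb_forall => /existsP[w hw].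
  have h0 : neighbours w :&: (A :\ v) = set0.
    apply/eqP/negPn/negP => /set0Pn[u]; rewrite !inE => /and3P[hu huv huA].
    case/negP: hw; apply/orP; case/orP: hu => [hu|/eqP <-].
      by right; apply/existsP; exists u; rewrite !inE huv huA e_sym.
    by left; rewrite !inE huv.
  have hsub u : u \in neighbours w :&: A -> u = v.
    move=> hu; apply/eqP/negPn/negP => huv.
    have : u \in neighbours w :&: (A :\ v).
      by move: hu; rewrite !inE huv.
    by rewrite h0 inE.
  have /set0Pn[u hu] := hA w; have huv := hsub _ hu; rewrite huv in hu.
  exists w; have -> : neighbours w :&: A = [set v].
    apply/setP => x; rewrite inE; apply/idP/eqP => [/hsub //|->]; exact: hu.
  by rewrite cards1 eqxx andbT; move: hu; rewrite inE => /andP[].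
split; first by apply/dominatingP => v; rewrite -card_gt0.
move=> B /dominatingP hB hBA; apply/eqP; rewrite eqEsubset hBA /=.
apply/subsetP => v hv; have [w /andP[hw /cards1P[u hu]]] := h2 v hv.
have huv : u = v.
  have : v \in neighbours w :&: A by rewrite inE hw.
  by rewrite hu inE => /eqP ->.
have /set0Pn[x] := hB w; rewrite inE => /andP[hx1 hx2].
have : x \in neighbours w :&: A by rewrite inE hx1 (subsetP hBA).
by rewrite hu inE => /eqP hxu; rewrite -huv -hxu.
Qed.

Definition bits (A : {set V}) : seq bool := [seq x \in A | x <- enum V].

Definition adjacency : seq (seq bool) :=
  [seq [seq e x y | y <- enum V] | x <- enum V].

Lemma size_bits A : size (bits A) = #|V|.
Proof. by rewrite size_map -cardE. Qed.

Lemma size_adjacency : size adjacency = #|V|.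
Proof. by rewrite size_map -cardE. Qed.

Lemma size_adjacency_rows : all (fun r => size r == #|V|) adjacency.
Proof. by apply/allP => r /mapP[x _ ->]; rewrite size_map -cardE. Qed.

Lemma nth_bits A (i : 'I_#|V|) : nth false (bits A) i = (enum_val i \in A).
Proof. by rewrite (nth_map (enum_default i)) -?cardE // -enum_val_nth. Qed.

Lemma nth_adjacency (i j : 'I_#|V|) :
  nth false (nth [::] adjacency i) j = e (enum_val i) (enum_val j).
Proof.
rewrite (nth_map (enum_default i)) -?cardE // -enum_val_nth.
by rewrite (nth_map (enum_default j)) -?cardE // -enum_val_nth.
Qed.

Lemma count_bits A : count id (bits A) = #|A|.
Proof.
by rewrite count_map enumT -size_filter cardE; congr size.
Qed.

Lemma data_of_setE A : data_of_set A = enc_list data_of_bool (bits A).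
Proof. by rewrite /data_of_set /enc_list /bits -map_comp. Qed.

Lemma data_of_instanceE X : data_of_instance e X =
  Cons (enc_list (enc_list data_of_bool) adjacency)
       (enc_list data_of_bool (bits X)).
Proof.
rewrite /data_of_instance data_of_setE; congr Cons.
rewrite /data_of_rel /enc_list /adjacency -map_comp; congr data_of_seq.
by apply: eq_map => x /=; rewrite -map_comp.
Qed.

Lemma spine_enc_list (T : Type) (enc : T -> data) l :
  spine (enc_list enc l) = size l.
Proof. by rewrite /enc_list; elim: l => //= x l ->. Qed.

Lemma bits_surj T : size T = #|V| -> exists A, T = bits A.
Proof.
move=> hT; exists [set x | nth false T (enum_rank x)].
apply: (@eq_from_nth _ false); first by rewrite size_bits.
move=> i; rewrite hT => hi; rewrite (nth_bits _ (Ordinal hi)) inE.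
by rewrite enum_valK.
Qed.

Lemma sum_enum_val (f : V -> nat) :
  \sum_(j < #|V|) f (enum_val j) = \sum_v f v.
Proof.
rewrite [RHS](reindex (@enum_val V (mem V))) /=; first exact: eq_bigr.
by apply: onW_bij; apply: enum_val_bij.
Qed.

Lemma nth_unzip1 (row : seq (bool * bool)) j :
  nth false (unzip1 row) j = (nth (false, false) row j).1.
Proof.
have [hj|hj] := ltnP j (size row); first by rewrite (nth_map (false, false)).
by rewrite !nth_default // size_map.
Qed.

Section Items.
Variable E : seq item.
Hypothesis hE : rev [seq unzip1 i.2 | i <- E] =
  mkseq (fun i => closed_row #|V| i (nth [::] adjacency i)) #|V|.

(** The items come in reverse order, which [all] does not see; this turns tests over items into
    quantifiers over vertices. *)
Lemma all_items (P : pred (seq bool)) (Q : pred item) :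
  (forall i : item, Q i = P (unzip1 i.2)) ->
  all Q E = [forall i : 'I_#|V|, P (closed_row #|V| i (nth [::] adjacency i))].
Proof.
move=> hPQ; rewrite (eq_all hPQ) -(all_map (fun i : item => unzip1 i.2) P).
rewrite -all_rev hE; apply/allP/forallP => [h i|h r /mapP[i hi ->]].
  by apply: h; apply/mapP; exists (i : nat); rewrite // mem_iota ltn_ord.
by move: hi; rewrite mem_iota => /= hi; exact: (h (Ordinal hi)).
Qed.

Lemma nth_closed_row (i j : 'I_#|V|) :
  nth false (closed_row #|V| i (nth [::] adjacency i)) j =
  (enum_val j \in neighbours (enum_val i)).
Proof.
rewrite nth_mkseq // nth_adjacency inE; congr (_ || _).
by rewrite (inj_eq enum_val_inj).
Qed.

(** The items keep whole closed neighbourhoods instead of their intersections with X; a set inside X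
    meets both in the same vertices. *)
Lemma valid_bits X A :
  valid E (bits X) (bits A) = minimal_dominating e A && (A \subset X).
Proof.
pose cnt r := \sum_(j < #|V|) (nth false r j && nth false (bits A) j).
have hcnt (i : item) : hcount i (bits A) = cnt (unzip1 i.2).
  by rewrite /hcount size_bits; apply: eq_bigr => j _; rewrite nth_unzip1.
have cntE (i : 'I_#|V|) : cnt (closed_row #|V| i (nth [::] adjacency i)) =
    #|neighbours (enum_val i) :&: A|.
  rewrite -sum1_card big_mkcond -(sum_enum_val (fun v =>
    if v \in neighbours (enum_val i) :&: A then 1 else 0)).
  apply: eq_bigr => j _; rewrite nth_closed_row nth_bits in_setI.
  by case: (_ && _).
have -> : valid E (bits X) (bits A) =
   [forall i : 'I_#|V|, 0 < #|neighbours (enum_val i) :&: A|] &&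
   [forall j : 'I_#|V|, (enum_val j \in A) ==> (enum_val j \in X) &&
      [exists i : 'I_#|V|, (enum_val j \in neighbours (enum_val i)) &&
        (#|neighbours (enum_val i) :&: A| == 1)]].
  rewrite /valid (all_items (P := fun r => 0 < cnt r)); last by move=> i; rewrite hcnt.
  congr (_ && _); first by apply: eq_forallb => i; rewrite cntE.
  have hh (j : 'I_#|V|) : has (fun i : item => hbit i j && (hcount i (bits A) == 1)) E =
     [exists i : 'I_#|V|, (enum_val j \in neighbours (enum_val i)) &&
        (#|neighbours (enum_val i) :&: A| == 1)].
    rewrite -[LHS]negbK -all_predC
      (all_items (P := fun r => ~~ (nth false r j && (cnt r == 1)))).
      rewrite negb_forall; apply: eq_existsb => i.
      by rewrite negbK nth_closed_row cntE.
    by move=> i /=; rewrite hcnt nth_unzip1.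
  rewrite size_bits; apply/allP/forallP => h j.
    by have := h j; rewrite mem_iota ltn_ord => /(_ isT); rewrite !nth_bits hh.
  rewrite mem_iota => /= hj; have := h (Ordinal hj).
  by rewrite -!nth_bits -hh.
apply/andP/andP => [[/forallP h1 /forallP h2]|[/minimal_dominatingP[h1 h2] hX]].
  have h2' v : v \in A -> (v \in X) && [exists i : 'I_#|V|,
      (v \in neighbours (enum_val i)) && (#|neighbours (enum_val i) :&: A| == 1)].
    by move=> hv; have := h2 (enum_rank v); rewrite enum_rankK hv.
  split; last by apply/subsetP => v /h2' /andP[].
  apply/minimal_dominatingP; split=> [v|v /h2' /andP[_ /existsP[i hi]]].
    by have := h1 (enum_rank v); rewrite enum_rankK.
  by exists (enum_val i).
split; apply/forallP => i; first exact: h1.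
apply/implyP => hi; rewrite (subsetP hX) //=; have [w hw] := h2 _ hi.
by apply/existsP; exists (enum_rank w); rewrite enum_rankK.
Qed.

End Items.
End Graph.

Import Order.TTheory GRing.Theory Num.Theory.
Local Open Scope ring_scope.

(** * Choice of the constants and the bound on the number of leaves *)

Section Rate.
Variables (R : realFieldType) (C : nat).
Hypothesis C_gt0 : (0 < C)%N.
(** [k] is at least [C] and at least 40, as needed to beat the polynomial in [pow_beats_poly]. [D]
    makes k n / D <= N / 4 when n <= C N. [s] is the number of exceptional blocks charged to one
    declared block, and [t] makes 4 s q <= N. [delta] is just small enough for [a j <= 1] when
    [j < k]. *)
Let k := (C + 40)%N.
Let D := (4 * k * C)%N.
Let s := (k * D)%N.
Let t := (4 * s)%N.
Let delta : R := (2 ^+ k)^-1.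

Definition rate : R :=
  Num.max (2 * (1 - (3 * t)%:R^-1)) ((2 - delta) * (1 + 2 / 5 * delta)).

Lemma block_size_gt0 : (0 < k)%N. Proof. by rewrite addn_gt0 orbT. Qed.
Lemma block_overlap_gt0 : (0 < D)%N. Proof. by rewrite !muln_gt0 block_size_gt0 C_gt0. Qed.
Lemma budget_unit_gt0 : (0 < t)%N. Proof. by rewrite !muln_gt0 block_size_gt0 C_gt0. Qed.

Lemma delta_pos : 0 < delta.
Proof. by rewrite invr_gt0 exprn_gt0. Qed.

Lemma delta_small : 20 * delta <= 1.
Proof.
rewrite ler_pdivrMr ?exprn_gt0 // mul1r.
apply: (@le_trans _ _ (2 ^+ 5)); first by rewrite -natrX ler_nat.
by rewrite ler_weXn2l ?ler1n // (leq_trans _ (leq_addl _ _)).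
Qed.

Lemma rate_lt2 : rate < 2.
Proof.
rewrite /rate gt_max (rate2_lt2 delta_pos) ?delta_small // andbT.
by rewrite gtr_pMr // gtrBl invr_gt0 ltr0n muln_gt0 budget_unit_gt0.
Qed.

Lemma rate1_ge0 : 0 <= 2 * (1 - (3 * t)%:R^-1) :> R.
Proof.
have h : 1 <= (3 * t)%:R :> R by rewrite ler1n muln_gt0 budget_unit_gt0.
by rewrite mulr_ge0 // subr_ge0 invf_le1 // (lt_le_trans ltr01 h).
Qed.

Lemma rate_ge0 : 0 <= rate.
Proof.
by rewrite /rate le_max rate1_ge0.
Qed.

Lemma leaves_bound n M X :
  size M = n -> all (fun r => size r == n) M -> size X = n ->
  (n <= C * count id X)%N ->
  (size (m_main k D s t n M X))%:R <= 4 * n.+1%:R * rate ^+ count id X :> R.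
Proof.
move=> hM hr hX hn; set N := count id X.
have [q [w [E [-> hE hsE hrows /andP[hq1 hq2]]]]] :=
  m_main_prep block_size_gt0 block_overlap_gt0 hM hr hX.
have hEs : all (sized_item n) E by case: hE => G1 _ _ _ _; apply/allP => e /G1 /eqP.
have hst : size (st_of n X E) = n by rewrite size_mkseq.
rewrite check_main //; last by apply/eqP.
rewrite size_map size_cat natrD.
pose c : ctl := (q, ((s * q).+1, w)).
have [hsat1 hsat2] := count_sat_st_of D E hX.
have hp0 : 0 <= rate ^+ N by rewrite exprn_ge0 // rate_ge0.
have d0 := delta_pos; have d1 := delta_small.
have h1 : (size (m_type1 n E (c, st_of n X E)))%:R <= 2 * rate ^+ N.
  pose alpha : R := k.+1%:R / 2 ^+ k.
  have alphaE : alpha * 2 ^+ k = k.+1%:R by rewrite divfK // expf_neq0 // pnatr_eq0.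
  have a0 : 0 <= alpha by rewrite divr_ge0 ?exprn_ge0.
  have hk : {in E, forall e, e.1 = 0%N -> scount e = k}.
    by case: hE => _ _ G3 _ _ e /G3 <- ->; rewrite addn0.
  have hi : inv1 k (c, st_of n X E).
    rewrite /inv1 /= (count_und_st_of E hX) -/N; apply: leq_trans hq1.
    rewrite leq_mul2r; apply/orP; right; rewrite /t /s mulnCA leq_pmulr //.
    by rewrite muln_gt0 block_overlap_gt0.
  apply: le_trans (leaf_1 alphaE block_size_gt0 hst hEs hk hi) _.
  rewrite /pot1 /= (count_und_st_of E hX) -/N hsE.
  have ha : (C * t)%:R * (2 * alpha) <= 4^-1.
    rewrite -[leRHS]mul1r ler_pdivlMr // /alpha.
    have -> : (C * t)%:R * (2 * (k.+1%:R / 2 ^+ k)) * 4 =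
        (C * t * 2 * k.+1 * 4)%:R / 2 ^+ k :> R.
      by rewrite !natrM; ring.
    rewrite ler_pdivrMr ?exprn_gt0 // mul1r -natrX ler_nat.
    apply: leq_trans (pow_beats_poly (leq_addl C 40)); rewrite -/k.
    (* The constants multiply to 128 C^2 k^2 (k + 1), and [C <= k] bounds this by 128 k^4 (k + 1) <=
       2^k. *)
    have hCk : (C <= k)%N by apply: leq_addr.
    have -> : (C * t * 2 * k.+1 * 4 = 128 * (C * C * (k * k)) * k.+1)%N.
      by rewrite /t /s /D; lia.
    rewrite leq_mul2r leq_mul2l (expnD k 2 2) /=.
    by rewrite leq_mul // ?mulnn // leq_mul.
  apply: le_trans (type1_bound budget_unit_gt0 a0 ha hn hq2) _.
  rewrite ler_wpM2l // lerXn2r ?nnegrE ?rate_ge0 ?rate1_ge0 //.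
  by rewrite /rate le_max lexx.
have h2 : (size (m_type2 D n E (c, st_of n X E)))%:R <= 2 * n.+1%:R * rate ^+ N.
  pose beta : R := 2 - delta; pose lam : R := (1 - delta)^-1.
  (* Closed form of beta^-1 + ... + beta^-j. As [beta - 1 = 1 - delta], it is at most 1 exactly if
     [delta <= beta^-j]. *)
  pose a j : R := (1 - beta^-1 ^+ j) / (beta - 1).
  have dp : 0 < 1 - delta by lra.
  have be1 : 1 <= beta by rewrite /beta; lra.
  have l1 : 1 <= lam by rewrite /lam invf_ge1 //; lra.
  have lb : 1 + lam <= lam * beta.
    by rewrite le_eqVlt; apply/orP; left; apply/eqP; rewrite /lam /beta; field; rewrite gt_eqF.
  have a0 : 0 <= a 0%N by rewrite /a expr0 subrr mul0r.
  have bn1 : beta - 1 != 0 by rewrite /beta gt_eqF //; lra.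
  have bn0 : beta != 0 by rewrite gt_eqF // (lt_le_trans ltr01).
  have aS j : beta * a j.+1 = 1 + a j.
    by rewrite /a exprS; field; rewrite bn1 bn0.
  have a1 j : (j < k)%N -> a j <= 1.
    move=> hj; rewrite /a ler_pdivrMr; last by rewrite /beta; lra.
    rewrite mul1r; suff : delta <= beta^-1 ^+ j by rewrite /beta; lra.
    have be0 : 0 < beta := lt_le_trans ltr01 be1.
    rewrite exprVn /delta lef_pV2 ?posrE ?exprn_gt0 //.
    apply: (@le_trans _ _ (2 ^+ j)).
      by rewrite lerXn2r ?nnegrE ?(le_trans ler01 be1) // /beta; lra.
    by rewrite ler_weXn2l ?ler1n // ltnW.
  have := @leaf_type2 R beta lam a k be1 l1 lb a0 aS a1 n D X E q (s * q).+1 w hE.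
  move=> /(_ isT hsE) h; apply: le_trans h _.
  have hs4 : (4 * count (saturated D) (st_of n X E) <= N)%N.
    have hle := saturated_count hE.
    rewrite -hsat1 hsE in hle.
    have hle' : (D * count (saturated D) (st_of n X E) <= k * (C * N))%N.
      by apply: leq_trans hle _; rewrite leq_mul2l hn orbT.
    have kC : (0 < k * C)%N by rewrite muln_gt0 block_size_gt0 C_gt0.
    rewrite -(leq_pmul2l kC) -[leqRHS]mulnA; apply: leq_trans hle'.
    by rewrite /D mulnCA -!mulnA.
  have hb4 : (4 * (s * q) <= N)%N by rewrite mulnA.
  apply: le_trans (type2_bound d0 d1 n hsat2 hs4 hb4) _.
  rewrite ler_wpM2l ?mulr_ge0 // lerXn2r ?nnegrE ?rate_ge0 //.
    by rewrite mulr_ge0 //; lra.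
  by rewrite /rate le_max lexx orbT.
apply: le_trans (lerD h1 h2) _.
have -> : 4 * n.+1%:R * rate ^+ N =
    2 * n.+1%:R * rate ^+ N + 2 * n.+1%:R * rate ^+ N by ring.
rewrite lerD2r ler_wpM2r // ler_peMr // ler1n //.
Qed.

End Rate.

Lemma time_product (R : realFieldType) (m n : nat) (r : R) :
  4 * n.+1%:R * r * (m.+3 * n.+1 ^ m)%:R = (4 * m.+3 * n.+1 ^ m.+1)%:R * r.
Proof.
rewrite expnS !natrM; move: (n.+1 ^ m)%:R (n.+1)%:R (m.+3)%:R => x y z.
by ring.
Qed.

Theorem theorem9 (R : realType) (d : R) (d_gt0 : 0 < d) :
  exists eps : R, 0 < eps /\
  exists (A : com) (c : nat),
  forall (V : finType) (e : rel V), symmetric e -> irreflexive e ->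
  forall X : {set V}, d * #|V|%:R <= #|X|%:R ->
  exists t : search_tree,
    [/\ search_tree_of A (data_of_instance e X) t,
        (path_time t <= c * #|V|.+1 ^ c)%N,
        enumerates t
          (fun D : {set V} => minimal_dominating e D && (D \subset X))
      & (total_time t)%:R <= (c * #|V|.+1 ^ c)%:R * (2 - eps) ^+ #|X| :> R].
Proof.
(* An integer above 1/d, so that there are at most [C * #|X|] hyperedges. *)
pose C := Num.bound d^-1.
have hC : d^-1 < C%:R by apply: archi_boundP; rewrite invr_ge0 ltW.
have C_gt0 : (0 < C)%N by rewrite -(ltr0n R); apply: lt_trans hC; rewrite invr_gt0.
pose k := (C + 40)%N; pose D := (4 * k * C)%N.
pose s := (k * D)%N; pose b := (4 * s)%N.
pose p := p_main k D s b; pose m := pdeg p.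
exists (2 - rate R C); split; first by rewrite subr_gt0 rate_lt2.
(* The 4 and one factor [n.+1] come from [leaves_bound], the rest from the path time; as an exponent
   this number only has to be at least [m.+1]. *)
exists (algorithm_of p), (4 * m.+3)%N => V e e_sym _ X hX.
set n := #|V|; set M := adjacency e.
have hM : size M = n := size_adjacency e.
have hr : all (fun r => size r == n) M := size_adjacency_rows e.
have hB : size (bits X) = n := size_bits X.
have hn : (n <= C * count id (bits X))%N.
  rewrite count_bits -(ler_nat R) natrM.
  apply: (@le_trans _ _ (d^-1 * #|X|%:R)); last by rewrite ler_wpM2r // ltW.
  by rewrite ler_pdivlMl.
have [t [h1 h2 h3]] := search_tree_of_algorithm p (data_of_instance e X).
have hsp : spine (hd (data_of_instance e X)) = n.
  by rewrite data_of_instanceE /= spine_enc_list.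
rewrite hsp in h2 h3.
have hsem : leaves t = m_main k D s b n M (bits X).
  by rewrite h3 data_of_instanceE sem_main.
have k0 : (0 < k)%N by apply: block_size_gt0.
have D0 : (0 < D)%N by apply: block_overlap_gt0.
have [q [w [E [hmain hE hsE hrows _]]]] := m_main_prep k0 D0 hM hr hB.
have hEs : all (sized_item n) E by case: hE => G1 _ _ _ _; apply/allP => i /G1 /eqP.
have hst : size (st_of n (bits X) E) = n by rewrite size_mkseq.
set c0 : ctl := (q, ((k * D * q).+1, w)) in hmain.
have ha : sized n (c0, st_of n (bits X) E) by apply/eqP.
have hvalid A := valid_bits e_sym hrows X A.
have hpath : (path_time t <= m.+3 * n.+1 ^ m)%N.
  apply: leq_trans h2 _; apply: leq_trans (leq_add (ptime_le n p) (leqnn 3)) _.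
  have x0 : (0 < n.+1 ^ m)%N by rewrite expn_gt0.
  by rewrite -/m; move: (n.+1 ^ m)%N x0 => x x0; lia.
exists t; split; first exact: h1.
- apply: leq_trans hpath _; apply: leq_mul; first by rewrite leq_pmull.
  by rewrite leq_pexp2l //; lia.
- split=> [v /has_leafE|A hA].
    rewrite hsem hmain check_main // => /mapP[r hr' ->] /=.
    case: ifP => [hv|_]; last by left.
    have hsz : size (map is_in r.2) = #|V|.
      have := chosen_main D ha hEs => /allP /(_ r hr') /andP[/eqP h _].
      by rewrite size_map.
    have [A hAr] := bits_surj hsz; right; exists A.
    by rewrite -hvalid -hAr hv /found data_of_setE -hAr.
  apply/has_leafE; rewrite hsem hmain check_main //.
  have hv : valid E (bits X) (bits A) by rewrite hvalid.
  (* The unit with which [b] starts makes it exceed [k * D * q], as required here. *)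
  have [c hc] := path_main k0 hE (size_bits A) hB hv w (leqnn (k * D * q).+1).
  apply/mapP; exists (c, decided (fun j => nth false (bits A) j) n) => //=.
  rewrite decided_chosen ?size_bits // map_is_in_chosen hv.
  by rewrite /found data_of_setE.
- have -> : 2 - (2 - rate R C) = rate R C by ring.
  have hl : (size (leaves t))%:R <= 4 * n.+1%:R * rate R C ^+ #|X|.
    by rewrite hsem -(count_bits X); apply: leaves_bound.
  apply: (@le_trans _ _ ((size (leaves t))%:R * (m.+3 * n.+1 ^ m)%:R)).
    rewrite -natrM ler_nat; apply: leq_trans (total_time_le t) _.
    by rewrite leq_mul2l hpath orbT.
  apply: (@le_trans _ _ (4 * n.+1%:R * rate R C ^+ #|X| * (m.+3 * n.+1 ^ m)%:R)).
    by rewrite ler_wpM2r.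
  rewrite time_product.
  move: m {hpath} => m; rewrite ler_wpM2r ?exprn_ge0 ?rate_ge0 //.
  by rewrite ler_nat leq_mul2l leq_pexp2l ?orbT //; lia.
Qed.
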